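(* Let $\varphi_*$ be a parametrized dynamical system over $\Lambda=\mathbb R$ (on a compact metric space) conjugate to the canonical parametrization $\psi_*$ for the pitchfork bifurcation. Then $\mathcal A^{\varphi_*}$ is acyclic (i.e. $H^k(\Lambda;\mathcal A^{\varphi_*})=0$ for all $k\ge1$) and $$H^0(\Lambda;\mathcal A^{\varphi_*})\cong\mathbb Z_2^3 .$$ Moreover, there exists a value $\lambda_0\in\mathbb R$ such that $$H^k(\Lambda,\Lambda';\mathcal A^{\varphi_*})\cong\begin{cases}\mathbb Z_2^2&\text{if }k=1\text{ and }a>\lambda_0,\\0&\text{if }k\ne1\text{ or }a\le\lambda_0,\end{cases}$$ where $\Lambda'=[a,\infty)$, $a\in\mathbb R$. Furthermore, for $\Lambda':=(-\infty,a]$ one has $H^k(\Lambda,\Lambda';\mathcal A^{\varphi_*})\cong0$ for all $k$ and for all $a\in\mathbb R$.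
   Context: Canonical pitchfork parametrization $\psi_*\colon\Lambda\to\mathbf{DS}(\mathbb T,X)$: phase space $X=\mathbb R\cup\{-\infty,\infty\}$, the two-point compactification of $\mathbb R$; time space $\mathbb T=\mathbb R^+$; parameter space $\Lambda=\mathbb R$. The parametrized flow is defined via the differential equation $\dot x=\lambda x-x^3$, $x\in\mathbb R$, $\lambda\in\mathbb R$, with $+\infty$ and $-\infty$ repelling fixed points. Before the bifurcation point $\lambda=0$ there is besides these a single attracting fixed point $x=0$; after $\lambda=0$ there are two additional attracting fixed points $x=\pm x_\lambda$ and $x=0$ has become a repelling fixed point. General definitions. Time space $\mathbb T\in\{\mathbb Z,\mathbb Z^+,\mathbb R,\mathbb R^+\}$ with usual topology. A dynamical system on a compact space $X$ is a continuous map $\phi\colon\mathbb T\times X\to X$ with $\phi(0,x)=x$ and $\phi(t,\phi(s,x))=\phi(t+s,x)$; $\phi_t=\phi(t,\cdot)$. $\mathbf{DS}(\mathbb T,X)$ is the set of dynamical systems with the compact-open topology. Attractors: $\omega_\phi(U)=\bigcap_{t\ge0}\mathrm{cl}\bigcup_{s\ge t}\phi_s(U)$; $U\subset X$ is an attracting neighborhood ($U\in\mathsf{ANbhd}(\phi)$) if $\omega_\phi(U)\subset\mathrm{int}\,U$; an attractor is a set $A=\omega_\phi(U)$ with $U\in\mathsf{ANbhd}(\phi)$. The set $\mathsf{Att}(\phi)$ of attractors is a bounded distributive lattice with $A\vee A'=A\cup A'$, $A\wedge A'=\omega_\phi(A\cap A')$, bottom $\emptyset$, top $\omega_\phi(X)$.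 Parametrized dynamical system over $\Lambda$ on $X$: a continuous map $\varphi\colon\mathbb T\times X\times\Lambda\to X$ with $\phi^\lambda:=\varphi(\cdot,\cdot,\lambda)\in\mathbf{DS}(\mathbb T,X)$ for all $\lambda$; it is identified with its transpose $\varphi_*\colon\lambda\mapsto\phi^\lambda$. Attractor sheaf: let $\mathcal S$ be the sheaf of bounded distributive lattices on $\Lambda$ with $\mathcal S(\Omega)$ the set of maps $\lambda\mapsto A_\lambda\in\mathsf{Att}(\phi^\lambda)$, $\lambda\in\Omega$, such that each $\mu\in\Omega$ has an open neighborhood $\Omega_0\subset\Omega$ and a set $U\subset X$ with $U\in\mathsf{ANbhd}(\phi^\lambda)$ and $A_\lambda=\omega_{\phi^\lambda}(U)$ for all $\lambda\in\Omega_0$; operations are pointwise. (This is the sheaf of sections of the pullback by $\varphi_*$ of the étale space of pairs $(\phi,A)$, $A\in\mathsf{Att}(\phi)$.) For a bounded distributive lattice $L$, $\mathsf R L$ is its Booleanization (minimal Boolean extension, i.e. the Boolean algebra of clopen subsets of the Priestley spectrum of $L$) regarded as a Boolean ring with symmetric difference as sum and intersection as product. $\mathcal A^{\varphi_*}$ is the sheafification of the presheaf of rings $\Omega\mapsto\mathsf R(\mathcal S(\Omega))$; its stalk at $\lambda$ is $\mathsf R\,\mathsf{Att}(\phi^\lambda)$. $H^k(\Lambda;\mathcal F)$ is sheaf cohomology, and $H^k(\Lambda,\Lambda';\mathcal F)$ is relative sheaf cohomology in the sense of Bredon, fitting in the long exact sequence of the pair $(\Lambda,\Lambda')$. Isomorphisms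 are of abelian groups. Conjugacy: $\varphi_*\colon\Lambda\to\mathbf{DS}(\mathbb T,Y)$ and $\psi_*\colon\Lambda\to\mathbf{DS}(\mathbb T,X)$ are conjugate if there are continuous $h\colon\Lambda\times Y\to X$ and $\tau\colon\Lambda\times\mathbb T\times Y\to\mathbb T$ such that (i) for every $\lambda$, $h^\lambda=h(\lambda,\cdot)$ is a homeomorphism, $\tau(\lambda,0,y)=0$, $t\mapsto\tau(\lambda,t,y)$ is strictly monotone and bijective on $\mathbb T$ for each $y$, and $h^\lambda(\phi^\lambda(t,y))=\psi^\lambda(\tau(\lambda,t,y),h^\lambda(y))$; (ii) $h^\lambda(Y_i)=X_i$ uniformly for all $\lambda\in\Lambda$, where $Y_i$ and $X_i$ are the connected components of $Y$ and $X$ (i.e. with an indexing independent of $\lambda$).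
   Formalization: With ±∞ fixed, x'=λx−x³ is discontinuous at ±∞ on the compactified line (solutions come down from infinity in finite time), so the canonical flow is taken for any x'=g(λ,x)(λx−x³) with g continuous and positive. *)

(* Defs.v *)
From HB Require Import structures.
From mathcomp Require Import all_boot all_order all_algebra.
From mathcomp Require Import generic_quotient ring_quotient.
From mathcomp Require Import all_classical all_reals all_analysis.

Set Implicit Arguments.
Unset Strict Implicit.
Unset Printing Implicit Defensive.

Import Order.TTheory GRing.Theory Num.Theory.
Import numFieldNormedType.Exports.

Local Open Scope classical_set_scope.
Local Open Scope ring_scope.
Local Open Scope quotient_scope.

Definition zmod_iso (V W : zmodType) : Prop :=
  exists f : {additive V -> W}, bijective f.

Definition zmod_zero (V : zmodType) : Prop := forall x : V, x = 0.

Section Kernel.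
Variables (V W : zmodType) (f : {additive V -> W}).

Definition kernel_pred : pred V := fun x => f x == 0.

Lemma kernel_zmod_closed : zmod_closed kernel_pred.
Proof.
split=> [|x y]; rewrite !unfold_in /kernel_pred ?raddf0 ?eqxx//.
by move=> /eqP fx /eqP fy; rewrite raddfB fx fy subrr.
Qed.

Definition kernel := {x : V | kernel_pred x}.
HB.instance Definition _ := SubChoice.on kernel.
HB.instance Definition _ :=
  GRing.SubChoice_isSubZmodule.Build V kernel_pred kernel kernel_zmod_closed.

End Kernel.

Section Image.
Variables (V W : zmodType) (f : {additive V -> W}).

Definition image_pred : pred W := fun y => `[< exists x, f x = y >].

Lemma image_zmod_closed : zmod_closed image_pred.
Proof.
split=> [|_ _ /asboolP[x <-] /asboolP[y <-]]; apply/asboolP.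
  by exists 0; rewrite raddf0.
by exists (x - y); rewrite raddfB.
Qed.

HB.instance Definition _ :=
  GRing.isZmodClosed.Build W image_pred image_zmod_closed.

End Image.

Record cochain_complex := CochainComplex {
  cochains :> nat -> zmodType;
  cobd : forall n, {additive cochains n -> cochains n.+1};
  cobdK : forall n x, cobd n.+1 (cobd n x) = 0 }.

Section Cohomology.
Variables (C : cochain_complex) (n : nat).

Definition cocycle := kernel (cobd C n).
HB.instance Definition _ := GRing.Zmodule.on cocycle.

Definition is_cobd (n : nat) : C n -> Prop :=
  match n with
  | 0 => fun x => x = 0
  | m.+1 => fun x => exists y, cobd C m y = x
  end.

Lemma is_cobd0 m : is_cobd (0 : C m).
Proof. by case: m => [|m]//=; exists 0; rewrite raddf0. Qed.

Lemma is_cobdB m (x y : C m) : is_cobd x -> is_cobd y -> is_cobd (x - y).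
Proof.
case: m x y => [|m] x y /=; first by move=> -> ->; rewrite subrr.
by move=> [u <-] [v <-]; exists (u - v); rewrite raddfB.
Qed.

Definition coboundary : pred cocycle := fun z => `[< is_cobd (val z) >].

Lemma coboundary_zmod_closed : zmod_closed coboundary.
Proof.
split=> [|x y /asboolP cx /asboolP cy]; apply/asboolP.
  by rewrite raddf0; exact: is_cobd0.
by rewrite raddfB; exact: is_cobdB.
Qed.

HB.instance Definition _ :=
  GRing.isZmodClosed.Build cocycle coboundary coboundary_zmod_closed.

Definition coboundaries : zmodClosed cocycle :=
  GRing.ZmodClosed.clone cocycle coboundary _.

Definition cohomology : zmodType := Quotient.quot coboundaries.

End Cohomology.

Record cochain_map (C D : cochain_complex) := CochainMap {
  cmap :> forall n, {additive C n -> D n};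
  cmap_cobd : forall n x, cmap n.+1 (cobd C n x) = cobd D n (cmap n x) }.

Section KernelComplex.
Variables (C D : cochain_complex) (f : cochain_map C D).

Lemma ker_cobd_subproof n (x : kernel (f n)) :
  kernel_pred (f n.+1) (cobd C n (val x)).
Proof.
by rewrite /kernel_pred cmap_cobd; have /eqP-> := valP x; rewrite raddf0.
Qed.

Definition ker_cobd n (x : kernel (f n)) : kernel (f n.+1) :=
  exist _ (cobd C n (val x)) (ker_cobd_subproof x).

Lemma ker_cobd_additive n : zmod_morphism (@ker_cobd n).
Proof. by move=> x y; apply/val_inj; rewrite /= !raddfB. Qed.
HB.instance Definition _ n :=
  GRing.isZmodMorphism.Build _ _ (@ker_cobd n) (@ker_cobd_additive n).

Lemma ker_cobdK n x : ker_cobd (@ker_cobd n x) = 0.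
Proof. by apply/val_inj; rewrite /= cobdK. Qed.

Definition ker_complex : cochain_complex :=
  @CochainComplex (fun n => kernel (f n)) (fun n => @ker_cobd n) ker_cobdK.

End KernelComplex.

Record opens (T : topologicalType) := Opens {
  oset :> set T;
  oset_open : open oset }.

Definition opensT (T : topologicalType) : opens T := Opens openT.

Definition opensI (T : topologicalType) (U V : opens T) : opens T :=
  Opens (openI (oset_open U) (oset_open V)).

Record presheaf (T : topologicalType) := Presheaf {
  sections :> opens T -> zmodType;
  res : forall U V : opens T, V `<=` U -> {additive sections U -> sections V};
  res_id : forall (U : opens T) (h : U `<=` U) s, res h s = s;
  res_comp : forall (U V W : opens T) (h : V `<=` U) (k : W `<=` V) (l : W `<=` U) s,
    res k (res h s) = res l s }.

Arguments res {T p U V}.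

(* [germs F S] is the colimit of [F U] over the open [U] containing [S]: the
   stalk for [S = [set x]], and the value at [W] of the presheaf inverse image
   along [f] for [S = f @` W]. *)
Section Germs.
Variables (T : topologicalType) (F : presheaf T) (S : set T).

Record presection := Presection {
  pdom : opens T;
  pdom_sub : S `<=` pdom;
  psec : F pdom }.

HB.instance Definition _ := gen_eqMixin presection.
HB.instance Definition _ := gen_choiceMixin presection.

Definition same_germ (a b : presection) : bool :=
  `[< exists (W : opens T) (hWa : W `<=` pdom a) (hWb : W `<=` pdom b),
        S `<=` W /\ res hWa (psec a) = res hWb (psec b) >].

Lemma same_germ_equiv : equiv_class_of same_germ.
Proof.
split=> [a|a b|b a c].
- by apply/asboolP; exists (pdom a), (@subset_refl _ _), (@subset_refl _ _);
     split=> //; exact: pdom_sub.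
- by apply/asboolP/asboolP => -[W [ha [hb [SW e]]]]; exists W, hb, ha.
- move=> /asboolP[W [ha [hb [SW e]]]] /asboolP[W' [hb' [hc [SW' e']]]].
  apply/asboolP; exists (opensI W W').
  have WW : opensI W W' `<=` W by move=> x [].
  have WW' : opensI W W' `<=` W' by move=> x [].
  exists (subset_trans WW ha), (subset_trans WW' hc); split.
    by move=> x Sx; split; [exact: SW|exact: SW'].
  rewrite -(res_comp ha WW) e (res_comp hb WW (subset_trans WW hb)).
  by rewrite -(res_comp hc WW') -e' (res_comp hb' WW' (subset_trans WW hb)).
Qed.

Canonical same_germ_rel := EquivRelPack same_germ_equiv.
Canonical same_germ_encModRel := defaultEncModRel same_germ.

Definition germs := {eq_quot same_germ}.
HB.instance Definition _ : EqQuotient _ same_germ germs := EqQuotient.on germs.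
HB.instance Definition _ := Choice.on germs.

Definition germ (U : opens T) (h : S `<=` U) (s : F U) : germs :=
  \pi_germs (Presection h s).

Lemma germP (U V : opens T) (hU : S `<=` U) (hV : S `<=` V) s t :
  germ hU s = germ hV t <->
  exists (W : opens T) (hWU : W `<=` U) (hWV : W `<=` V),
    S `<=` W /\ res hWU s = res hWV t.
Proof.
split.
  by move/eqquotP => /asboolP.
by move=> h; apply/eqquotP/asboolP.
Qed.

Lemma germ_res (U V : opens T) (hU : S `<=` U) (hV : S `<=` V)
    (hVU : V `<=` U) s : germ hV (res hVU s) = germ hU s.
Proof.
apply/germP; exists V, (@subset_refl _ _), hVU; split=> //.
by rewrite res_id.
Qed.

Lemma germW (a : germs) : exists (U : opens T) (h : S `<=` U) s, a = germ h s.
Proof.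
exists (pdom (repr a)), (@pdom_sub (repr a)), (psec (repr a)).
by rewrite /germ -[LHS]reprK; case: (repr a).
Qed.

Lemma germW2 (a b : germs) :
  exists (U : opens T) (h : S `<=` U) s t, a = germ h s /\ b = germ h t.
Proof.
have [U [hU [s ->]]] := germW a; have [V [hV [t ->]]] := germW b.
have h : S `<=` opensI U V by move=> x Sx; split; [exact: hU|exact: hV].
have hl : opensI U V `<=` U by move=> x [].
have hr : opensI U V `<=` V by move=> x [].
by exists (opensI U V), h, (res hl s), (res hr t); rewrite !germ_res.
Qed.

Definition germ0 : germs := germ (@subsetT _ S : S `<=` opensT T) 0.

Definition germN (a : germs) : germs :=
  germ (@pdom_sub (repr a)) (- psec (repr a)).

Lemma subl (a b : presection) : opensI (pdom a) (pdom b) `<=` pdom a.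
Proof. by move=> x []. Qed.

Lemma subr (a b : presection) : opensI (pdom a) (pdom b) `<=` pdom b.
Proof. by move=> x []. Qed.

Lemma subI (a b : presection) : S `<=` opensI (pdom a) (pdom b).
Proof. by move=> x Sx; split; exact: pdom_sub. Qed.

Definition germD (a b : germs) : germs :=
  germ (@subI (repr a) (repr b))
    (res (@subl _ _) (psec (repr a)) + res (@subr _ _) (psec (repr b))).

Lemma germ_repr (a : germs) : germ (@pdom_sub (repr a)) (psec (repr a)) = a.
Proof. by rewrite /germ -[RHS]reprK; case: (repr a). Qed.

Lemma germ0E (U : opens T) (h : S `<=` U) : germ0 = germ h 0.
Proof.
by apply/germP; exists U, (@subsetT _ _), (@subset_refl _ _); rewrite !raddf0.
Qed.

Lemma germNE (U : opens T) (h : S `<=` U) s : germN (germ h s) = germ h (- s).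
Proof.
apply/germP; have /germP[W [h1 [h2 [SW e]]]] := germ_repr (germ h s).
by exists W, h1, h2; split=> //; rewrite !raddfN e.
Qed.

Lemma germDE (U : opens T) (h : S `<=` U) s t : germD (germ h s) (germ h t) = germ h (s + t).
Proof.
apply/germP; have /germP[W [h1 [h2 [SW e]]]] := germ_repr (germ h s).
have /germP[W' [h1' [h2' [SW' e']]]] := germ_repr (germ h t).
have hW : opensI W W' `<=` W by move=> x [].
have hW' : opensI W W' `<=` W' by move=> x [].
have k : opensI W W' `<=` opensI (pdom (repr (germ h s))) (pdom (repr (germ h t))).
  by move=> x [Wx W'x]; split; [exact: (h1 x Wx)|exact: (h1' x W'x)].
exists (opensI W W'), k, (subset_trans hW h2); split.
  by move=> x Sx; split; [exact: SW|exact: SW'].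
rewrite !raddfD; congr +%R.
  rewrite (res_comp _ _ (subset_trans hW h1)) -(res_comp h1 hW) e.
  exact: res_comp.
rewrite (res_comp _ _ (subset_trans hW' h1')) -(res_comp h1' hW') e'.
exact: res_comp.
Qed.

Lemma germDC : commutative germD.
Proof.
by move=> a b; have [U [h [s [t [-> ->]]]]] := germW2 a b; rewrite !germDE addrC.
Qed.

Lemma germDA : associative germD.
Proof.
move=> a b c; have [U [h [s [t [-> ->]]]]] := germW2 a b.
have [V [k [u ->]]] := germW c.
have kl : opensI U V `<=` U by move=> x [].
have kr : opensI U V `<=` V by move=> x [].
have hk : S `<=` opensI U V by move=> x Sx; split; [exact: h|exact: k].
by rewrite -!(germ_res h hk kl) -(germ_res k hk kr) !germDE addrA.
Qed.

Lemma germD0 : left_id germ0 germD.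
Proof.
by move=> a; have [U [h [s ->]]] := germW a; rewrite (germ0E h) germDE add0r.
Qed.

Lemma germDN : left_inverse germ0 germN germD.
Proof.
by move=> a; have [U [h [s ->]]] := germW a; rewrite germNE germDE addNr -germ0E.
Qed.

HB.instance Definition _ :=
  GRing.isZmodule.Build germs germDA germDC germD0 germDN.

Lemma germ_additive (U : opens T) (h : S `<=` U) : zmod_morphism (@germ U h).
Proof. by move=> s t; rewrite -germDE -germNE. Qed.
HB.instance Definition _ (U : opens T) (h : S `<=` U) :=
  GRing.isZmodMorphism.Build (F U) germs (@germ U h) (@germ_additive U h).

End Germs.


Definition stalk (T : topologicalType) (F : presheaf T) (x : T) := germs F [set x].
HB.instance Definition _ T F x := GRing.Zmodule.on (@stalk T F x).

Lemma sub1 (T : Type) (A : set T) (x : A) : [set val x] `<=` A.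
Proof. by move=> _ ->; exact: set_valP. Qed.

Section GermsRestrict.
Variables (T : topologicalType) (F : presheaf T) (S S' : set T) (h : S' `<=` S).

Definition germs_res (a : germs F S) : germs F S' :=
  germ (subset_trans h (@pdom_sub _ _ _ (repr a))) (psec (repr a)).

Lemma germs_resE (U : opens T) (hU : S `<=` U) (hU' : S' `<=` U) s :
  germs_res (germ hU s) = germ hU' s.
Proof.
apply/germP; have /germP[W [h1 [h2 [SW e]]]] := germ_repr (germ hU s).
by exists W, h1, h2; split=> //; exact: subset_trans SW.
Qed.

Lemma germs_res_additive : zmod_morphism germs_res.
Proof.
move=> a b; have [U [hU [s [t [-> ->]]]]] := germW2 a b.
have hU' := subset_trans h hU.
by rewrite -raddfB !(germs_resE _ hU') raddfB.
Qed.
HB.instance Definition _ :=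
  GRing.isZmodMorphism.Build _ _ germs_res germs_res_additive.

End GermsRestrict.

Section Product.
Variables (I : Type) (V : I -> zmodType).

Definition zprod := forall i, V i.
HB.instance Definition _ := Choice.on zprod.

Definition zprod0 : zprod := fun=> 0.
Definition zprodN (f : zprod) : zprod := fun i => - f i.
Definition zprodD (f g : zprod) : zprod := fun i => f i + g i.

Lemma zprodA : associative zprodD.
Proof. by move=> f g h; apply: functional_extensionality_dep => i; exact: addrA. Qed.
Lemma zprodC : commutative zprodD.
Proof. by move=> f g; apply: functional_extensionality_dep => i; exact: addrC. Qed.
Lemma zprod0r : left_id zprod0 zprodD.
Proof. by move=> f; apply: functional_extensionality_dep => i; exact: add0r. Qed.
Lemma zprodNr : left_inverse zprod0 zprodN zprodD.
Proof. by move=> f; apply: functional_extensionality_dep => i; exact: addNr. Qed.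

HB.instance Definition _ :=
  GRing.isZmodule.Build zprod zprodA zprodC zprod0r zprodNr.

End Product.

Definition incl (T : Type) (U V : set T) (h : V `<=` U) (x : V) : U :=
  SigSub (mem_set (h _ (set_valP x))).

(* [serration F U] is the product of the stalks of [F] over the points of [U],
   i.e. the not necessarily continuous sections of the etale space (Bredon's
   C^0).  Sheafification selects the serrations locally induced by [F]. *)
Section Serrations.
Variables (T : topologicalType) (F : presheaf T).

Definition serration (U : opens T) := zprod (fun x : U => stalk F (val x)).
HB.instance Definition _ U := GRing.Zmodule.on (serration U).

Definition serration_res (U V : opens T) (h : V `<=` U) (s : serration U) :
  serration V := fun x => s (incl h x).

Lemma serration_res_additive U V h : zmod_morphism (@serration_res U V h).
Proof. by []. Qed.
HB.instance Definition _ U V h :=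
  GRing.isZmodMorphism.Build _ _ (@serration_res U V h)
    (@serration_res_additive U V h).

Lemma inclE (U : set T) (h : U `<=` U) (x : U) : incl h x = x.
Proof. exact/val_inj. Qed.

Lemma serration_res_id U h s : @serration_res U U h s = s.
Proof.
apply: functional_extensionality_dep => -[x xU].
by rewrite /serration_res /incl /=; congr (s (SigSub _)); exact: Prop_irrelevance.
Qed.

Lemma serration_res_comp U V W h k l s :
  @serration_res V W k (@serration_res U V h s) = @serration_res U W l s.
Proof.
apply: functional_extensionality_dep => -[x xW].
by rewrite /serration_res /incl /=; congr (s (SigSub _)); exact: Prop_irrelevance.
Qed.

Definition serrations : presheaf T :=
  @Presheaf T (fun U => serration U) (fun U V h => @serration_res U V h)
    serration_res_id serration_res_comp.

Definition to_serration (U : opens T) (s : F U) : serrations U :=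
  fun x => germ (@sub1 T U x) s.

Lemma to_serration_additive U : zmod_morphism (@to_serration U).
Proof.
by move=> s t; apply: functional_extensionality_dep => x; exact: raddfB.
Qed.
HB.instance Definition _ U :=
  GRing.isZmodMorphism.Build _ _ (@to_serration U) (@to_serration_additive U).

Lemma to_serration_res (U V : opens T) (h : V `<=` U) s :
  to_serration (res h s) = res h (to_serration s).
Proof. by apply: functional_extensionality_dep => x; exact: germ_res. Qed.

Definition locally_section (U : opens T) : pred (serrations U) := fun s =>
  `[< forall x : U, exists (V : opens T) (h : V `<=` U) (t : F V),
        oset V (val x) /\ res h s = to_serration t >].

Lemma locally_section_zmod_closed U : zmod_closed (@locally_section U).
Proof.
split=> [|s t /asboolP hs /asboolP ht]; apply/asboolP => x.
  by exists U, (@subset_refl _ _), 0; split; [exact: set_valP|rewrite !raddf0].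
have [V [hV [s' [Vx es]]]] := hs x; have [W [hW [t' [Wx et]]]] := ht x.
have kV : opensI V W `<=` V by move=> y [].
have kW : opensI V W `<=` W by move=> y [].
exists (opensI V W), (subset_trans kV hV), (res kV s' - res kW t'); split=> //.
rewrite raddfB (raddfB (@to_serration _)); congr (_ - _).
  transitivity (to_serration (res kV s')) => //.
  by rewrite to_serration_res -es (res_comp _ _ (subset_trans kV hV)).
transitivity (to_serration (res kW t')) => //.
by rewrite to_serration_res -et (res_comp _ _ (subset_trans kV hV)).
Qed.

Definition sheaf_section (U : opens T) :=
  {s : serrations U | locally_section s}.
HB.instance Definition _ U := SubChoice.on (sheaf_section U).
HB.instance Definition _ U :=
  GRing.SubChoice_isSubZmodule.Build _ _ (sheaf_section U)
    (@locally_section_zmod_closed U).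

Lemma sheaf_res_subproof (U V : opens T) (h : V `<=` U) (s : sheaf_section U) :
  locally_section (res h (val s)).
Proof.
apply/asboolP => x; have /asboolP/(_ (incl h x))[W [k [t [Wx e]]]] := valP s.
have lV : opensI V W `<=` V by move=> y [].
have lW : opensI V W `<=` W by move=> y [].
exists (opensI V W), lV, (res lW t); split.
  by split=> //; exact: set_valP.
rewrite to_serration_res -e (res_comp _ _ (subset_trans lV h)).
by rewrite (res_comp _ _ (subset_trans lV h)).
Qed.

Definition sheaf_res (U V : opens T) (h : V `<=` U) (s : sheaf_section U) :
  sheaf_section V := exist _ (res h (val s)) (sheaf_res_subproof h s).

Lemma sheaf_res_additive U V h : zmod_morphism (@sheaf_res U V h).
Proof. by move=> s t; apply/val_inj; rewrite /= !raddfB. Qed.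
HB.instance Definition _ U V h :=
  GRing.isZmodMorphism.Build _ _ (@sheaf_res U V h) (@sheaf_res_additive U V h).

Lemma sheaf_res_id U h s : @sheaf_res U U h s = s.
Proof. by apply/val_inj; exact: (@res_id _ serrations). Qed.

Lemma sheaf_res_comp U V W h k l s :
  @sheaf_res V W k (@sheaf_res U V h s) = @sheaf_res U W l s.
Proof. by apply/val_inj; exact: (@res_comp _ serrations). Qed.

Definition sheafify : presheaf T :=
  @Presheaf T (fun U => sheaf_section U) (fun U V h => @sheaf_res U V h)
    sheaf_res_id sheaf_res_comp.

Lemma to_sheaf_subproof (U : opens T) (s : F U) :
  locally_section (to_serration s).
Proof.
apply/asboolP => x; exists U, (@subset_refl _ _), s; split; first exact: set_valP.
by rewrite (@res_id _ serrations).
Qed.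

Definition to_sheaf (U : opens T) (s : F U) : sheafify U :=
  exist _ (to_serration s) (to_sheaf_subproof s).

Lemma to_sheaf_additive U : zmod_morphism (@to_sheaf U).
Proof. by move=> s t; apply/val_inj; rewrite /= !raddfB. Qed.
HB.instance Definition _ U :=
  GRing.isZmodMorphism.Build _ _ (@to_sheaf U) (@to_sheaf_additive U).

Definition germ_image (U : opens T) : zmodClosed (serrations U) :=
  GRing.ZmodClosed.clone _ (image_pred (@to_serration U)) _.

Definition qserration (U : opens T) := Quotient.quot (germ_image U).
HB.instance Definition _ U := GRing.Zmodule.on (qserration U).

Definition qser (U : opens T) (s : serrations U) : qserration U := \pi s.

Lemma qser_additive U : zmod_morphism (@qser U).
Proof. by move=> s t; exact: raddfB. Qed.
HB.instance Definition _ U :=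
  GRing.isZmodMorphism.Build _ _ (@qser U) (@qser_additive U).

Lemma qser_eq0 U (s : serrations U) :
  (qser s = 0) <-> exists t, to_serration t = s.
Proof.
have e0 : qser (0 : serrations U) = 0 by exact: raddf0.
split=> [h|h].
  have : s - 0 \in germ_image U.
    by rewrite Quotient.idealrBE; apply/eqP; rewrite -/(qser s) h -e0.
  by rewrite subr0 => /asboolP.
rewrite -e0; apply/eqP; rewrite /qser -Quotient.idealrBE subr0; exact/asboolP.
Qed.

Lemma qserW U (a : qserration U) : exists s, a = qser s.
Proof. by exists (repr a); rewrite /qser reprK. Qed.

Definition quot_res (U V : opens T) (h : V `<=` U) (a : qserration U) :
  qserration V := qser (res h (repr a)).

Lemma quot_resE (U V : opens T) (h : V `<=` U) (s : serrations U) :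
  quot_res h (qser s) = qser (res h s).
Proof.
apply/eqP; rewrite -subr_eq0 -!raddfB; apply/eqP/qser_eq0.
have /qser_eq0[t et] : qser (repr (qser s) - s) = 0.
  by rewrite raddfB /= {1}/qser reprK subrr.
by exists (res h t); rewrite to_serration_res et.
Qed.

Lemma quot_res_additive U V h : zmod_morphism (@quot_res U V h).
Proof.
move=> a b; have [s ->] := qserW a; have [t ->] := qserW b.
by rewrite -raddfB !quot_resE !raddfB.
Qed.
HB.instance Definition _ U V h :=
  GRing.isZmodMorphism.Build _ _ (@quot_res U V h) (@quot_res_additive U V h).

Lemma quot_res_id U h s : @quot_res U U h s = s.
Proof. by have [a ->] := qserW s; rewrite quot_resE res_id. Qed.

Lemma quot_res_comp U V W h k l s :
  @quot_res V W k (@quot_res U V h s) = @quot_res U W l s.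
Proof. by have [a ->] := qserW s; rewrite !quot_resE (res_comp _ _ l). Qed.

Definition quot_serrations : presheaf T :=
  @Presheaf T (fun U => qserration U) (fun U V h => @quot_res U V h)
    quot_res_id quot_res_comp.

End Serrations.

(* Bredon's canonical resolution: Z^0 = F, C^n = C^0(Z^n), Z^(n+1) = C^n / Z^n.
   The quotients [syzygy] are formed as presheaves: C^0 only depends on stalks,
   so sheafifying them would not change [godement]. *)
Section Godement.
Variables (T : topologicalType) (F : presheaf T).

Fixpoint syzygy (n : nat) : presheaf T :=
  if n is m.+1 then quot_serrations (syzygy m) else F.

Definition godement n : presheaf T := serrations (syzygy n).

Definition godement_cobd n (U : opens T) :
    {additive godement n U -> godement n.+1 U} :=
  (@to_serration T (syzygy n.+1) U) \o (@qser T (syzygy n) U).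

Lemma godement_cobdK n U x : godement_cobd n.+1 U (godement_cobd n U x) = 0.
Proof.
rewrite /godement_cobd /=; rewrite [X in to_serration X](_ : _ = 0) ?raddf0//.
by apply/qser_eq0; exists (qser x).
Qed.

Definition godement_complex : cochain_complex :=
  CochainComplex (fun n => @godement_cobdK n (opensT T)).

Definition sheaf_cohomology (k : nat) : zmodType :=
  cohomology godement_complex k.

End Godement.

(* A [cohom_map] is an f-cohomomorphism in the sense of Bredon; it induces a
   map of canonical resolutions. *)
Section Cohomomorphism.
Variables (X T : topologicalType) (f : X -> T) (cf : continuous f).

Definition opens_pre (U : opens T) : opens X :=
  Opens (proj1 (continuousP f) cf _ (oset_open U)).

Record cohom_map (F : presheaf T) (G : presheaf X) := CohomMap {
  chom : forall U : opens T, {additive F U -> G (opens_pre U)};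
  chom_res : forall (U V : opens T) (h : V `<=` U)
      (k : opens_pre V `<=` opens_pre U) s,
    chom V (res h s) = res k (chom U s) }.

Arguments chom {F G} _ {U}.

Section Induced.
Variables (F : presheaf T) (G : presheaf X) (phi : cohom_map F G).

Lemma pre1 (U : opens T) (x : X) : [set f x] `<=` U -> [set x] `<=` opens_pre U.
Proof. by move=> h _ ->; exact: h. Qed.

Definition chom_stalk (x : X) (a : stalk F (f x)) : stalk G x :=
  germ (pre1 (@pdom_sub _ _ _ (repr a))) (chom phi (psec (repr a))).

Lemma opens_preS (U V : opens T) (h : V `<=` U) : opens_pre V `<=` opens_pre U.
Proof. by move=> x; exact: h. Qed.

Lemma chom_stalkE x (U : opens T) (h : [set f x] `<=` U)
    (k : [set x] `<=` opens_pre U) s :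
  chom_stalk (germ h s : stalk F (f x)) = germ k (chom phi s).
Proof.
apply/germP; have /germP[W [h1 [h2 [SW e]]]] := germ_repr (germ h s).
exists (opens_pre W), (opens_preS h1), (opens_preS h2); split; first exact: pre1.
by rewrite -!chom_res e.
Qed.

Lemma chom_stalk_additive x : zmod_morphism (@chom_stalk x).
Proof.
move=> a b; have [U [hU [s [t [-> ->]]]]] := germW2 a b.
by rewrite -raddfB !(chom_stalkE _ (pre1 hU)) !raddfB.
Qed.
HB.instance Definition _ x :=
  GRing.isZmodMorphism.Build _ _ (@chom_stalk x) (@chom_stalk_additive x).

Definition pre_pt (U : opens T) (x : opens_pre U) : U :=
  SigSub (mem_set (set_valP x : oset U (f (val x)))).

Definition chom_ser (U : opens T) (s : serrations F U) :
  serrations G (opens_pre U) := fun x => chom_stalk (s (pre_pt x)).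

Lemma chom_ser_additive U : zmod_morphism (@chom_ser U).
Proof.
by move=> s t; apply: functional_extensionality_dep => x; exact: chom_stalk_additive.
Qed.
HB.instance Definition _ U :=
  GRing.isZmodMorphism.Build _ _ (@chom_ser U) (@chom_ser_additive U).

Lemma chom_ser_res (U V : opens T) (h : V `<=` U)
    (k : opens_pre V `<=` opens_pre U) (s : serrations F U) :
  chom_ser (res h s) = res k (chom_ser s).
Proof.
apply: functional_extensionality_dep => x; rewrite /chom_ser /=.
congr (chom_stalk (s (SigSub _))); exact: Prop_irrelevance.
Qed.

Definition serrations_map : cohom_map (serrations F) (serrations G) :=
  CohomMap chom_ser_res.

Lemma chom_ser_germ (U : opens T) (s : F U) :
  chom_ser (to_serration s) = to_serration (chom phi s).
Proof. by apply: functional_extensionality_dep => x; exact: chom_stalkE. Qed.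

Definition chom_quot (U : opens T) (a : quot_serrations F U) :
  quot_serrations G (opens_pre U) := qser (chom_ser (repr a)).

Lemma chom_quotE (U : opens T) (s : serrations F U) :
  chom_quot (qser s : quot_serrations F U) = qser (chom_ser s).
Proof.
apply/eqP; rewrite -subr_eq0 -!raddfB; apply/eqP/qser_eq0.
have /qser_eq0[t et] : qser (repr (qser s) - s) = 0.
  by rewrite raddfB /= {1}/qser reprK subrr.
by exists (chom phi t); rewrite -chom_ser_germ et.
Qed.

Lemma chom_quot_additive U : zmod_morphism (@chom_quot U).
Proof.
move=> a b; have [s ->] := qserW a; have [t ->] := qserW b.
by rewrite -raddfB !chom_quotE !raddfB.
Qed.
HB.instance Definition _ U :=
  GRing.isZmodMorphism.Build _ _ (@chom_quot U) (@chom_quot_additive U).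

Lemma chom_quot_res (U V : opens T) (h : V `<=` U)
    (k : opens_pre V `<=` opens_pre U) (a : quot_serrations F U) :
  chom_quot (res h a) = res k (chom_quot a).
Proof.
have [s ->] := qserW a; rewrite /= quot_resE !chom_quotE quot_resE.
by rewrite (chom_ser_res h k).
Qed.

Definition quot_serrations_map :
    cohom_map (quot_serrations F) (quot_serrations G) :=
  CohomMap chom_quot_res.

End Induced.

Fixpoint syzygy_map F G (phi : cohom_map F G) n :
    cohom_map (syzygy F n) (syzygy G n) :=
  match n with
  | 0 => phi
  | m.+1 => quot_serrations_map (syzygy_map phi m)
  end.

Section Godement_map.
Variables (F : presheaf T) (G : presheaf X) (phi : cohom_map F G).

Lemma pre_setT : opensT X `<=` opens_pre (opensT T).
Proof. by []. Qed.

Definition godement_map_fun n :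
    {additive godement F n (opensT T) -> godement G n (opensT X)} :=
  res pre_setT \o @chom_ser _ _ (syzygy_map phi n) (opensT T).

Lemma godement_map_cobd n x :
  godement_map_fun n.+1 (cobd (godement_complex F) n x) =
  cobd (godement_complex G) n (godement_map_fun n x).
Proof.
rewrite /= /godement_cobd /=.
rewrite (chom_ser_germ (quot_serrations_map (syzygy_map phi n))) /=.
rewrite chom_quotE.
rewrite -(quot_resE pre_setT).
symmetry; exact: (@to_serration_res _ (syzygy G n.+1) _ _ pre_setT).
Qed.

Definition godement_map : cochain_map (godement_complex F) (godement_complex G) :=
  @CochainMap (godement_complex F) (godement_complex G)
    godement_map_fun godement_map_cobd.

End Godement_map.

Section InverseImage.
Variable F : presheaf T.

Lemma imageS_opens (U V : opens X) : V `<=` U -> f @` V `<=` f @` U.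
Proof. exact: image_subset. Qed.

Lemma germs_res_id S (h : S `<=` S) (a : germs F S) : germs_res h a = a.
Proof. by have [U [hU [s ->]]] := germW a; exact: germs_resE. Qed.

Lemma germs_res_comp S S' S'' (h : S' `<=` S) (k : S'' `<=` S') (l : S'' `<=` S)
  (a : germs F S) : germs_res k (germs_res h a) = germs_res l a.
Proof.
have [U [hU [s ->]]] := germW a.
by rewrite (germs_resE h hU (subset_trans h hU)) !(germs_resE _ _ (subset_trans l hU)).
Qed.

Definition inverse_image_presheaf : presheaf X :=
  @Presheaf X (fun W => germs F (f @` W))
    (fun U V h => @germs_res T F _ _ (imageS_opens h))
    (fun U h s => germs_res_id _ s)
    (fun U V W h k l s => germs_res_comp _ _ _ s).

Definition inverse_image : presheaf X := sheafify inverse_image_presheaf.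

Lemma image_pre (U : opens T) : f @` opens_pre U `<=` U.
Proof. by move=> _ [x Ux <-]. Qed.

Definition pull_section (U : opens T) :
    {additive F U -> inverse_image (opens_pre U)} :=
  (@to_sheaf _ inverse_image_presheaf (opens_pre U))
    \o (@germ _ F _ U (@image_pre U)).

Lemma pull_section_res (U V : opens T) (h : V `<=` U)
    (k : opens_pre V `<=` opens_pre U) s :
  pull_section V (res h s) = res k (pull_section U s).
Proof.
apply/val_inj => /=.
rewrite -[RHS](to_serration_res (F := inverse_image_presheaf) k).
congr (@to_serration _ inverse_image_presheaf _ _) => /=.
rewrite (germs_resE _ _ (subset_trans (imageS_opens k) (@image_pre U))).
exact: germ_res.
Qed.

Definition inverse_image_map : cohom_map F inverse_image :=
  CohomMap pull_section_res.

End InverseImage.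
End Cohomomorphism.

(* Bredon's relative cohomology: C^*(T, A; F) is the kernel of the restriction
   C^*(T; F) -> C^*(A; F|A). *)
Section Relative.
Variables (T : topologicalType) (F : presheaf T) (A : set T).

Lemma continuous_set_val : continuous (set_val : A -> T).
Proof. exact: initial_continuous. Qed.

Definition relative_complex : cochain_complex :=
  ker_complex (godement_map (inverse_image_map continuous_set_val F)).

Definition relative_cohomology (k : nat) : zmodType :=
  cohomology relative_complex k.

End Relative.

(* [booleanization L] is the Boolean ring of clopen subsets of the Priestley
   spectrum: the prime ideals of [L] with the topology generated by the sets
   {p | a \in p} and their complements. *)
Section Priestley.
Context {d : Order.disp_t}.
Variable L : tbDistrLatticeType d.

Record prime_ideal := PrimeIdeal {
  pideal :> set L;
  pideal0 : pideal \bot%O;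
  pideal1 : ~ pideal \top%O;
  pideal_le : forall a b, (a <= b)%O -> pideal b -> pideal a;
  pidealU : forall a b, pideal a -> pideal b -> pideal (a `|` b)%O;
  pidealI : forall a b, pideal (a `&` b)%O -> pideal a \/ pideal b }.

HB.instance Definition _ := gen_eqMixin prime_ideal.
HB.instance Definition _ := gen_choiceMixin prime_ideal.

Lemma prime_ideal_inj (p q : prime_ideal) : (p : set L) = q -> p = q.
Proof.
case: p q => [p p0 p1 p2 p3 p4] [q q0 q1 q2 q3 q4] /= e; subst q.
by congr PrimeIdeal; exact: Prop_irrelevance.
Qed.

Definition priestley_subbase : set (set prime_ideal) :=
  [set S | exists a, S = [set p | pideal p a] \/ S = [set p | ~ pideal p a]].

HB.instance Definition _ :=
  isSubBaseTopological.Build prime_ideal priestley_subbase id.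

Definition is_clopen : pred (set prime_ideal) := fun S => `[< clopen S >].

Definition booleanization := {S : set prime_ideal | is_clopen S}.
HB.instance Definition _ := SubChoice.on booleanization.

Implicit Types S : booleanization.

Lemma is_clopenY (A B : set prime_ideal) :
  is_clopen A -> is_clopen B -> is_clopen (A `+` B).
Proof.
move=> /asboolP cA /asboolP cB; apply/asboolP; rewrite /setY !setDE.
by apply: clopenU; apply: clopenI => //; exact: clopenC.
Qed.

Lemma is_clopenI (A B : set prime_ideal) :
  is_clopen A -> is_clopen B -> is_clopen (A `&` B).
Proof. by move=> /asboolP cA /asboolP cB; apply/asboolP; exact: clopenI. Qed.

Definition bool0 : booleanization := exist _ set0 (asboolT clopen0).
Definition bool1 : booleanization := exist _ setT (asboolT clopenT).
Definition boolN S : booleanization := S.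
Definition boolD S S' : booleanization :=
  exist _ (val S `+` val S') (is_clopenY (valP S) (valP S')).
Definition boolM S S' : booleanization :=
  exist _ (val S `&` val S') (is_clopenI (valP S) (valP S')).

Lemma boolDA : associative boolD.
Proof. by move=> ? ? ?; apply/val_inj; exact: setYA. Qed.
Lemma boolDC : commutative boolD.
Proof. by move=> ? ?; apply/val_inj; exact: setYC. Qed.
Lemma bool0D : left_id bool0 boolD.
Proof. by move=> ?; apply/val_inj; exact: set0Y. Qed.
Lemma boolND : left_inverse bool0 boolN boolD.
Proof. by move=> ?; apply/val_inj; exact: setYK. Qed.
HB.instance Definition _ :=
  GRing.isZmodule.Build booleanization boolDA boolDC bool0D boolND.

Lemma boolMA : associative boolM.
Proof. by move=> ? ? ?; apply/val_inj; exact: setIA. Qed.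
Lemma boolMC : commutative boolM.
Proof. by move=> ? ?; apply/val_inj; exact: setIC. Qed.
Lemma bool1M : left_id bool1 boolM.
Proof. by move=> ?; apply/val_inj; exact: setTI. Qed.
Lemma boolMD : left_distributive boolM boolD.
Proof. by move=> ? ? ?; apply/val_inj; exact: setIYl. Qed.
HB.instance Definition _ :=
  GRing.Zmodule_isComPzRing.Build booleanization boolMA boolMC bool1M boolMD.

End Priestley.

Section BooleanizationMap.
Context {d d' : Order.disp_t}.
Variables (L : tbDistrLatticeType d) (L' : tbDistrLatticeType d').

(* [{tblmorphism _ -> _}] does not include compatibility with meet and join. *)
Record lattice_hom := LatticeHom {
  lhom :> L -> L';
  lhom0 : lhom \bot%O = \bot%O;
  lhom1 : lhom \top%O = \top%O;
  lhomI : {morph lhom : a b / (a `&` b)%O};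
  lhomU : {morph lhom : a b / (a `|` b)%O} }.

Variable f : lattice_hom.

Lemma spec_map_subproof0 (p : prime_ideal L') : pideal p (f \bot%O).
Proof. by rewrite lhom0; exact: pideal0. Qed.

Lemma spec_map_subproof1 (p : prime_ideal L') : ~ pideal p (f \top%O).
Proof. by rewrite lhom1; exact: pideal1. Qed.

Lemma spec_map_subproof_le (p : prime_ideal L') a b :
  (a <= b)%O -> pideal p (f b) -> pideal p (f a).
Proof.
by move=> ab; apply: pideal_le; move: ab; rewrite !leEmeet -lhomI => /eqP->.
Qed.

Lemma spec_map_subproofU (p : prime_ideal L') a b :
  pideal p (f a) -> pideal p (f b) -> pideal p (f (a `|` b)%O).
Proof. by rewrite lhomU; exact: pidealU. Qed.

Lemma spec_map_subproofI (p : prime_ideal L') a b :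
  pideal p (f (a `&` b)%O) -> pideal p (f a) \/ pideal p (f b).
Proof. by rewrite lhomI; exact: pidealI. Qed.

Definition spec_map (p : prime_ideal L') : prime_ideal L :=
  @PrimeIdeal _ L (f @^-1` p)
    (@spec_map_subproof0 p) (@spec_map_subproof1 p) (@spec_map_subproof_le p)
    (@spec_map_subproofU p) (@spec_map_subproofI p).

Lemma subbase_open d0 (M : tbDistrLatticeType d0) (S : set (prime_ideal M)) :
  priestley_subbase S -> open S.
Proof.
move=> hS; exists [set S]; last by rewrite bigcup_set1.
by move=> _ ->; exact: finI_from1.
Qed.

Lemma spec_map_continuous : continuous spec_map.
Proof.
apply/continuousP => _ [D sD <-]; rewrite preimage_bigcup; apply: bigcup_open.
move=> B /sD [E sE <-]; rewrite preimage_bigcap.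
rewrite bigcap_fset big_seq; apply: big_ind; [exact: openT|exact: openI|].
move=> S /sE; rewrite inE => -[a [->|->]]; apply: subbase_open; exists (f a).
  by left.
by right.
Qed.

Lemma bool_map_subproof (S : booleanization L) :
  is_clopen (spec_map @^-1` val S).
Proof.
apply/asboolP; apply: preimage_clopen; last exact: spec_map_continuous.
exact/asboolP/(valP S).
Qed.

Definition bool_map (S : booleanization L) : booleanization L' :=
  exist _ (spec_map @^-1` val S) (bool_map_subproof S).

Lemma bool_map_additive : zmod_morphism bool_map.
Proof. by move=> S S'; apply/val_inj. Qed.
HB.instance Definition _ :=
  GRing.isZmodMorphism.Build _ _ bool_map bool_map_additive.

Lemma bool_map_monoid : monoid_morphism bool_map.
Proof. by split=> [|S S']; apply/val_inj. Qed.
HB.instance Definition _ :=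
  GRing.isMonoidMorphism.Build _ _ bool_map bool_map_monoid.

End BooleanizationMap.

(* Time is [0, +oo[: the values of [flow] at negative times are irrelevant.
   Phase spaces are compact and Hausdorff. *)
Record dynsys (R : realType) (X : topologicalType) := DynSys {
  flow :> R -> X -> X;
  phase_compact : compact [set: X];
  phase_hausdorff : hausdorff_space X;
  flow_continuous :
    {within [set p : R * X | 0 <= p.1], continuous (fun p => flow p.1 p.2)};
  flow0 : forall x, flow 0 x = x;
  flowD : forall t s x, 0 <= t -> 0 <= s -> flow t (flow s x) = flow (t + s) x }.

Section Attractors.
Variables (R : realType) (X : topologicalType) (phi : dynsys R X).
Implicit Types U V A B C : set X.

Definition tail U (t : R) : set X := \bigcup_(s in [set s | t <= s]) (phi s @` U).

Definition omega U : set X := \bigcap_(t in [set t | 0 <= t]) closure (tail U t).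

Definition attracting U : Prop := omega U `<=` U°.

Definition attractor A : Prop := exists2 U, attracting U & A = omega U.

Lemma tailS U V t : U `<=` V -> tail U t `<=` tail V t.
Proof. by move=> UV x [s st [y Uy <-]]; exists s => //; exists y => //; exact: UV. Qed.

Lemma tail_le U s t : s <= t -> tail U t `<=` tail U s.
Proof. by move=> st x [r /= tr ?]; exists r => //=; exact: le_trans tr. Qed.

Lemma omegaS U V : U `<=` V -> omega U `<=` omega V.
Proof. by move=> UV x Ux t t0; apply: closureS (Ux t t0); exact: tailS. Qed.

Lemma tailU U V t : tail (U `|` V) t = tail U t `|` tail V t.
Proof.
apply/seteqP; split=> x.
  by move=> [s st [y [Uy|Vy] <-]]; [left|right]; exists s => //; exists y.
by move=> [] [s st [y ? <-]]; exists s => //; exists y => //; [left|right].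
Qed.

Lemma omegaU U V : omega (U `|` V) = omega U `|` omega V.
Proof.
apply/seteqP; split=> [x UVx|x [] hx]; last 2 first.
- by apply: omegaS hx => y; left.
- by apply: omegaS hx => y; right.
apply: contrapT => /not_orP[/existsNP[s /not_implyP[/= s0 hs]]].
move=> /existsNP[t /not_implyP[/= t0 ht]].
have /= := UVx (Num.max s t); rewrite le_max s0 => /(_ isT).
rewrite tailU closureU => -[h|h].
  by apply: hs; apply: closureS h; apply: tail_le; rewrite le_max lexx.
by apply: ht; apply: closureS h; apply: tail_le; rewrite le_max lexx orbT.
Qed.

Lemma omega0 : omega set0 = set0.
Proof.
rewrite -subset0 => x /(_ 0 (lexx _)); rewrite (_ : tail _ _ = set0) ?closure0//.
by rewrite -subset0 => y [s _ [z]].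
Qed.

Lemma closed_omega U : closed (omega U).
Proof. by apply: closed_bigI => t _; exact: closed_closure. Qed.

Lemma flow_cts t : 0 <= t -> continuous (phi t).
Proof.
move=> t0 x.
have /subspace_continuousP/(_ (t, x) t0) h := @flow_continuous _ _ phi.
apply: (@cvg_comp _ _ _ (fun y => (t, y)) (fun p => phi p.1 p.2)) h.
move=> P [[/= Q1 Q2] [Q1t Q2x] Q]; rewrite /nbhs /=.
by apply: filterS Q2x => y Q2y; apply: (Q (t, y)) => //=; split=> //; exact: nbhs_singleton.
Qed.

Lemma flow_omega_sub U s : 0 <= s -> phi s @` omega U `<=` omega U.
Proof.
move=> s0 _ [x xU <-] t t0.
have /= xt := xU t t0.
move=> N Nx; have [y [[r /= tr [z Uz ezy]] Ny]] := xt _ (flow_cts s0 Nx).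
exists (phi s y); split=> //; exists (s + r) => /=.
  by rewrite -[t]add0r lerD.
by exists z => //; rewrite -(flowD _ _ s0 (le_trans t0 tr)) ezy.
Qed.

Lemma omega_sub_flow U t : 0 <= t -> omega U `<=` phi t @` omega U.
Proof.
move=> t0 y yU.
pose K s := closure (tail U s) `&` phi t @^-1` [set y].
have clK s : closed (K s).
  apply: closedI; first exact: closed_closure.
  move/continuous_closedP: (flow_cts t0); apply.
  exact: accessible_closed_set1 (hausdorff_accessible (@phase_hausdorff _ _ phi)) _.
have K0 s : 0 <= s -> K s !=set0.
  move=> s0; have /= := yU (t + s) (addr_ge0 t0 s0).
  have cpt : compact (phi t @` closure (tail U s)).
    apply: continuous_compact; first exact/continuous_subspaceT/flow_cts.
    apply: subclosed_compact (@phase_compact _ _ phi) _ => //.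
    exact: closed_closure.
  have cl := compact_closed (@phase_hausdorff _ _ phi) cpt.
  suff sub : tail U (t + s) `<=` phi t @` closure (tail U s).
    by move=> /(closureS sub)/cl[x ? ?]; exists x.
  move=> _ [r /= tsr [z Uz <-]]; exists (phi (r - t) z).
    apply: subset_closure; exists (r - t) => /=; last by exists z.
    by rewrite lerBrDl.
  have st : 0 <= r - t by rewrite subr_ge0 (le_trans _ tsr)// lerDl.
  by rewrite flowD// addrC subrK.
pose F := filter_from [set s : R | 0 <= s] K.
have FF : ProperFilter F.
  apply: filter_from_proper; last exact: K0.
  apply: filter_from_filter; first by exists 0; exact: lexx.
  move=> r s /= r0 s0; exists (Num.max r s); first by rewrite /= le_max r0.
  move=> x [xc xy]; split; split=> //; apply: closureS xc; apply: tail_le.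
    by rewrite le_max lexx.
  by rewrite le_max lexx orbT.
have [x [_ Fx]] := @phase_compact _ _ phi F FF filterT.
have Kx s : 0 <= s -> K s x.
  by move=> s0; apply: clK => N Nx; apply: Fx => //; exists s.
exists x; last by case: (Kx 0 (lexx _)).
by move=> s s0; case: (Kx s s0).
Qed.

Lemma omega_closed_sub A :
  closed A -> (forall t, 0 <= t -> phi t @` A `<=` A) -> omega A `<=` A.
Proof.
move=> clA fA x /(_ 0 (lexx _)) /= h; apply: clA; apply: closureS h.
by move=> y [s s0 ys]; exact: fA ys.
Qed.

Lemma omega_omega U : omega (omega U) = omega U.
Proof.
apply/seteqP; split; first by apply: omega_closed_sub;
  [exact: closed_omega|move=> t t0; exact: flow_omega_sub].
move=> x Ux t t0; apply: subset_closure; exists t => /=; first exact: lexx.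
exact: omega_sub_flow.
Qed.

Lemma attracting0 : attracting set0.
Proof. by rewrite /attracting omega0. Qed.

Lemma attractingT : attracting setT.
Proof. by rewrite /attracting interiorT. Qed.

Lemma attractingU U V : attracting U -> attracting V -> attracting (U `|` V).
Proof.
move=> aU aV; rewrite /attracting omegaU => x [/aU|/aV] h; apply: interiorS h.
  by move=> y; left.
by move=> y; right.
Qed.

Lemma attractingI U V : attracting U -> attracting V -> attracting (U `&` V).
Proof.
move=> aU aV x UVx; rewrite interiorI; split.
  by apply: aU; apply: omegaS UVx => y [].
by apply: aV; apply: omegaS UVx => y [].
Qed.

Lemma omegaI U V : attracting U -> attracting V ->
  omega (omega U `&` omega V) = omega (U `&` V).
Proof.
move=> aU aV; apply/seteqP; split.
  by apply: omegaS => x [/aU/interior_subset ? /aV/interior_subset].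
rewrite -[X in X `<=` _]omega_omega; apply: omegaS => x UVx.
by split; apply: omegaS UVx => y [].
Qed.

Lemma attractor_omega A : attractor A -> omega A = A.
Proof. by move=> [U _ ->]; exact: omega_omega. Qed.

Lemma attractorIsub A B : attractor A -> attractor B -> omega (A `&` B) `<=` A `&` B.
Proof.
move=> /attractor_omega hA /attractor_omega hB x h; split.
  by rewrite -hA; apply: omegaS h => y [].
by rewrite -hB; apply: omegaS h => y [].
Qed.

Lemma attractorIA A B C : attractor A -> attractor B -> attractor C ->
  omega (A `&` omega (B `&` C)) = omega (A `&` B `&` C).
Proof.
move=> aA aB aC; apply/seteqP; split.
  by apply: omegaS => x [Ax /(attractorIsub aB aC)[]].
rewrite -[X in X `<=` _]omega_omega; apply: omegaS => x h; split.
  by rewrite -(attractor_omega aA); apply: omegaS h => y [[]].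
by apply: omegaS h => y [[]].
Qed.

End Attractors.

Record param_dynsys (R : realType) (Lam X : topologicalType) := ParamDynSys {
  fiber :> Lam -> dynsys R X;
  fiber_continuous :
    {within [set p : R * X * Lam | 0 <= p.1.1],
      continuous (fun p => fiber p.2 p.1.1 p.1.2)} }.

Section AttractorSheaf.
Variables (R : realType) (Lam X : topologicalType) (phi : param_dynsys R Lam X).

(* [att_section Om] is the lattice S(Om). *)
Section AttractorLattice.
Variable Om : opens Lam.

Definition is_att_section : pred (Om -> set X) := fun A =>
  `[< (forall l : Om, attractor (phi (val l)) (A l)) /\
      (forall m : Om, exists (Om0 : opens Lam) (U : set X),
         [/\ Om0 `<=` Om, oset Om0 (val m) &
             forall l : Om, oset Om0 (val l) ->
               attracting (phi (val l)) U /\ A l = omega (phi (val l)) U]) >].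

Definition att_section := {A : Om -> set X | is_att_section A}.
HB.instance Definition _ := SubChoice.on att_section.

Implicit Types A B C : att_section.

Lemma att_section_attractor A (l : Om) : attractor (phi (val l)) (val A l).
Proof. by have /asboolP[] := valP A. Qed.

Lemma att_section_ext A B : (forall l, val A l = val B l) -> A = B.
Proof. by move=> h; apply/val_inj/funext. Qed.

Lemma att0_subproof : is_att_section (fun=> set0).
Proof.
apply/asboolP; split=> [l|m].
  by exists set0; [exact: attracting0|rewrite omega0].
exists Om, set0; split=> //; first exact: set_valP.
by move=> l _; rewrite omega0; split=> //; exact: attracting0.
Qed.

Lemma att1_subproof : is_att_section (fun l => omega (phi (val l)) setT).
Proof.
apply/asboolP; split=> [l|m]; first by exists setT => //; exact: attractingT.
exists Om, setT; split=> //; first exact: set_valP.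
by move=> l _; split=> //; exact: attractingT.
Qed.

Lemma attU_subproof A B : is_att_section (fun l => val A l `|` val B l).
Proof.
have /asboolP[A1 A2] := valP A; have /asboolP[B1 B2] := valP B.
apply/asboolP; split=> [l|m].
  have [U aU ->] := A1 l; have [V aV ->] := B1 l.
  by exists (U `|` V); [exact: attractingU|rewrite omegaU].
have [Om1 [U [s1 m1 h1]]] := A2 m; have [Om2 [V [s2 m2 h2]]] := B2 m.
exists (opensI Om1 Om2), (U `|` V); split=> //; first by move=> x [/s1].
move=> l [/h1[aU ->] /h2[aV ->]]; split; first exact: attractingU.
by rewrite omegaU.
Qed.

Lemma attI_subproof A B :
  is_att_section (fun l => omega (phi (val l)) (val A l `&` val B l)).
Proof.
have /asboolP[A1 A2] := valP A; have /asboolP[B1 B2] := valP B.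
apply/asboolP; split=> [l|m].
  have [U aU ->] := A1 l; have [V aV ->] := B1 l.
  by exists (U `&` V); [exact: attractingI|rewrite omegaI].
have [Om1 [U [s1 m1 h1]]] := A2 m; have [Om2 [V [s2 m2 h2]]] := B2 m.
exists (opensI Om1 Om2), (U `&` V); split=> //; first by move=> x [/s1].
move=> l [/h1[aU ->] /h2[aV ->]]; split; first exact: attractingI.
by rewrite omegaI.
Qed.

Definition att0 : att_section := exist is_att_section _ att0_subproof.
Definition att1 : att_section := exist is_att_section _ att1_subproof.
Definition attU A B : att_section := exist is_att_section _ (attU_subproof A B).
Definition attI A B : att_section := exist is_att_section _ (attI_subproof A B).
Definition att_le A B : bool := `[< forall l, val A l `<=` val B l >].
Definition att_lt A B : bool := (B != A) && att_le A B.

Lemma att_le_def A B : att_le A B = (attI A B == A).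
Proof.
apply/asboolP/eqP => [AB|<- l x].
  apply: att_section_ext => l /=.
  by rewrite (setIidl (AB l)) attractor_omega//; exact: att_section_attractor.
by move=> /(attractorIsub (att_section_attractor A l) (att_section_attractor B l))[].
Qed.

Lemma attIC : commutative attI.
Proof. by move=> A B; apply: att_section_ext => l /=; rewrite setIC. Qed.
Lemma attUC : commutative attU.
Proof. by move=> A B; apply: att_section_ext => l /=; rewrite setUC. Qed.
Lemma attIA : associative attI.
Proof.
move=> A B C; apply: att_section_ext => l /=.
rewrite attractorIA; try exact: att_section_attractor.
rewrite [in RHS]setIC attractorIA; try exact: att_section_attractor.
by rewrite [in LHS]setIC setIA.
Qed.
Lemma attUA : associative attU.
Proof. by move=> A B C; apply: att_section_ext => l /=; rewrite setUA. Qed.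
Lemma attUKI B A : attI A (attU A B) = A.
Proof.
apply: att_section_ext => l /=; rewrite (setIidl (@subsetUl _ _ _)) attractor_omega//.
exact: att_section_attractor.
Qed.
Lemma attIKU B A : attU A (attI A B) = A.
Proof.
apply: att_section_ext => l /=; apply/setUidPl => x.
by move=> /(attractorIsub (att_section_attractor A l) (att_section_attractor B l))[].
Qed.
Lemma attIUl : left_distributive attI attU.
Proof. by move=> A B C; apply: att_section_ext => l /=; rewrite setIUl omegaU. Qed.
Lemma attII : idempotent_op attI.
Proof.
move=> A; apply: att_section_ext => l /=; rewrite setIid attractor_omega//.
exact: att_section_attractor.
Qed.

Fact att_display : Order.disp_t. Proof. exact: Order.Disp tt tt. Qed.

HB.instance Definition _ := @Order.isMeetJoinDistrLattice.Build att_display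
  att_section att_le att_lt attI attU att_le_def (fun _ _ => erefl)
  attIC attUC attIA attUA attUKI attIKU attIUl attII.

Lemma att0_le A : (att0 <= A)%O.
Proof. by apply/asboolP => l x. Qed.

Lemma att_le1 A : (A <= att1)%O.
Proof.
apply/asboolP => l /=; rewrite -(attractor_omega (att_section_attractor A l)).
exact: omegaS.
Qed.

HB.instance Definition _ := @Order.hasBottom.Build att_display att_section att0 att0_le.
HB.instance Definition _ := @Order.hasTop.Build att_display att_section att1 att_le1.

End AttractorLattice.

Section Restriction.
Variables (Om Om' : opens Lam) (h : Om' `<=` Om).

Lemma att_res_subproof (A : att_section Om) :
  @is_att_section Om' (fun l => val A (incl h l)).
Proof.
have /asboolP[A1 A2] := valP A; apply/asboolP; split=> [l|m].
  exact: (A1 (incl h l)).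
have [Om0 [U [sO mO hO]]] := A2 (incl h m).
exists (opensI Om0 Om'), U; split=> [x []//|//|].
  by split=> //; exact: set_valP.
by move=> l [lOm _]; exact: (hO (incl h l)).
Qed.

Definition att_res_fun (A : att_section Om) : att_section Om' :=
  exist (@is_att_section Om') _ (att_res_subproof A).

Definition att_res : lattice_hom (att_section Om) (att_section Om').
Proof.
by apply: (@LatticeHom _ _ _ _ att_res_fun) => [||A B|A B];
  exact: att_section_ext.
Defined.

End Restriction.

Definition boolean_sections (Om : opens Lam) := booleanization (att_section Om).

Lemma boolean_res_id (Om : opens Lam) (h : Om `<=` Om) S :
  bool_map (att_res h) S = S.
Proof.
apply/val_inj/funext => p /=; congr (val S _); apply: prime_ideal_inj => /=.
apply/funext => A; congr (pideal p _); apply: att_section_ext => l /=.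
by rewrite inclE.
Qed.

Lemma boolean_res_comp (U V W : opens Lam) (h : V `<=` U) (k : W `<=` V)
    (l : W `<=` U) S :
  bool_map (att_res k) (bool_map (att_res h) S) = bool_map (att_res l) S.
Proof.
apply/val_inj/funext => p /=; congr (val S _); apply: prime_ideal_inj => /=.
apply/funext => A; congr (pideal p _); apply: att_section_ext => x /=.
by congr (val A _); exact/val_inj.
Qed.

Definition boolean_presheaf : presheaf Lam :=
  @Presheaf Lam (fun Om => boolean_sections Om)
    (fun U V h => bool_map (att_res h)) boolean_res_id boolean_res_comp.

Definition attractor_sheaf : presheaf Lam := sheafify boolean_presheaf.

End AttractorSheaf.

Definition strictly_monotone_on (R : realType) (D : set R) (f : R -> R) : Prop :=
  (forall s t, D s -> D t -> s < t -> f s < f t) \/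
  (forall s t, D s -> D t -> s < t -> f t < f s).

Definition is_component (X : topologicalType) (C : set X) : Prop :=
  exists x, C = connected_component [set: X] x.

Definition homeomorphism (Y X : topologicalType) (h : Y -> X) : Prop :=
  continuous h /\ exists g : X -> Y, [/\ continuous g, cancel h g & cancel g h].

Definition conjugate (R : realType) (Lam Y X : topologicalType)
    (phi : param_dynsys R Lam Y) (psi : param_dynsys R Lam X) : Prop :=
  exists (h : Lam -> Y -> X) (tau : Lam -> R -> Y -> R),
  [/\ continuous (fun p : Lam * Y => h p.1 p.2),
      {within [set p : Lam * R * Y | 0 <= p.1.2],
        continuous (fun p => tau p.1.1 p.1.2 p.2)},
      forall l, [/\ homeomorphism (h l),
        forall y, tau l 0 y = 0,
        forall y, strictly_monotone_on `[0, +oo[ (tau l ^~ y),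
        forall y, set_bij `[0, +oo[ `[0, +oo[ (tau l ^~ y) &
        forall t y, 0 <= t -> h l (phi l t y) = psi l (tau l t y) (h l y)] &
      forall C, is_component C ->
        exists2 D, is_component D & forall l, h l @` C = D].

(* Trajectories of x' = l x - x^3 come down from infinity in finite time, so with
   +oo and -oo as fixed points the flow of this very vector field would not be
   continuous on \bar R.  The equation therefore prescribes the vector field on
   R up to a continuous positive speed factor [g] ([g = 1] is not excluded), for
   instance g = 1 / (1 + x^2).  Conjugacy allows changes of time anyway. *)
Definition pitchfork (R : realType) (psi : param_dynsys R R (\bar R)) : Prop :=
  (forall l t : R, 0 <= t -> psi l t +oo%E = +oo%E /\ psi l t -oo%E = -oo%E) /\
  exists g : R -> R -> R,
  [/\ continuous (fun p : R * R => g p.1 p.2),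
      forall l x, 0 < g l x &
      forall l x0 : R, exists x : R -> R,
        (forall t : R, 0 <= t -> psi l t x0%:E = (x t)%:E) /\
        (forall t : R, 0 < t ->
          is_derive t 1 x (g l (x t) * (l * x t - x t ^+ 3)))].

(* Main.v *)
Require Import Defs.
From HB Require Import structures.
From mathcomp Require Import all_boot all_order all_algebra.
From mathcomp Require Import ring lra.
From mathcomp Require Import all_classical all_reals all_analysis.

(* The equilibria -oo, - sqrt l, 0, sqrt l, +oo transport to rest points of phi which
   depend continuously on l.  For a rest point m, the attractors avoiding m form a
   prime ideal, and as an attracting neighbourhood that contains m in its closure
   has m in its interior, this ideal varies continuously with l.  A point not at
   rest lies in an attractor iff the rest point it came from does, so attractors
   are determined by their rest points and over an interval there are no further
   prime ideals.  Membership of the five ideals in a clopen set thus identifies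
   the attractor sheaf with the direct sum of the constant sheaf Z_2^3 and of the
   extension by zero of the constant sheaf Z_2^2 on l > 0: the two extra summands
   record that the three middle equilibria separate for l > 0.

   Germs of such a sheaf continue to the right from any point, and to the left
   from any point l <= 0.  Germs of the higher syzygies of the canonical resolution
   continue in both directions, since serrations extend by zero.  On a line, local
   lifts along C^0(Z) -> C^0(Z) / Z glue point by point under these conditions; this
   gives acyclicity, on rays as well as on the whole line.  Relative cohomology then
   reduces to comparing global sections over R, which are Z_2^3, with those over
   the ray, which are Z_2^5 on [a, +oo[ with a > 0 and Z_2^3 otherwise. *)

Set Implicit Arguments.
Unset Strict Implicit.
Unset Printing Implicit Defensive.

Import Order.TTheory GRing.Theory Num.Theory.
Import numFieldNormedType.Exports.

Local Open Scope classical_set_scope.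
Local Open Scope ring_scope.

(** * Cochain complexes *)

Definition additive_of (V W : zmodType) (f : V -> W) (fB : zmod_morphism f) :
  {additive V -> W} := HB.pack f (GRing.isZmodMorphism.Build V W f fB).

Section CohomologyCriteria.
Local Open Scope quotient_scope.
Variables (C : cochain_complex) (n : nat).

Definition cocycle_of (x : C n) (dx : cobd C n x = 0) : cocycle C n :=
  exist _ x (introT eqP dx).

Lemma cobd_val (z : cocycle C n) : cobd C n (val z) = 0.
Proof. exact/eqP/(valP z). Qed.

Lemma cohomology_repr (a : cohomology C n) : a = \pi_(cohomology C n) (repr a).
Proof. by rewrite reprK. Qed.

Lemma cohomology_pi_eq0 (z : cocycle C n) :
  (\pi_(cohomology C n) z = 0) <-> is_cobd (val z).
Proof.
have e0 : \pi_(cohomology C n) (0 : cocycle C n) = 0 by exact: raddf0.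
rewrite -e0; split=> [/eqP|h].
  by rewrite -Quotient.idealrBE subr0 => /asboolP.
by apply/eqP; rewrite -Quotient.idealrBE subr0; exact/asboolP.
Qed.

Lemma cohomology_zero :
  (forall x : C n, cobd C n x = 0 -> is_cobd x) -> zmod_zero (cohomology C n).
Proof.
move=> h a; rewrite (cohomology_repr a); apply/cohomology_pi_eq0/h.
exact: cobd_val.
Qed.

(** First isomorphism theorem: [g] descends along the quotient. The induced map is evaluated on
    chosen representatives, and [gpi] shows that the choice does not matter. *)
Lemma cohomology_iso (V : zmodType) (g : cocycle C n -> V) :
  zmod_morphism g -> (forall v, exists z, g z = v) ->
  (forall z, g z = 0 <-> is_cobd (val z)) -> zmod_iso (cohomology C n) V.
Proof.
move=> gB gsurj gker.
have gpi z : g (repr (\pi_(cohomology C n) z)) = g z.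
  apply/eqP; rewrite -subr_eq0 -gB; apply/eqP/gker.
  by apply/cohomology_pi_eq0; rewrite raddfB /= reprK subrr.
pose f (a : cohomology C n) := g (repr a).
have fB : zmod_morphism f.
  move=> a b; rewrite (cohomology_repr a) (cohomology_repr b) -raddfB.
  by rewrite /f !gpi gB.
exists (additive_of fB).
have finj : injective f.
  move=> a b; rewrite (cohomology_repr a) (cohomology_repr b) /f !gpi => e.
  apply/eqP; rewrite -subr_eq0 -raddfB; apply/eqP/cohomology_pi_eq0/gker.
  by rewrite gB e subrr.
have [h hK] : exists h : V -> cohomology C n, cancel h f.
  have [h hP] := choice gsurj; exists (fun v => \pi_(cohomology C n) (h v)) => v.
  by rewrite /f gpi hP.
by exists h => // a; apply: finj; rewrite hK.
Qed.

End CohomologyCriteria.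

(** * Cohomology of the kernel of a cochain map *)

Section KernelCohomology.
Variables (C D : cochain_complex) (f : cochain_map C D).

Lemma ker_complex_zero0 :
  (forall x : C 0, cobd C 0 x = 0 -> f 0 x = 0 -> x = 0) ->
  zmod_zero (cohomology (ker_complex f) 0).
Proof.
move=> h; apply: cohomology_zero => x dx /=; apply/val_inj/h.
  by move/(congr1 val): dx.
exact/eqP/(valP x).
Qed.

Hypothesis f_surj : forall n (y : D n), exists x, f n x = y.

(** Lift a primitive of [y] and take its coboundary. Where [D] is exact, this makes every cocycle of
    [D] the image of a cocycle of [C]. *)
Lemma is_cobd_lift n (y : D n) : is_cobd y ->
  exists2 x : C n, cobd C n x = 0 & f n x = y.
Proof.
case: n y => [y /= ->|n y /= [w <-]].
  by exists 0; rewrite raddf0.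
have [w' <-] := f_surj w.
by exists (cobd C n w'); rewrite ?cobdK ?cmap_cobd.
Qed.

Variable m : nat.
Hypothesis C_exact : forall x : C m.+1, cobd C m.+1 x = 0 -> exists y, cobd C m y = x.

(** Inverting the connecting homomorphism: a relative cocycle has a primitive in [C], whose image in
    [D] is a cocycle since [f] kills [x]. *)
Lemma ker_cobd_lift (x : ker_complex f m.+1) : cobd (ker_complex f) m.+1 x = 0 ->
  exists y, cobd C m y = val x /\ cobd D m (f m y) = 0.
Proof.
move=> /(congr1 val)/= /C_exact[y dy]; exists y; split=> //.
by rewrite -cmap_cobd dy; exact/eqP/(valP x).
Qed.

(** A primitive of [x] lying in the kernel of [f] differs from the given primitive [y] by a cocycle
    of [C]. *)
Lemma ker_is_cobdP (x : ker_complex f m.+1) (y : C m) : cobd C m y = val x ->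
  is_cobd x <-> exists2 z, cobd C m z = 0 & f m z = f m y.
Proof.
move=> dy; split=> [[w dw]|[z dz fz]].
  exists (y - val w); first by rewrite raddfB dy -dw subrr.
  by rewrite raddfB /= (eqP (valP w)) subr0.
have k : kernel_pred (f m) (y - z) by rewrite /kernel_pred raddfB fz subrr.
exists (exist (fun y => kernel_pred (f m) y) _ k).
by apply/val_inj; rewrite /= raddfB dz subr0.
Qed.

Lemma ker_complex_zero :
  (forall y : D m, cobd D m y = 0 -> exists2 x, cobd C m x = 0 & f m x = y) ->
  zmod_zero (cohomology (ker_complex f) m.+1).
Proof.
move=> h; apply: cohomology_zero => x /ker_cobd_lift[y [dy /h[z dz fz]]].
by apply/(ker_is_cobdP dy); exists z.
Qed.

(** From the long exact sequence: as [C] is exact in degree [m.+1], relative cohomology there is the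
    group of cocycles of [D] modulo images of cocycles of [C], and [g] presents [V] as this
    quotient. *)
Lemma ker_complex_iso (V : zmodType) (g : cocycle D m -> V) :
  zmod_morphism g -> (forall v, exists z, g z = v) ->
  (forall z, g z = 0 <-> exists2 x, cobd C m x = 0 & f m x = val z) ->
  zmod_iso (cohomology (ker_complex f) m.+1) V.
Proof.
move=> gB gsurj gker.
have [y yP] := choice (fun x => ker_cobd_lift (cobd_val x)).
pose fy x := cocycle_of (proj2 (yP x)).
have gE (z z' : cocycle D m) x : cobd C m x = 0 -> val z - val z' = f m x -> g z = g z'.
  move=> dx e; apply/eqP; rewrite -subr_eq0 -gB; apply/eqP/gker; exists x => //.
apply: (@cohomology_iso _ _ _ (fun x => g (fy x))).
(* The chosen primitives need not be additive in [x]; their defect is a cocycle of [C], which [g]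
   does not see. *)
- move=> x x'; rewrite -gB; apply: (gE _ _ (y (x - x') - (y x - y x'))).
    by rewrite !raddfB !(proj1 (yP _)) /= -opprD subrr.
  by rewrite !raddfB.
(* The connecting homomorphism: lift [z] to a cochain [w] of [C] and take the coboundary of [w],
   which is relative. *)
- move=> v; have [z <-] := gsurj v; have [w fw] := f_surj (val z).
  have kw : kernel_pred (f m.+1) (cobd C m w).
    by rewrite /kernel_pred cmap_cobd fw cobd_val.
  have dkw : cobd (ker_complex f) m.+1 (exist (fun y => kernel_pred (f m.+1) y) _ kw) = 0.
    by apply/val_inj; rewrite /= cobdK.
  exists (cocycle_of dkw); apply: (gE _ _ (y (cocycle_of dkw) - w)).
    by rewrite raddfB (proj1 (yP _)) /= subrr.
  by rewrite raddfB fw.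
- by move=> x; rewrite gker /= -(ker_is_cobdP (proj1 (yP x))).
Qed.

End KernelCohomology.

(** * Canonical resolutions on a line *)

Section GlobalSerrations.
Variables (T : topologicalType).
Implicit Types (F : presheaf T) (U V W : opens T).

Definition pt (x : T) : opensT T := SigSub (mem_set (I : oset (opensT T) x)).

Lemma sub1P (A : set T) (x : T) : A x -> [set x] `<=` A.
Proof. by move=> Ax _ ->. Qed.

(* Serrations over the whole space, indexed by points rather than by the
   elements of [opensT T]. *)
Definition gser F := forall x, stalk F x.

Definition to_gser F (s : serrations F (opensT T)) : gser F := fun x => s (pt x).

Definition of_gser F (g : gser F) U : serrations F U := fun x => g (val x).
Arguments of_gser {F} g U.

Lemma of_gserK F (s : serrations F (opensT T)) : of_gser (to_gser s) (opensT T) = s.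
Proof.
apply: functional_extensionality_dep => -[x xT].
by rewrite /of_gser /to_gser /pt /=; congr (s (SigSub _)); exact: Prop_irrelevance.
Qed.

Lemma gser_ext F (s t : serrations F (opensT T)) :
  (forall x, to_gser s x = to_gser t x) -> s = t.
Proof.
move=> h; rewrite -(of_gserK s) -(of_gserK t).
by apply: functional_extensionality_dep => x; exact: h.
Qed.

Lemma germ_irr F U x (h k : [set x] `<=` U) (t : F U) :
  germ h t = germ k t :> stalk F x.
Proof. by congr germ; exact: Prop_irrelevance. Qed.

Lemma germ1P F x U V (hU : [set x] `<=` U) (hV : [set x] `<=` V) (s : F U) (t : F V) :
  (germ hU s : stalk F x) = germ hV t ->
  exists W, oset W x /\ forall y (Wy : oset W y) (hU : [set y] `<=` U) (hV : [set y] `<=` V),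
     (germ hU s : stalk F y) = germ hV t.
Proof.
move=> /germP[W [h1 [h2 [Wx e]]]]; exists W; split; first exact: Wx.
move=> y Wy kU kV; apply/germP; exists W, h1, h2; split=> //.
exact: sub1P.
Qed.

(** Continuity of [g] near [x] as a section of the étale space of [F]. *)
Definition loc_at F (g : gser F) x := exists U (t : F U),
  oset U x /\ forall y (Uy : [set y] `<=` U), g y = germ Uy t.

Definition near_eq F (g g' : gser F) x :=
  exists U, oset U x /\ forall y, oset U y -> g y = g' y.

(** Continuous sections of an étale space that meet at a point agree around it, as equality of germs
    is an open condition. *)
Lemma loc_near_eq F (g g' : gser F) x : loc_at g x -> loc_at g' x -> g x = g' x ->
  near_eq g g' x.
Proof.
move=> [U [s [Ux gs]]] [V [t [Vx gt]]].
rewrite (gs x (sub1P Ux)) (gt x (sub1P Vx)) => /germ1P[W [Wx e]].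
exists (opensI W (opensI U V)); split=> // y [Wy [Uy Vy]].
by rewrite (gs y (sub1P Uy)) (gt y (sub1P Vy)); exact: e.
Qed.

(** The projection from C^0(F) to the stalks of C^0(F) / F, read on global serrations. By
    [godement_cobdE] it is the differential of the canonical resolution, point by point. *)
Definition qgerm F (g : gser F) : gser (quot_serrations F) :=
  fun x => @germ T (quot_serrations F) [set x] (opensT T) (sub1P I)
    (qser (of_gser g (opensT T))).

Lemma qgermB F (g g' : gser F) x : qgerm (fun y => g y - g' y) x = qgerm g x - qgerm g' x.
Proof.
rewrite /qgerm -raddfB; congr germ.
exact: (raddfB (@qser T F (opensT T))).
Qed.

Lemma qgerm_loc F (g : gser F) x : loc_at (qgerm g) x.
Proof.
exists (opensT T), (qser (of_gser g (opensT T))); split=> // y h.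
exact: germ_irr.
Qed.

(** Exactness on stalks: the class of [g] vanishes near [x] when [g] is induced there by a section
    of [F]. *)
Lemma qgerm_eq0 F (g : gser F) x : qgerm g x = 0 <-> loc_at g x.
Proof.
have e0 := germ0E (quot_serrations F) (sub1P I : [set x] `<=` opensT T).
split=> [|[U [t [Ux gt]]]].
  rewrite [0]e0 => /germP[W [h1 [h2 [Wx]]]]; rewrite raddf0 /= quot_resE.
  move=> /qser_eq0[t et]; exists W, t; split; first exact: Wx.
  move=> y Wy; have Wy' : oset W y by exact: Wy.
  have := congr1 (fun f => f (SigSub (mem_set Wy') : W)) et.
  rewrite /to_serration /of_gser /= => et'.
  transitivity (germ (@sub1 T W (SigSub (mem_set Wy'))) t : stalk F y) => //.
  exact: germ_irr.
rewrite [0]e0; apply/germP.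
exists U, (@subsetT _ _), (@subsetT _ _); split; first exact: sub1P.
rewrite raddf0 /= quot_resE; apply/qser_eq0; exists t.
apply: functional_extensionality_dep => y; rewrite /to_serration.
rewrite /= /serration_res /of_gser /= (gt (val y) (@sub1 T U y)).
by [].
Qed.

Lemma qgerm_near F (g g' : gser F) x : near_eq g g' x -> qgerm g x = qgerm g' x.
Proof.
move=> [U [Ux e]]; apply/eqP; rewrite -subr_eq0 -qgermB; apply/eqP/qgerm_eq0.
by exists U, 0; split=> // y Uy; rewrite raddf0 e ?subrr//; exact: Uy.
Qed.

(** A serration over an open set extends by zero to the whole space without changing its germ at
    [x]. *)
Lemma qgerm_surj F x (a : stalk (quot_serrations F) x) :
  exists g : gser F, qgerm g x = a.
Proof.
have [U [h [b ->]]] := germW a; have [s ->] := qserW b.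
pose g : gser F := fun y => match pselect (oset U y) with
  | left Uy => s (SigSub (mem_set Uy)) | right _ => 0 end.
exists g; apply/germP; exists U, (@subsetT _ _), (@subset_refl _ _).
split=> //; rewrite res_id /= quot_resE; congr qser.
apply: functional_extensionality_dep => -[y Uy] /=.
rewrite /serration_res /of_gser /g /=; case: pselect => [Uy'|]; last first.
  by move=> nUy; exfalso; apply: nUy; exact: set_mem.
by congr (s (SigSub _)); exact: Prop_irrelevance.
Qed.

Lemma godement_cobdE F n (s : godement F n (opensT T)) x :
  to_gser (godement_cobd F n (opensT T) s) x = qgerm (to_gser s) x.
Proof. by rewrite /qgerm of_gserK /to_gser /=; exact: germ_irr. Qed.

Lemma godement_cocycleP F n (s : godement F n (opensT T)) :
  godement_cobd F n (opensT T) s = 0 <-> forall x, loc_at (to_gser s) x.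
Proof.
split=> [e x|h].
  by apply/qgerm_eq0; rewrite -godement_cobdE e.
apply: gser_ext => x; rewrite godement_cobdE.
by apply/qgerm_eq0.
Qed.

(** Global sections of the sheaf C^0(F) / F lift to C^0(F); this is the vanishing of the first
    cohomology of [F]. *)
Definition lifts F := forall s : gser (quot_serrations F), (forall x, loc_at s x) ->
  exists g : gser F, forall x, qgerm g x = s x.

Lemma godement_exact F n : lifts (syzygy F n) ->
  forall x : godement_complex F n.+1, cobd (godement_complex F) n.+1 x = 0 ->
  exists y, cobd (godement_complex F) n y = x.
Proof.
move=> lF s /godement_cocycleP hs; have [g gP] := lF (to_gser s) hs.
exists (of_gser g (opensT T)); apply: gser_ext => x.
by rewrite /= godement_cobdE -gP.
Qed.

End GlobalSerrations.
Arguments of_gser {T F} g U.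

(** * Lifting along an interval *)

Section Line.
Variables (R : realType) (T : topologicalType).
Implicit Types (iota : T -> R) (F : presheaf T).

(** Each point has a whole neighbourhood, not only its own coordinate, below some term; a limit
    along the sequence is then locally constant. A space with a greatest coordinate qualifies as
    well. *)
Definition cofinal_from iota (p : T) := exists e : nat -> T,
  [/\ e 0%N = p, forall n, iota (e n) <= iota (e n.+1) &
   forall x, exists n U, [/\ oset U x & forall y, oset U y -> iota y <= iota (e n)]].

(** Covers the line and its closed rays at once. Replacing [iota] by its opposite exchanges right
    and left, so only continuation to the right is studied. Points with equal coordinates are
    topologically indistinguishable. *)
Record line iota (p : T) := Line {
  line_cts : continuous iota;
  line_conn : connected [set: T];
  line_embed : forall x (U : opens T), oset U x ->
    exists2 e : R, 0 < e & forall y, `|iota y - iota x| < e -> oset U y;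
  line_cofinal : cofinal_from iota p;
  line_coinitial : cofinal_from (fun x => - iota x) p }.

(* A germ of [F] at [p] continues to a section over [p <= x]; its values at
   other points are arbitrary. *)
Definition ext_right iota F (p : T) := forall a : stalk F p,
  exists z : gser F, z p = a /\ forall x, iota p <= iota x -> loc_at z x.

Lemma line_opp iota p : line iota p -> line (fun x => - iota x) p.
Proof.
move=> [c k e f g]; split=> //.
- by move=> x; apply: continuousN; exact: c.
- move=> x U /e[d d0 h]; exists d => // y yx; apply: h.
  by move: yx; rewrite opprK addrC distrC.
- by rewrite (_ : (fun _ => _) = iota)//; apply/funext => x; rewrite opprK.
Qed.

Section Lift.
Variables (F : presheaf T) (s : gser (quot_serrations F)).
Hypothesis s_loc : forall x, loc_at s x.

Definition lift_at (g : gser F) x := qgerm g x = s x.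

Lemma lift_at_open g x : lift_at g x ->
  exists U, oset U x /\ forall y, oset U y -> lift_at g y.
Proof. by move=> /(loc_near_eq (qgerm_loc g x) (s_loc x))[U [Ux e]]; exists U. Qed.

Lemma lift_at_near g g' x : near_eq g g' x -> lift_at g x -> lift_at g' x.
Proof. by rewrite /lift_at => /qgerm_near ->. Qed.

Lemma lift_atB g z x : loc_at z x -> lift_at g x -> lift_at (fun y => g y - z y) x.
Proof. by rewrite /lift_at qgermB => /qgerm_eq0 ->; rewrite subr0. Qed.

Lemma lift_at_diff g g' x : lift_at g x -> lift_at g' x -> loc_at (fun y => g y - g' y) x.
Proof. by move=> gx g'x; apply/qgerm_eq0; rewrite qgermB gx g'x subrr. Qed.

Section Right.
Variable iota : T -> R.
Hypothesis cts : continuous iota.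
Hypothesis embed : forall x (U : opens T), oset U x ->
    exists2 e : R, 0 < e & forall y, `|iota y - iota x| < e -> oset U y.

Lemma iota_indist x y (U : opens T) : iota x = iota y -> oset U x -> oset U y.
Proof. by move=> e /embed[d d0]; apply; rewrite e subrr normr0. Qed.

Lemma open_iota (A : set R) : open A -> open (iota @^-1` A).
Proof. by move: cts => /continuousP; exact. Qed.

Lemma near_eq_lt (g g' : gser F) (r : R) x :
  (forall y, iota y < r -> g y = g' y) -> iota x < r -> near_eq g g' x.
Proof. by move=> e xr; exists (Opens (open_iota (@open_lt _ r))). Qed.

Lemma near_eq_gt (g g' : gser F) (r : R) x :
  (forall y, r < iota y -> g y = g' y) -> r < iota x -> near_eq g g' x.
Proof. by move=> e xr; exists (Opens (open_iota (@open_gt _ r))). Qed.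

(* Two lifts of the same section differ near [y] by a section of [F]; continuing
   that section to the right of [y] makes the lifts agree at [y]. *)
Lemma lift_glue (g g' : gser F) y : ext_right iota F y -> lift_at g y -> lift_at g' y ->
  exists h : gser F,
  [/\ forall x, iota x <= iota y -> h x = g x,
      forall x, iota x <= iota y -> lift_at g x -> lift_at h x &
      forall x, iota y <= iota x -> lift_at g' x -> lift_at h x].
Proof.
move=> ext gy g'y; have [z [zy zloc]] := ext (g' y - g y).
pose k : gser F := fun x => g' x - z x.
(* Follow [g] up to [y] and the corrected lift [k] afterwards. As [g' - g] and [z] agree on [U], so
   do [g] and [k], and the seam at [y] is invisible. *)
pose h : gser F := fun x => if iota x <= iota y then g x else k x.
have /= [U [Uy e]] : near_eq (fun x => g' x - g x) z y.
  by apply: loc_near_eq => //; [exact: lift_at_diff|exact: zloc].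
have kg x : oset U x -> k x = g x.
  by move=> /e/= ezx; rewrite /k -ezx opprB addrC subrK.
have kx x : iota y <= iota x -> lift_at g' x -> lift_at k x.
  by move=> /zloc; exact: lift_atB.
have gh x : oset U x -> h x = g x by rewrite /h; case: ifP => // _; exact: kg.
have kh x : oset U x -> h x = k x by move=> Ux; rewrite gh// kg.
exists h; split=> [x xy|x|x]; first by rewrite /h xy.
  rewrite le_eqVlt => /predU1P[xy|lt] gx.
    apply: lift_at_near gx; exists U; split; first exact: iota_indist Uy.
    by move=> w /gh.
  apply: lift_at_near gx; apply: near_eq_lt lt => w wy.
  by rewrite /h (ltW wy).
move=> yx /(kx _ yx) kxx; apply: lift_at_near kxx.
move: yx; rewrite le_eqVlt => /predU1P[xy|lt].
  by exists U; split; [exact: iota_indist Uy|move=> w /kh].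
by apply: near_eq_gt lt => w wy; rewrite /h leNgt wy.
Qed.

Definition good_on (g : gser F) p r :=
  forall x, iota p <= iota x -> iota x <= iota r -> lift_at g x.

Hypothesis conn : connected [set: T].

(** The points that a lift starting from [g] can reach form a clopen set: inside a neighbourhood
    carrying a local lift, [lift_glue] carries reachability from one point to any other. *)
Lemma lift_upto p r (g : gser F) : (forall y, iota p <= iota y -> ext_right iota F y) ->
  iota p <= iota r -> lift_at g p ->
  exists h, good_on h p r /\ (forall x, iota x <= iota p -> h x = g x).
Proof.
move=> ext pr gp.
pose good r := exists h, good_on h p r /\ (forall x, iota x <= iota p -> h x = g x).
(* Points to the left of [p] are put in [E], so that [E] can be clopen in the whole space. *)
pose E := [set r | iota p <= iota r -> good r].
have chart (x : T) : exists (h : gser F) (d : R),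
    0 < d /\ forall y, `|iota y - iota x| < d -> lift_at h y.
  have [h hx] := qgerm_surj (s x).
  have [U [Ux hU]] := lift_at_open hx.
  by have [d d0 dU] := embed Ux; exists h, d; split=> // y /dU/hU.
have goodp r' : iota r' <= iota p -> good r'.
  move=> rp; exists g; split=> // x px xr.
  have e : iota p = iota x by apply/eqP; rewrite eq_le px (le_trans xr).
  have [U [Up gU]] := lift_at_open gp.
  by apply: gU; exact: iota_indist e Up.
have spread x (h : gser F) d q y : (forall w, `|iota w - iota x| < d -> lift_at h w) ->
    `|iota q - iota x| < d -> `|iota y - iota x| < d -> iota p <= iota q ->
    iota q <= iota y -> good q -> good y.
  move=> hd qx yx pq qy [h0 [h0good h0g]].
  have [||h1 [h1a h1b h1c]] := @lift_glue h0 h q (ext _ pq); [exact: h0good|exact: hd|].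
  exists h1; split=> [w pw wy|w wp]; last by rewrite h1a ?h0g// (le_trans wp).
  have [wq|qw] := leP (iota w) (iota q); first by apply: h1b => //; exact: h0good.
  apply: h1c; first exact: ltW.
  by apply: hd; move: qx yx; rewrite !ltr_distl; lra.
(* Membership in [E] is constant on each chart, which makes both [E] and its complement open. Moving
   left restricts the lift; moving right glues from [y], or from [p] when [y] does not lie to the
   right of [p]. *)
have spreadE x (h : gser F) d y y' : (forall w, `|iota w - iota x| < d -> lift_at h w) ->
    `|iota y - iota x| < d -> `|iota y' - iota x| < d -> E y -> E y'.
  move=> hd yx y'x Ey py'.
  have [yy'|y'y] := leP (iota y) (iota y'); last first.
    have [h0 [h0good h0g]] := Ey (le_trans py' (ltW y'y)).
    by exists h0; split=> // w pw wy'; apply: h0good => //; apply: le_trans wy' (ltW y'y).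
  have [yp|py] := leP (iota y) (iota p).
    apply: (@spread x h d p) => //; last exact: goodp.
    by move: yx y'x; rewrite !ltr_distl; lra.
  by apply: (@spread x h d y) => //; [exact: ltW|exact/Ey/ltW].
have openball x d : open [set y | `|iota y - iota x| < d].
  rewrite (_ : [set _ | _] = iota @^-1` [set t | `|t - iota x| < d])//.
  apply: open_iota; rewrite (_ : [set _ | _] = ball (iota x) d); first exact: ball_open.
  by apply/seteqP; split=> t /=; rewrite /ball /= distrC.
have nball x (d : R) : 0 < d -> nbhs x [set y | `|iota y - iota x| < d].
  move=> d0; apply: open_nbhs_nbhs; split; first exact: openball.
  by rewrite /= subrr normr0.
have cE : clopen E.
  split.
    rewrite openE => x Ex; have [h [d [d0 hd]]] := chart x.
    apply: filterS (nball x d d0) => y /= yx.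
    by apply: (spreadE x h d x) => //; rewrite subrr normr0.
  rewrite -openC openE => x nEx; have [h [d [d0 hd]]] := chart x.
  apply: filterS (nball x d d0) => y /= yx Ey.
  by apply/nEx/(spreadE x h d y) => //; rewrite subrr normr0.
have ET : E = setT.
  case: cE => oE clE; apply: conn; first by exists p => _; exact: goodp.
    by exists E; rewrite ?setTI.
  by exists E; rewrite ?setTI.
have Er : E r by rewrite ET.
exact: Er pr.
Qed.

(** Extend the lift from [e n] to [e n.+1] without altering earlier values, then pass to the limit,
    where each value is eventually constant. *)
Lemma lift_right p (g : gser F) : (forall y, iota p <= iota y -> ext_right iota F y) ->
  cofinal_from iota p -> lift_at g p ->
  exists h, forall x, iota p <= iota x -> lift_at h x.
Proof.
move=> ext [e [e0 eS efin]] gp.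
have epn n : iota p <= iota (e n) by elim: n => [|n /le_trans]; rewrite ?e0//; apply.
have step n (h : gser F) : exists h' : gser F, good_on h p (e n) ->
    good_on h' p (e n.+1) /\ forall x, iota x <= iota (e n) -> h' x = h x.
  (* A serration that is not a lift is returned unchanged, only to make the step a total function
     for [choice]. *)
  have [hgood|] := pselect (good_on h p (e n)); last by exists h.
  have [y py|||h' [h'good h'h]] := @lift_upto (e n) (e n.+1) h.
  - by apply: ext; exact: le_trans py.
  - exact: eS.
  - exact: hgood.
  exists h' => _; split=> // x px xe; have [xn|nx] := leP (iota x) (iota (e n)).
    have hx := hgood x px xn.
    move: xn; rewrite le_eqVlt => /predU1P[xn|lt]; first by apply: h'good => //; rewrite xn.
    apply: lift_at_near hx; apply: near_eq_lt lt => w wn.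
    by rewrite h'h// ltW.
  by apply: h'good => //; exact: ltW.
have [nxt nxtP] := choice (fun nh => step nh.1 nh.2).
pose c := fix c n := if n is m.+1 then nxt (m, c m) else g.
have cgood n : good_on (c n) p (e n).
  elim: n => [|n IH]; last by have [] := nxtP (n, c n) IH.
  rewrite e0 => x px xp; have [U [Up gU]] := lift_at_open gp.
  by apply: gU; apply: iota_indist Up; apply/eqP; rewrite eq_le px.
have cS n m x : iota x <= iota (e n) -> c (n + m)%N x = c n x.
  move=> xn; elim: m => [|m IH]; first by rewrite addn0.
  rewrite addnS -IH; have [_] := nxtP (_, c (n + m)%N) (cgood (n + m)%N); apply.
  rewrite /=; elim: m {IH} => [|m /le_trans]; rewrite ?addn0// addnS; apply; exact: eS.
have cc n m x : iota x <= iota (e n) -> iota x <= iota (e m) -> c n x = c m x.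
  move=> xn xm; have [nm|mn] := leqP n m; first by rewrite -(subnKC nm) cS.
  by rewrite -(subnKC (ltnW mn)) cS.
have [N NP] := choice efin.
(* All of [U] lies before [e (N x)], so on [U] the limit coincides with the single lift
   [c (N x)]. *)
exists (fun x => c (N x) x) => x px; have [U [Ux hU]] := NP x.
apply: (@lift_at_near (c (N x))); last by apply: cgood => //; exact: hU.
exists U; split=> // y Uy; apply: cc; first exact: hU.
by have [V [Vy hV]] := NP y; exact: hV.
Qed.

End Right.
End Lift.

(** A lift to the right of [p] and a lift to its left, obtained by reflection, are glued at [p].
    Germs need only continue away from [p]. *)
Lemma line_lifts iota p F : line iota p ->
  (forall y, iota p <= iota y -> ext_right iota F y) ->
  (forall y, iota y <= iota p -> ext_right (fun x => - iota x) F y) ->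
  lifts F.
Proof.
move=> lT extr extl s sloc.
have [g gp] := qgerm_surj (s p).
have [gr grP] := lift_right sloc (line_cts lT) (line_embed lT) (line_conn lT)
   extr (line_cofinal lT) gp.
have lT' := line_opp lT.
have [|gl glP] := lift_right sloc (line_cts lT') (line_embed lT') (line_conn lT')
   _ (line_cofinal lT') gp.
  by move=> y; rewrite lerN2; exact: extl.
have [||h [h1 h2 h3]] :=
  @lift_glue F s iota (line_cts lT) (line_embed lT) gl gr p (extr p (lexx _)).
- by apply: glP; rewrite lexx.
- by apply: grP; rewrite lexx.
exists h => x; have [xp|px] := leP (iota x) (iota p).
  by apply: h2 => //; apply: glP; rewrite lerN2.
by apply: h3; [exact: ltW|apply/grP/ltW].
Qed.

(** A germ of the quotient comes from a global serration, so it continues everywhere; acyclicity in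
    higher degrees thus puts no condition on [F]. *)
Lemma quot_lifts iota p F : line iota p -> lifts (quot_serrations F).
Proof.
move=> lT; apply: line_lifts lT _ _ => y _ a; have [g <-] := qgerm_surj a;
  by exists (qgerm g); split=> // x _; exact: qgerm_loc.
Qed.

Lemma line_godement_exact iota p F : line iota p -> lifts F ->
  forall n (x : godement_complex F n.+1),
  cobd (godement_complex F) n.+1 x = 0 -> exists y, cobd (godement_complex F) n y = x.
Proof.
move=> lT lF n; apply: godement_exact; case: n => [//|n].
exact: quot_lifts lT.
Qed.

End Line.

(** * Sheaves with one wall of discontinuity *)

Section Model.
Variables (R : realType) (V W : zmodType).

Section Def.
Variables (T : topologicalType) (iota : T -> R).

(** The subgroup of [V * W] that is the stalk at [x]: beyond the wall everything, elsewhere only the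
    part [V]. *)
Definition allowed (x : T) (v : V * W) := 0 < iota x \/ v.2 = 0.

(* [F] is the direct sum of the constant sheaf [V] and of the extension by zero
   of the constant sheaf [W] on the open set [0 < iota]. *)
Record model (F : presheaf T) := Model {
  mev : forall (U : opens T) (x : T), oset U x -> F U -> V * W;
  mevB : forall U x (Ux : oset U x), zmod_morphism (mev Ux);
  mev_res : forall (U U' : opens T) (h : U' `<=` U) x (Ux : oset U x) (U'x : oset U' x) s,
    mev U'x (res h s) = mev Ux s;
  mev_eq0 : forall U x (Ux : oset U x) s, mev Ux s = 0 ->
    exists (U' : opens T) (h : U' `<=` U), oset U' x /\ res h s = 0;
  mev_allowed : forall U x (Ux : oset U x) s, allowed x (mev Ux s);
  mev_surj : forall x v, allowed x v ->
    exists (U : opens T) (Ux : oset U x) s, mev Ux s = v;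
  mev_const : forall U s x (Ux : oset U x), exists (U' : opens T), oset U' x /\
    forall y (Uy : oset U y), oset U' y -> mev Uy s = mev Ux s }.

Hypothesis cts : continuous iota.

Section Stalk.
Variables (F : presheaf T) (M : model F).

(** Identifies the stalk with the allowed vectors; independence of the representative of the germ is
    [mskE]. *)
Definition msk x (a : stalk F x) : V * W :=
  mev M (@pdom_sub _ _ _ (repr a) x erefl) (psec (repr a)).

Lemma mskE (U : opens T) x (h : [set x] `<=` U) (Ux : oset U x) (s : F U) :
  msk (germ h s) = mev M Ux s.
Proof.
have /germP[U' [h1 [h2 [U'x e]]]] := germ_repr (germ h s : stalk F x).
have U'x' := U'x x erefl.
by rewrite /msk -(mev_res M h1 _ U'x') e (mev_res M h2 Ux).
Qed.

Lemma mskB x : zmod_morphism (@msk x).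
Proof.
move=> a b; have [U [h [s [t [-> ->]]]]] := germW2 a b.
have Ux := h x erefl.
by rewrite -raddfB !(mskE _ Ux) mevB.
Qed.

Lemma msk_inj x : injective (@msk x).
Proof.
move=> a b e; apply/eqP; rewrite -subr_eq0; apply/eqP.
have : msk (a - b) = 0 by rewrite mskB e subrr.
have [U [h [s ->]]] := germW (a - b); have Ux := h x erefl.
rewrite (mskE _ Ux) => /mev_eq0[U' [h' [U'x e']]].
by rewrite -(germ_res h (sub1P U'x) h') e' raddf0.
Qed.

Lemma msk_allowed x (a : stalk F x) : allowed x (msk a).
Proof. exact: mev_allowed. Qed.

Lemma msk_surj x v : allowed x v -> exists a : stalk F x, msk a = v.
Proof.
move=> /(mev_surj M)[U [Ux [s <-]]]; exists (germ (sub1P Ux) s).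
exact: mskE.
Qed.

Definition near_const (f : T -> V * W) x :=
  exists U : opens T, oset U x /\ forall y, oset U y -> f y = f x.

(** Germs are determined by their values, and sections have locally constant values; continuity of a
    serration is therefore local constancy of its values. *)
Lemma near_const_loc (g : gser F) x :
  near_const (fun y => msk (g y)) x <-> loc_at g x.
Proof.
split=> [[U [Ux e]]|[U [t [Ux gt]]]].
  have [U1 [h [s gxE]]] := germW (g x); have U1x := h x erefl.
  have [U2 [U2x s_const]] := mev_const M s U1x.
  have h3 : opensI U1 (opensI U U2) `<=` U1 by move=> y [].
  exists (opensI U1 (opensI U U2)), (res h3 s); split=> // y Uy.
  have [U1y [Uy' U2y]] := Uy y erefl; apply: msk_inj.
  rewrite e// gxE (mskE h U1x) (germ_res (sub1P U1y) Uy h3) (mskE _ U1y).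
  by rewrite s_const.
have [U2 [U2x t_const]] := mev_const M t Ux.
exists (opensI U U2); split=> // y [Uy U2y].
by rewrite (gt y (sub1P Uy)) (gt x (sub1P Ux)) (mskE _ Uy) (mskE _ Ux) t_const.
Qed.

(** The constant serration of value [v] where [v] is allowed; zero is a default elsewhere. *)
Definition msec (v : V * W) : gser F := fun x =>
  match pselect (exists a : stalk F x, msk a = v) with
  | left h => sval (cid h) | right _ => 0 end.

Lemma msk_msec v x : allowed x v -> msk (msec v x) = v.
Proof.
move=> /msk_surj h; rewrite /msec; case: pselect => // h'.
by case: (cid h').
Qed.

Lemma msec_loc v x : allowed x v -> loc_at (msec v) x.
Proof.
move=> vx; apply/near_const_loc; case: (vx) => [x0|v0]; last first.
  by exists (opensT T); split=> // y _; rewrite !msk_msec//; right.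
exists (Opens (open_iota cts (@open_gt _ 0))); split=> // y y0.
by rewrite !msk_msec//; left.
Qed.

(** The groups of allowed values grow with [iota], so the constant section through a germ exists all
    the way to the right. *)
Lemma model_ext_right p : ext_right iota F p.
Proof.
move=> a; exists (msec (msk a)); split.
  by apply: msk_inj; rewrite msk_msec//; exact: msk_allowed.
move=> x px; apply: msec_loc; have [p0|v0] := msk_allowed a; last by right.
by left; exact: lt_le_trans px.
Qed.

(** Going left, a component in [W] would be stopped by the wall. Either the germ has none, or there
    is no wall. *)
Lemma model_ext_left p : iota p <= 0 \/ (forall x, 0 < iota x) ->
  ext_right (fun x => - iota x) F p.
Proof.
move=> hp a; exists (msec (msk a)); split.
  by apply: msk_inj; rewrite msk_msec//; exact: msk_allowed.
move=> x px; apply: msec_loc; have [p0|v0] := msk_allowed a; last by right.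
by case: hp => [|h]; [rewrite leNgt p0|left; exact: h].
Qed.

Lemma loc_msk_const (g : gser F) : connected [set: T] -> (forall x, loc_at g x) ->
  forall x y, msk (g x) = msk (g y).
Proof.
move=> conn gloc x y; pose E := [set z | msk (g z) = msk (g x)].
have opn (P : V * W -> Prop) : open [set z | P (msk (g z))].
  rewrite openE => z Pz; have /near_const_loc[U [Uz e]] := gloc z.
  apply: (@filterS _ _ _ U); first by move=> w /e; rewrite /= => ->.
  by apply: open_nbhs_nbhs; split=> //; exact: oset_open.
have ET : E = setT.
  apply: conn; first by exists x.
    by exists E; rewrite ?setTI//; exact: (opn (fun v => v = msk (g x))).
  exists E; rewrite ?setTI// -openC; exact: (opn (fun v => v <> msk (g x))).
have : E y by rewrite ET.
by move=> ->.
Qed.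

Variable p : T.
Hypothesis hp : iota p <= 0 \/ forall x, 0 < iota x.
Hypothesis lT : line iota p.

(** The base point is at or before the wall, unless there is no wall; every point to its left is
    then one from which germs continue to the left. *)
Lemma model_lifts : lifts F.
Proof.
apply: line_lifts lT _ _ => y yp; first exact: model_ext_right.
apply: model_ext_left; case: hp => [p0|]; [left|by right].
exact: le_trans p0.
Qed.

Lemma model_godement_exact n (x : godement_complex F n.+1) :
  cobd (godement_complex F) n.+1 x = 0 -> exists y, cobd (godement_complex F) n y = x.
Proof. exact: line_godement_exact lT model_lifts _ _. Qed.

Lemma model_acyclic k : (1 <= k)%N -> zmod_zero (sheaf_cohomology F k).
Proof.
by case: k => // k _; apply: cohomology_zero => x; exact: model_godement_exact.
Qed.

(** A global section has constant value, and at [p], not beyond the wall, only the component in [V]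
    can be nonzero. *)
Lemma model_H0 : iota p <= 0 -> zmod_iso (sheaf_cohomology F 0) V.
Proof.
move=> p0; pose g (z : cocycle (godement_complex F) 0) :=
  (msk (to_gser (val z : godement F 0 (opensT T)) p)).1.
apply: (@cohomology_iso (godement_complex F) 0 V g).
- move=> z z'; exact: (congr1 fst (mskB (to_gser (val z : godement F 0 (opensT T)) p)
    (to_gser (val z' : godement F 0 (opensT T)) p))).
- move=> v; have av x : allowed x (v, 0) by right.
  have dz : cobd (godement_complex F) 0 (of_gser (msec (v, 0)) (opensT T)) = 0.
    by apply/godement_cocycleP => x; exact: (msec_loc (av x)).
  exists (cocycle_of dz); rewrite /g /= /to_gser /of_gser /=.
  by rewrite msk_msec.
- rewrite /g => z /=; split=> [e|->]; last first.
    have -> : to_gser (0 : godement_complex F 0) p = 0 by [].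
    by have := mskB (0 : stalk F p) 0; rewrite !subrr => ->.
  have zloc := proj1 (godement_cocycleP (n := 0) (val z)) (cobd_val z).
  apply: gser_ext => x; apply: msk_inj.
  rewrite (loc_msk_const (line_conn lT) zloc x p).
  have -> : msk (to_gser (0 : godement_complex F 0) x) = 0.
    by have := mskB (0 : stalk F x) 0; rewrite !subrr => ->.
  have [p0'|] := msk_allowed (to_gser (val z) p); first by rewrite ltNge p0 in p0'.
  by move: e; case: msk => /= ? ? -> ->.
Qed.

End Stalk.
End Def.
End Model.

(** * Models under sheafification and inverse image *)

Section ModelConstructions.
Variables (R : realType) (V W : zmodType).

Section Sheafify.
Variables (T : topologicalType) (iota : T -> R) (P : presheaf T).
Variable M : model V W iota P.

Definition sh_val (U : opens T) x (Ux : oset U x) (s : sheafify P U) : stalk P x :=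
  val s (SigSub (mem_set Ux)).

Lemma sheaf_local (U : opens T) x (Ux : oset U x) (s : sheafify P U) :
  exists (U' : opens T) (h : U' `<=` U) (t : P U'), oset U' x /\
    forall y (Uy : oset U y) (U'y : [set y] `<=` U'), sh_val Uy s = germ U'y t.
Proof.
have /asboolP/(_ (SigSub (mem_set Ux)))[U' [h [t [U'x e]]]] := valP s.
exists U', h, t; split=> // y Uy U'y; have U'y' := U'y y erefl.
have /= := congr1 (fun f => f (SigSub (mem_set U'y') : U')) e.
rewrite /to_serration /serration_res /= => e'.
transitivity (germ (@sub1 T U' (SigSub (mem_set U'y'))) t : stalk P y); last exact: germ_irr.
rewrite -e' /sh_val /incl /=; congr (val s (SigSub _)); exact: Prop_irrelevance.
Qed.

(** Values are read off stalks, which sheafification preserves. The construction is transparent so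
    that [model_sheafify_msk] can compute with it. *)
Lemma model_sheafify : model V W iota (sheafify P).
Proof.
pose ev (U : opens T) x (Ux : oset U x) (s : sheafify P U) := msk M (sh_val Ux s).
apply: (@Model _ _ _ _ _ _ ev).
- by move=> U x Ux s t; exact: mskB.
- move=> U U' h x Ux U'x s; congr (msk M _).
  by rewrite /sh_val /= /serration_res /incl /=;
      congr (val s (SigSub _)); exact: Prop_irrelevance.
- move=> U x Ux s e; have [U' [h [t [U'x st]]]] := sheaf_local Ux s.
  have : sh_val Ux s = 0.
    apply: (@msk_inj _ _ _ _ _ _ M); rewrite [LHS]e.
    by have := mskB M (0 : stalk P x) 0; rewrite !subrr.
  rewrite (st x Ux (sub1P U'x)) [0](germ0E _ (sub1P U'x)).
  move=> /germP[U2 [h1 [h2 [U2x]]]]; rewrite raddf0 => e2.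
  exists U2, (subset_trans h1 h); split; first exact: U2x.
  apply/val_inj/functional_extensionality_dep => -[y yU2].
  have U2y := set_mem yU2; have Uy : oset U y by exact/h/h1.
  transitivity (sh_val Uy s).
    by rewrite /sh_val /= /serration_res /incl /=;
      congr (val s (SigSub _)); exact: Prop_irrelevance.
  rewrite (st y Uy (sub1P (h1 _ U2y))) -(germ_res _ (sub1P U2y) h1) e2 raddf0.
  by [].
- by move=> U x Ux s; exact: msk_allowed.
- move=> x v /(mev_surj M)[U [Ux [s e]]]; exists U, Ux, (to_sheaf s).
  rewrite -e -(mskE M (sub1P Ux)); congr (msk M _).
  exact: germ_irr.
- move=> U s x Ux; have [U' [h [t [U'x st]]]] := sheaf_local Ux s.
  have [U2 [U2x c]] := mev_const M t U'x.
  exists (opensI U' U2); split=> // y Uy [U'y U2y].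
  rewrite /ev (st y Uy (sub1P U'y)) (st x Ux (sub1P U'x)).
  by rewrite (mskE M _ U'y) (mskE M _ U'x) c.
Defined.

Lemma model_sheafify_msk (U : opens T) x (Ux : oset U x) (s : sheafify P U) :
  mev model_sheafify Ux s = msk M (sh_val Ux s).
Proof. by []. Qed.

End Sheafify.

Section InverseImage.
Variables (X T : topologicalType) (f : X -> T) (cf : continuous f).
Variables (iota : T -> R) (F : presheaf T) (M : model V W iota F).

Let G := inverse_image_presheaf f F.

Lemma image1 (U : opens X) x : oset U x -> [set f x] `<=` f @` U.
Proof. by move=> Ux _ ->; exists x. Qed.

Definition ii_val (U : opens X) x (Ux : oset U x) (a : G U) : stalk F (f x) :=
  germs_res (image1 Ux) (a : germs F (f @` U)).

Lemma ii_local (U : opens X) (a : G U) : exists (B : opens T) (h : f @` U `<=` B) s,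
  a = germ h s /\ forall x (Ux : oset U x) (k : [set f x] `<=` B), ii_val Ux a = germ k s.
Proof.
have [B [h [s e]]] := germW (a : germs F (f @` U)).
exists B, h, s; split=> // x Ux k.
by rewrite /ii_val e (germs_resE _ _ k).
Qed.

(** The stalk of the inverse image at [x] is the stalk of [F] at [f x], so the values of [F] are
    reused; this too is kept transparent for [msk_chom_stalk]. *)
Lemma model_inverse_image : model V W (iota \o f) G.
Proof.
pose ev (U : opens X) x (Ux : oset U x) (a : G U) := msk M (ii_val Ux a).
apply: (@Model _ _ _ _ _ _ ev).
- by move=> U x Ux s t; rewrite /ev /ii_val raddfB mskB.
- move=> U U' h x Ux U'x a; congr (msk M _).
  exact: germs_res_comp.
- move=> U x Ux a; have [B [h [s [ea aE]]]] := ii_local a.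
  have Bfx : oset B (f x) by apply: (h); exists x.
  rewrite /ev (aE x Ux (sub1P Bfx)) (mskE M _ Bfx) => /mev_eq0[B' [h' [B'x e]]].
  have kU : opensI U (opens_pre cf B') `<=` U by move=> y [].
  exists (opensI U (opens_pre cf B')), kU; split=> //.
  have hB' : f @` opensI U (opens_pre cf B') `<=` B' by move=> _ [y [_ ?] <-].
  have hB := subset_trans hB' h'.
  rewrite ea /=; transitivity (germ hB s : germs F (f @` opensI U (opens_pre cf B'))).
    exact: germs_resE.
  by rewrite -(germ_res hB hB' h') e raddf0.
- by move=> U x Ux a; exact: (@msk_allowed _ _ _ _ _ _ M (f x)).
- move=> x v /(@mev_surj _ _ _ _ _ _ M (f x))[B [Bx [s e]]].
  have h : f @` opens_pre cf B `<=` B by move=> _ [y ? <-].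
  exists (opens_pre cf B), Bx, (germ h s); rewrite -e -(mskE M (sub1P Bx)).
  congr (msk M _); exact: germs_resE.
- move=> U a x Ux; have [B [h [s [ea aE]]]] := ii_local a.
  have Bx : oset B (f x) by apply: (h); exists x.
  have [B' [B'x c]] := mev_const M s Bx.
  exists (opens_pre cf B'); split=> // y Uy B'y.
  have By : oset B (f y) by apply: (h); exists y.
  by rewrite /ev (aE x Ux (sub1P Bx)) (aE y Uy (sub1P By)) !(mskE M) c.
Defined.

End InverseImage.

Section Relative.
Variables (T : topologicalType) (iota : T -> R) (F : presheaf T).
Variables (M : model V W iota F) (A : set T).

Notation cA := (@continuous_set_val T A).
Let G := inverse_image (set_val : A -> T) F.

Definition model_restrict : model V W (iota \o (set_val : A -> T)) G :=
  model_sheafify (model_inverse_image cA M).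

Let phi := inverse_image_map cA F.

(** Restriction to [A] preserves values, so global sections over the space and over [A] can be
    compared in [V * W]. *)
Lemma msk_chom_stalk (x : A) (a : stalk F (val x)) :
  msk model_restrict (chom_stalk phi a) = msk M a.
Proof.
have [U [h [s ->]]] := germW a; have Ux := h (val x) erefl.
have Ux' : oset (opens_pre cA U) x by exact: Ux.
rewrite (@chom_stalkE _ _ _ _ _ _ phi x U h (sub1P Ux')) (mskE _ _ Ux') model_sheafify_msk.
rewrite (mskE M h Ux) -(mskE M (sub1P Ux)).
pose gs : inverse_image_presheaf (set_val : A -> T) F (opens_pre cA U) :=
  germ (@Defs.image_pre _ _ _ cA U) s.
transitivity (msk (model_inverse_image cA M)
  (germ (sub1P Ux') gs : stalk (inverse_image_presheaf (set_val : A -> T) F) x)).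
  by congr msk; exact: germ_irr.
rewrite (mskE _ _ Ux') /=; congr msk; exact: germs_resE.
Qed.

End Relative.

End ModelConstructions.

(** * Surjectivity of restriction on canonical resolutions *)

Section ChomStalk.
Variables (T : topologicalType) (A : set T).
Notation cA := (@continuous_set_val T A).
Variables (F : presheaf T) (G : presheaf A) (phi : cohom_map cA F G).

(** Lift each germ separately over [A] and extend by zero outside [A]; serrations need no
    continuity. *)
Lemma chom_gser_surj : (forall x (a : stalk G x), exists b, chom_stalk phi b = a) ->
  forall c : gser G, exists d : gser F, forall x : A, chom_stalk phi (d (set_val x)) = c x.
Proof.
move=> surj c; pose d x := sval (cid (surj x (c x))).
have dP x : chom_stalk phi (d x) = c x by rewrite /d; case: cid.
exists (fun y => match pselect (A y) return stalk F y with
  | left Ay => d (SigSub (mem_set Ay)) | right _ => 0 end) => -[x xA].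
rewrite -[in RHS]dP /=; case: pselect => [Ax|]; last by case; exact: set_mem.
have -> : mem_set Ax = xA by exact: Prop_irrelevance.
by [].
Qed.

Lemma chom_quot_qgerm (d : gser F) (c : gser G) :
  (forall x : A, chom_stalk phi (d (set_val x)) = c x) ->
  forall x : A, chom_stalk (quot_serrations_map phi) (qgerm d (set_val x)) = qgerm c x.
Proof.
move=> dc x; rewrite /qgerm.
rewrite (@chom_stalkE _ _ _ _ _ _ (quot_serrations_map phi) x _ _
  (sub1P (I : oset (opens_pre cA (opensT T)) x))).
apply/germP; exists (opensT A), (@subset_refl _ _), (@subset_refl _ _); split=> //=.
rewrite chom_quotE !quot_resE; congr qser.
by apply: functional_extensionality_dep => -[y yA]; exact: dc.
Qed.

Lemma chom_stalk_quot_surj : (forall x (a : stalk G x), exists b, chom_stalk phi b = a) ->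
  forall x (a : stalk (quot_serrations G) x),
    exists b, chom_stalk (quot_serrations_map phi) b = a.
Proof.
move=> surj x a; have [c <-] := qgerm_surj a.
have [d dP] := chom_gser_surj surj c.
by exists (qgerm d (set_val x)); exact: chom_quot_qgerm.
Qed.

End ChomStalk.

Lemma syzygy_stalk_surj (T : topologicalType) (A : set T) (F : presheaf T) (G : presheaf A)
    (phi : cohom_map (@continuous_set_val T A) F G) n :
  (forall x (a : stalk G x), exists b, chom_stalk phi b = a) ->
  forall x (a : stalk (syzygy G n) x),
    exists b, chom_stalk (syzygy_map phi n) b = a.
Proof.
by move=> surj; elim: n => [//|n IH]; exact: chom_stalk_quot_surj.
Qed.

Lemma godement_mapE (T : topologicalType) (A : set T) (F : presheaf T) (G : presheaf A)
    (phi : cohom_map (@continuous_set_val T A) F G) n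
    (s : godement_complex F n) (x : A) :
  to_gser (godement_map phi n s : godement G n (opensT A)) x =
  chom_stalk (syzygy_map phi n) (to_gser (s : godement F n (opensT T)) (set_val x)).
Proof.
rewrite /to_gser /= /serration_res /chom_ser.
congr (chom_stalk _ (s (SigSub _))); exact: Prop_irrelevance.
Qed.

(** Surjectivity on stalks passes from each syzygy to the next, hence to all terms of the
    resolution. This makes the kernel complex compute the relative term of a long exact sequence. *)
Lemma godement_map_surj (T : topologicalType) (A : set T) (F : presheaf T) (G : presheaf A)
    (phi : cohom_map (@continuous_set_val T A) F G) :
  (forall x (a : stalk G x), exists b, chom_stalk phi b = a) ->
  forall n (y : godement_complex G n), exists x, godement_map phi n x = y.
Proof.
move=> surj n y.
have [d dP] := chom_gser_surj (@syzygy_stalk_surj _ _ _ _ _ n surj) (to_gser y).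
exists (of_gser d (opensT T)); apply: gser_ext => x.
by rewrite godement_mapE.
Qed.

(** * Relative cohomology of a model *)

Section ModelRelative.
Variables (R : realType) (V W : zmodType).
Variables (T : topologicalType) (iota : T -> R) (F : presheaf T).
Variables (M : model V W iota F) (p : T) (lT : line iota p).
Variables (A : set T) (q : A) (lA : line (iota \o (set_val : A -> T)) q).
Hypothesis p0 : iota p <= 0.
Hypothesis q0 : iota (set_val q) <= 0 \/ forall x : A, 0 < iota (set_val x).

Notation cA := (@continuous_set_val T A).
Let phi := inverse_image_map cA F.
Let N := model_restrict M A.
Let f := godement_map phi.

Lemma restrict_stalk_surj (x : A) (a : stalk (inverse_image (set_val : A -> T) F) x) :
  exists b, chom_stalk phi b = a.
Proof.
have [b e] : exists b : stalk F (set_val x), msk M b = msk N a.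
  by apply: msk_surj; have := msk_allowed N a.
by exists b; apply: (@msk_inj _ _ _ _ _ _ N); rewrite msk_chom_stalk.
Qed.

Let f_surj := godement_map_surj restrict_stalk_surj.

Lemma model_C_exact n (x : godement_complex F n.+1) :
  cobd (godement_complex F) n.+1 x = 0 -> exists y, cobd (godement_complex F) n y = x.
Proof. by apply: (model_godement_exact (line_cts lT) M _ lT); left. Qed.

Lemma msk_godement_map (x : godement_complex F 0) (y : A) :
  msk N (to_gser (f 0 x : godement _ 0 _) y) =
  msk M (to_gser (x : godement F 0 _) (set_val y)).
Proof. by rewrite godement_mapE; exact: msk_chom_stalk. Qed.

Lemma msk0 (T' : topologicalType) (i : T' -> R) (P : presheaf T') (M' : model V W i P) x :
  msk M' (0 : stalk P x) = 0.
Proof. by have := mskB M' (0 : stalk P x) 0; rewrite !subrr. Qed.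

(** A global section has constant value, hence vanishes as soon as it vanishes at the point [q] of
    [A]. *)
Lemma model_relative0 : zmod_zero (relative_cohomology F A 0).
Proof.
apply: ker_complex_zero0 => x /godement_cocycleP xloc fx.
apply: gser_ext => y; apply: (@msk_inj _ _ _ _ _ _ M).
rewrite (loc_msk_const M (line_conn lT) xloc y (set_val q)).
by rewrite -msk_godement_map fx [LHS](msk0 N) [RHS](msk0 M).
Qed.

(** Both the space and [A] are acyclic: a cocycle of positive degree over [A] is a coboundary and
    therefore lifts. *)
Lemma model_relativeSS n : zmod_zero (relative_cohomology F A n.+2).
Proof.
apply: (@ker_complex_zero _ _ f n.+1 (@model_C_exact _)).
move=> y dy; apply: (is_cobd_lift f_surj).
by have := model_godement_exact (line_cts lA) N q0 lA dy.
Qed.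

Lemma msec_cocycle v : (forall x, allowed iota x v) ->
  cobd (godement_complex F) 0 (of_gser (msec M v) (opensT T)) = 0.
Proof.
move=> av; apply/godement_cocycleP => x; exact: (msec_loc (line_cts lT) M (av x)).
Qed.

(** The section over [A] is constant, and a constant value without component in [W] is allowed on
    the whole space. *)
Lemma restrict_lift (y : godement_complex (inverse_image (set_val : A -> T) F) 0) :
  cobd (godement_complex _) 0 y = 0 ->
  (msk N (to_gser (y : godement _ 0 _) q)).2 = 0 ->
  exists2 x, cobd (godement_complex F) 0 x = 0 & f 0 x = y.
Proof.
move=> /godement_cocycleP yloc; set v := msk N _ => v0.
have av x : allowed iota x v by right.
exists (of_gser (msec M v) (opensT T)); first exact: msec_cocycle.
apply: gser_ext => x; apply: (@msk_inj _ _ _ _ _ _ N).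
rewrite msk_godement_map (loc_msk_const N (line_conn lA) yloc x q).
exact: (msk_msec M (av (set_val x))).
Qed.

Lemma model_relative1 : iota (set_val q) <= 0 -> zmod_zero (relative_cohomology F A 1).
Proof.
move=> q0'; apply: (@ker_complex_zero _ _ f 0 (@model_C_exact _)).
move=> y dy; apply: restrict_lift => //.
have [q1|//] := msk_allowed N (to_gser (y : godement _ 0 _) q).
by move: q1; rewrite /= ltNge q0'.
Qed.

(** Beyond the wall a section over [A] has an arbitrary component in [W], while sections over the
    whole space have none; the component in [W] is thus the cokernel of restriction. *)
Lemma model_relative1_iso : (forall x : A, 0 < iota (set_val x)) ->
  zmod_iso (relative_cohomology F A 1) W.
Proof.
move=> A0; pose g (z : cocycle (godement_complex (inverse_image (set_val : A -> T) F)) 0) :=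
  (msk N (to_gser (val z : godement _ 0 _) q)).2.
apply: (@ker_complex_iso _ _ _ f_surj _ (@model_C_exact 0) W g).
- move=> z z'; exact: (congr1 snd (mskB N (to_gser (val z : godement _ 0 _) q)
    (to_gser (val z' : godement _ 0 _) q))).
- move=> w; have av x : allowed (iota \o (set_val : A -> T)) x ((0, w) : V * W).
    by left; exact: A0.
  have dz : cobd (godement_complex (inverse_image (set_val : A -> T) F)) 0
      (of_gser (msec N (0, w)) (opensT A)) = 0.
    by apply/godement_cocycleP => x; exact: (msec_loc (line_cts lA) N (av x)).
  exists (cocycle_of dz); rewrite /g.
  by have /(congr1 snd) := msk_msec N (av q).
- move=> z; split=> [gz|[x dx fx]].
    by apply: restrict_lift gz; exact: cobd_val.
  rewrite /g -fx msk_godement_map.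
  have xloc := proj1 (godement_cocycleP (n := 0) (x : godement F 0 _)) dx.
  rewrite (loc_msk_const M (line_conn lT) xloc _ p).
  have [p1|//] := msk_allowed M (to_gser (x : godement F 0 _) p).
  by move: p1; rewrite /= ltNge p0.
Qed.

End ModelRelative.

(** * The real line and its closed rays *)

Section RealLines.
Variable R : realType.

Lemma nat_above (x : R) : exists n : nat, x < n%:R.
Proof.
exists (Num.bound `|x|); apply: le_lt_trans (ler_norm x) _.
exact/archi_boundP/normr_ge0.
Qed.

Lemma opens_ball (U : opens R) x : oset U x ->
  exists2 e : R, 0 < e & forall y, `|y - x| < e -> oset U y.
Proof.
move=> Ux; have /nbhs_ballP[e /= e0 eU] : nbhs x (oset U).
  by apply: open_nbhs_nbhs; split=> //; exact: oset_open.
by exists e => // y yx; apply: eU; rewrite /ball /= distrC.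
Qed.

(** The retraction [r] shows that [A] is connected, as a continuous image of the line. *)
Lemma line_retract (A : set R) (r : R -> R) (q : A) :
  continuous r -> (forall x, A (r x)) -> (forall x, A x -> r x = x) ->
  cofinal_from (set_val : A -> R) q -> cofinal_from (fun x : A => - set_val x) q ->
  line (set_val : A -> R) q.
Proof.
move=> rc rA rid c1 c2; split=> //; first exact: initial_continuous.
- pose f x : A := SigSub (mem_set (rA x)).
  have fc : continuous f by apply: continuous_comp_initial.
  rewrite (_ : [set: A] = f @` [set: R]).
    apply: connected_continuous_connected; last exact: continuous_subspaceT.
    by apply/connected_intervalP => ? ?.
  apply/seteqP; split=> // x _; exists (set_val x) => //; apply/val_inj => /=.
  by rewrite rid//; exact: set_valP.
- move=> x [U oU] /= Ux; move: (oU) => [B oB BU].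
  have [|e e0 eB] := @opens_ball (Opens oB) (set_val x); first by move: Ux; rewrite -BU.
  by exists e => // y /eB By; rewrite -BU.
Qed.

Lemma cofinal_above (T : topologicalType) (iota : T -> R) (e : R -> T) (q : T) (c : R) :
  continuous iota -> e c = q -> (forall t, c <= t -> iota (e t) = t) ->
  cofinal_from iota q.
Proof.
move=> ic ec ie; exists (fun n => e (c + n%:R)); split.
- by rewrite addr0.
- move=> n; rewrite !ie ?lerDl// lerD2l.
  by rewrite ler_nat.
- move=> x; have [n xn] := nat_above (iota x - c).
  exists n, (Opens (open_iota ic (@open_lt _ (c + n%:R)))); split.
    by rewrite /= -ltrBlDl.
  by move=> y /= yn; rewrite ie ?lerDl//; exact: ltW.
Qed.

(** The sequence must start at [q] and may then stay at the maximum. *)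
Lemma cofinal_max (T : topologicalType) (iota : T -> R) (q m : T) :
  (forall x, iota x <= iota m) -> cofinal_from iota q.
Proof.
move=> h; exists (fun n => if n is 0%N then q else m).
split=> [//|[|n]|x]; [exact: h|exact: lexx|].
by exists 1%N, (opensT T); split.
Qed.

Lemma line_real : line (@idfun R) 0.
Proof.
split.
- by move=> x; exact: cvg_id.
- by apply/connected_intervalP => ? ?.
- by move=> x U; exact: opens_ball.
- by apply: (@cofinal_above _ _ idfun _ 0) => // x; exact: cvg_id.
- apply: (@cofinal_above _ _ -%R _ 0); [|by rewrite oppr0|by move=> t _; rewrite opprK].
  by move=> x; apply: continuousN; exact: cvg_id.
Qed.

Lemma memray_ge (a : R) : `[a, +oo[%classic a.
Proof. by rewrite /= in_itv /= lexx. Qed.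

Lemma line_ge (a : R) :
  line (set_val : `[a, +oo[%classic -> R) (SigSub (mem_set (memray_ge a))).
Proof.
have rA x : `[a, +oo[%classic (Num.max a x) by rewrite /= in_itv /= le_max lexx.
apply: (@line_retract _ (Num.max a)) => //.
- by move=> x; apply: (@continuous_max R R (fun=> a) idfun); [exact: cvg_cst|exact: cvg_id].
- by move=> x; rewrite /= in_itv /= andbT => /max_idPr.
- apply: (@cofinal_above _ (set_val : `[a, +oo[%classic -> R)
    (fun x => SigSub (mem_set (rA x))) _ a).
  + exact: initial_continuous.
  + by apply/val_inj; rewrite /= maxxx.
  + by move=> t /max_idPr.
- apply: (@cofinal_max _ (fun x : `[a, +oo[%classic => - set_val x) _
    (SigSub (mem_set (memray_ge a)))) => -[x xA].
  by rewrite lerN2 /=; have := set_mem xA; rewrite /= in_itv /= andbT.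
Qed.

Lemma line_le (a b : R) (ab : b \in `]-oo, a]%classic) :
  line (set_val : `]-oo, a]%classic -> R) (SigSub ab).
Proof.
have rA x : `]-oo, a]%classic (Num.min a x) by rewrite /= in_itv /= ge_min lexx.
have ba : b <= a by have := set_mem ab; rewrite /= in_itv.
apply: (@line_retract _ (Num.min a)) => //.
- by move=> x; apply: (@continuous_min R R (fun=> a) idfun); [exact: cvg_cst|exact: cvg_id].
- by move=> x; rewrite /= in_itv /= => /min_idPr.
- apply: (@cofinal_max _ (set_val : `]-oo, a]%classic -> R) _
    (SigSub (mem_set (rA a)))) => -[x xA] /=.
  have xa : x <= a by have := set_mem xA; rewrite /= in_itv.
  by apply: le_trans xa _; rewrite [leRHS](minxx a).
- apply: (@cofinal_above _ (fun x : `]-oo, a]%classic => - set_val x)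
    (fun x => SigSub (mem_set (rA (- x)))) _ (- b)).
  + by move=> x; apply: continuousN; exact: initial_continuous.
  + by apply/val_inj; rewrite /= opprK; exact/min_idPr.
  + move=> t bt; have /min_idPr e : - t <= a by apply: le_trans ba; rewrite lerNl.
    by rewrite -[RHS]opprK; congr (- _); exact: e.
Qed.

Variables (V W : zmodType) (F : presheaf R) (M : model V W idfun F).

Theorem model_cohomology :
  [/\ forall k : nat, (1 <= k)%N -> zmod_zero (sheaf_cohomology F k),
      zmod_iso (sheaf_cohomology F 0) V,
      exists lam0 : R, forall (a : R) (k : nat),
        (k = 1%N /\ lam0 < a -> zmod_iso (relative_cohomology F `[a, +oo[ k) W) /\
        (k <> 1%N \/ a <= lam0 -> zmod_zero (relative_cohomology F `[a, +oo[ k)) &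
      forall (a : R) (k : nat), zmod_zero (relative_cohomology F `]-oo, a] k)].
Proof.
have lT := line_real; have cT := line_cts lT.
split.
- by move=> k; apply: (model_acyclic cT M (or_introl _) lT).
- exact: (model_H0 cT M lT (lexx 0)).
(* The wall of the model is at 0, and the ray lies entirely beyond it exactly when [0 < a]. *)
- exists 0 => a k; have lA := line_ge a; split=> [[-> a0]|].
    apply: (model_relative1_iso M lT lA) => //.
      by move=> x; have := set_valP x; rewrite /= in_itv /= andbT; exact: lt_le_trans.
  have q0 : a <= 0 \/ forall x : `[a, +oo[%classic, 0 < set_val x.
    have [|a0] := leP a 0; [by left|right=> x].
    by have := set_valP x; rewrite /= in_itv /= andbT; exact: lt_le_trans.
  case: k => [_|[[//|a0]|k _]].
  + exact: (model_relative0 M lT (SigSub (mem_set (memray_ge a)))).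
  + exact: (model_relative1 M lT lA (lexx 0) a0).
  + exact: (model_relativeSS M lT lA (lexx 0) q0).
- move=> a k.
  (* This base point belongs to the ray and is never beyond the wall. *)
  have bA : Num.min a 0 \in `]-oo, a]%classic by rewrite inE /= in_itv /= ge_min lexx.
  have lA := line_le bA; have b0 : set_val (SigSub bA) <= 0.
    by apply: (@le_trans _ _ (Num.min a 0)) => //; rewrite ge_min lexx orbT.
  case: k => [|[|k]].
  + exact: (model_relative0 M lT (SigSub bA)).
  + exact: (model_relative1 M lT lA (lexx 0) b0).
  + exact: (model_relativeSS M lT lA (lexx 0) (or_introl b0)).
Qed.

End RealLines.

(** * The pitchfork flow *)

Section ScalarODE.
Variable R : realType.
Implicit Types (F G u : R -> R).

Record solution F u := Solution {
  sol_cts : {within `[0, +oo[, continuous u};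
  sol_derive : forall t : R, 0 < t -> is_derive t 1 u (F (u t)) }.

(** Solutions need not be unique when [F] is merely continuous; [fl_rest] records that an orbit
    reaching a zero of [F] stays there. *)
Record flow_line F u := FlowLine {
  fl_sol : solution F u;
  fl_rest : forall s t : R, 0 <= s -> s <= t -> F (u s) = 0 -> u t = u s }.

Lemma sol_cts_in F u (a b : R) : solution F u -> 0 <= a -> {within `[a, b], continuous u}.
Proof.
move=> [cu _] a0; apply: continuous_subspaceW cu => x /=.
by rewrite !in_itv /= andbT => /andP[ax _]; exact: le_trans ax.
Qed.

Lemma sol_MVT F u (a b : R) : solution F u -> 0 <= a -> a < b ->
  exists2 c, a < c < b & u b - u a = F (u c) * (b - a).
Proof.
move=> su a0 ab; have [|c] := MVT (f := u) (df := F \o u) ab _ (sol_cts_in su a0).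
  by move=> x; rewrite in_itv /= => /andP[ax _]; apply: sol_derive su _ (le_lt_trans a0 ax).
by rewrite in_itv /= => cab e; exists c.
Qed.

Lemma solution_opp F u : solution F u -> solution (fun x => - F (- x)) (\- u).
Proof.
move=> [cu du]; split=> [|t t0].
  by move=> x; apply: continuousN; exact: cu.
rewrite opprK; have := du t t0; exact: is_deriveN.
Qed.

Lemma flow_line_opp F u : flow_line F u -> flow_line (fun x => - F (- x)) (\- u).
Proof.
move=> [su r]; split=> [|s t s0 st]; first exact: solution_opp.
by move=> /eqP; rewrite oppr_eq0 opprK => /eqP/(r s t s0 st) e; rewrite /= e.
Qed.

(* On a short interval the mean value theorem makes the largest deviation from
   [z] at most half of itself, because [F] is locally Lipschitz at its zero [z]. *)
Lemma rest_short F G u (z : R) : {for z, continuous G} ->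
  (forall x, F x = (x - z) * G x) -> solution F u -> u 0 = z ->
  exists2 e : R, 0 < e & forall t, 0 <= t -> t <= e -> u t = z.
Proof.
move=> cG FG su u0.
pose K : R := `|G z| + 1.
have K0 : 0 < K by rewrite ltr_pwDr.
have [d d0 dK] : exists2 d : R, 0 < d & forall x, `|x - z| < d -> `|G x| <= K.
  have /cvgrPdist_lt/(_ 1 ltr01)/nbhs_ballP[d /= d0 dG] := cG.
  exists d => // x xz; have := dG x; rewrite /ball /= distrC => /(_ xz) /ltW h.
  rewrite -[G x](subrK (G z)) addrC; apply: le_trans (ler_normD _ _) _.
  by rewrite lerD2l distrC.
have [e1 e10 ed] : exists2 e : R, 0 < e & forall t, 0 <= t -> t <= e -> `|u t - z| < d.
  have := sol_cts su => /subspace_continuousP/(_ 0).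
  rewrite /= in_itv /= lexx => /(_ isT)/cvgrPdist_lt/(_ d d0).
  rewrite near_withinE /from_subspace u0 => /nbhs_ballP[e /= e0 eu].
  exists (e / 2); first by rewrite divr_gt0.
  move=> t t0 te; rewrite distrC; apply: eu.
    by rewrite /ball /= sub0r normrN ger0_norm//; lra.
  by rewrite /= in_itv /= t0.
(* The second bound gives [e * K <= 1 / 2], the contraction factor. *)
pose e : R := Num.min e1 (2 * K)^-1.
have e0 : 0 < e by rewrite lt_min e10 invr_gt0 mulr_gt0.
have eK : e * K < 1.
  have : e <= (2 * K)^-1 by rewrite ge_min lexx orbT.
  rewrite -(ler_pM2r K0) => /le_lt_trans; apply.
  by rewrite invfM -mulrA mulVf ?gt_eqF//; lra.
exists e => //.
have [m mE mmax] : exists2 c, c \in `[0, e] &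
    forall t, t \in `[0, e] -> `|u t - z| <= `|u c - z|.
  apply: (@EVT_max R (fun t => `|u t - z|)); first exact: ltW.
  move=> t; apply: cvg_norm; apply: cvgB; last exact: cvg_cst.
  exact: (sol_cts_in su (lexx 0)).
suff um : u m = z.
  move=> t t0 te; have := mmax t; rewrite in_itv /= t0 te => /(_ isT).
  by rewrite um subrr normr0 normr_le0 subr_eq0 => /eqP.
move: mE; rewrite in_itv /= => /andP[m0 me].
have [->//|mgt0] := eqVneq m 0; have {}m0 : 0 < m by rewrite lt_def mgt0.
have [c /andP[c0 cm] uc] := sol_MVT su (lexx 0) m0.
move: uc; rewrite u0 subr0 => uc; apply/eqP; rewrite -subr_eq0 -normr_le0.
have c1 : `|u c - z| <= `|u m - z|.
  by apply: mmax; rewrite in_itv /= (ltW c0) (le_trans (ltW cm)).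
have c2 : `|G (u c)| <= K.
  apply/dK/ed; first exact: ltW.
  by apply: le_trans (ltW cm) (le_trans me _); rewrite ge_min lexx.
have h : `|u m - z| <= `|u m - z| * (e * K).
  rewrite [leLHS](_ : _ = `|u c - z| * (m * `|G (u c)|)); last first.
    by rewrite uc FG !normrM (gtr0_norm m0) -mulrA [m * _]mulrC.
  apply: ler_pM => //; first by rewrite mulr_ge0// ltW.
  by apply: ler_pM => //; exact: ltW.
have := normr_ge0 (u m - z); rewrite le_eqVlt => /predU1P[<-//|pos].
by move: h; rewrite ler_pMr// leNgt eK.
Qed.

Section FlowLine.
Variables (F u : R -> R).
Hypotheses (cF : continuous F) (fu : flow_line F u).

Lemma speed_cts (a b : R) : 0 <= a -> {within `[a, b], continuous (F \o u)}.
Proof.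
move=> a0; have h := @sol_cts_in F u a b (fl_sol fu) a0.
by move=> x; apply: (@continuous_comp (subspace `[a, b]) R R u F x (h x)); exact: cF.
Qed.

(** If the speed were nonnegative earlier, it would vanish in between by the intermediate value
    theorem, and the orbit would remain at rest. *)
Lemma speed_neg (s t : R) : 0 <= s -> s <= t -> F (u t) < 0 -> F (u s) < 0.
Proof.
move=> s0 st ut; rewrite ltNge; apply/negP => us.
have [|c cst Fc] := @IVT R (F \o u) s t 0 st (@speed_cts s t s0).
  by rewrite /= ge_min le_max (ltW ut) us !orbT.
move: cst; rewrite in_itv /= => /andP[sc ct].
have e := fl_rest fu (le_trans s0 sc) ct Fc.
by move: ut; rewrite e [F _]Fc ltxx.
Qed.

Lemma flow_line_decr (s t : R) : 0 <= s -> s < t -> F (u t) < 0 -> u t < u s.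
Proof.
move=> s0 st ut; have [c /andP[sc ct] e] := sol_MVT (fl_sol fu) s0 st.
rewrite -subr_lt0 e pmulr_llt0 ?subr_gt0//.
exact: speed_neg (le_trans s0 (ltW sc)) (ltW ct) ut.
Qed.

Lemma neg_near c : F c < 0 -> exists2 d : R, 0 < d & forall x, `|x - c| < d -> F x < 0.
Proof.
move=> Fc; have Fc' : 0 < - F c by rewrite oppr_gt0.
have /cvgrPdist_lt/(_ _ Fc')/nbhs_ballP[d /= d0 dF] := @cF c.
exists d => // x xc; have := dF x; rewrite /ball /= distrC => /(_ xc).
rewrite ltr_distlC; lra.
Qed.

(** To get above [c] the orbit would have to pass a level just above [c] where [F] is still
    negative; but an orbit arriving at such a level has been decreasing since time 0. *)
Lemma flow_line_trap c (t : R) : F c < 0 -> u 0 <= c -> 0 < t -> u t < c.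
Proof.
move=> Fc u0 t0; rewrite ltNge le_eqVlt; apply/negP => /predU1P[e|ct].
  have := @flow_line_decr 0 t (lexx _) t0; rewrite -e => /(_ Fc).
  by rewrite ltNge u0.
have [d d0 dF] := neg_near Fc.
pose x : R := Num.min (c + d / 2) (u t).
have cx : c < x by rewrite lt_min ct; lra.
have Fx : F x < 0.
  apply: dF; have : x <= c + d / 2 by rewrite ge_min lexx.
  by rewrite ger0_norm ?subr_ge0 ?(ltW cx)//; lra.
have [|s] := @IVT R u 0 t x (ltW t0) (@sol_cts_in F u 0 t (fl_sol fu) (lexx _)).
  by rewrite ge_min le_max (le_trans u0 (ltW cx)) /= /x !ge_min lexx !orbT.
rewrite in_itv /= => /andP[s0 st] us.
move: s0; rewrite le_eqVlt => /predU1P[s0|s0].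
  by move: us u0; rewrite -s0 => ->; rewrite leNgt cx.
have := @flow_line_decr 0 s (lexx _) s0; rewrite us => /(_ Fx).
by rewrite ltNge (le_trans u0 (ltW cx)).
Qed.

End FlowLine.

(** With [m] a maximum point of [F] on [[x, c]], an orbit descends through this interval at speed at
    least [- F m]. If it is still at [x] after a long time, it started above [c]. *)
Lemma flow_line_backward F (x c : R) : continuous F -> x < c ->
  (forall y, x <= y -> y <= c -> F y < 0) ->
  exists2 T : R, 0 < T & forall u t, flow_line F u -> T <= t -> u t = x -> c < u 0.
Proof.
move=> cF xc Fneg.
have [m mE mmin] : exists2 m, m \in `[x, c] & forall y, y \in `[x, c] -> F y <= F m.
  by apply: EVT_max; [exact: ltW|exact: continuous_subspaceT].
have Fm : F m < 0 by move: mE; rewrite in_itv /= => /andP[]; exact: Fneg.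
have q0 : 0 <= (c - x) / - F m.
  by apply: divr_ge0; rewrite ?oppr_ge0 ?subr_ge0; exact: ltW.
(* The longest possible crossing time, plus 1 to contradict it strictly. *)
exists ((c - x) / - F m + 1); first by rewrite ltr_wpDl.
move=> u t fu Tt utx; rewrite ltNge; apply/negP => u0c.
have t0 : 0 < t by apply: lt_le_trans Tt; rewrite ltr_wpDl.
have Fut : F (u t) < 0 by rewrite utx; apply: Fneg => //; exact: ltW.
have decr (s r : R) : 0 <= s -> s < r -> r <= t -> u r < u s.
  move=> s0 sr rt; apply: (flow_line_decr cF fu s0 sr).
  exact: (speed_neg cF fu (le_trans s0 (ltW sr)) rt Fut).
have [s /andP[s0 st] e] := sol_MVT (fl_sol fu) (lexx 0) t0.
have us : F (u s) <= F m.
  apply: mmin; rewrite in_itv /= -utx (ltW (decr _ _ (ltW s0) st (lexx _))) /=.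
  exact: le_trans (ltW (decr _ _ (lexx _) s0 (ltW st))) u0c.
have Fm' : 0 < - F m by rewrite oppr_gt0.
have h1 : - F m * t <= c - x.
  have : - F m * t <= u 0 - u t.
    rewrite -[leRHS]opprB e subr0 mulNr lerN2; exact: (ler_wpM2r (ltW t0)).
  by rewrite utx; lra.
have : t <= (c - x) / - F m by rewrite ler_pdivlMr// mulrC.
lra.
Qed.

End ScalarODE.

Section FlowLineMore.
Variable R : realType.
Implicit Types F u : R -> R.

Lemma reflect_cts F : continuous F -> continuous (fun x => - F (- x)).
Proof.
move=> cF x; apply: continuousN; apply: continuous_comp; last exact: cF.
exact: opp_continuous.
Qed.

Lemma flow_line_barrier F u (z t : R) : flow_line F u -> F z = 0 -> 0 <= t ->
  u t < z -> u 0 < z.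
Proof.
move=> fu Fz t0 utz; rewrite ltNge; apply/negP => zu0.
have [|s] := @IVT R u 0 t z t0 (@sol_cts_in _ F u 0 t (fl_sol fu) (lexx _)).
  by rewrite ge_min le_max zu0 (ltW utz) !orbT.
rewrite in_itv /= => /andP[s0 st] us.
have := fl_rest fu s0 st; rewrite us => /(_ Fz) e.
by move: utz; rewrite e ltxx.
Qed.

Lemma flow_line_barrier_gt F u (z t : R) : flow_line F u -> F z = 0 -> 0 <= t ->
  z < u t -> z < u 0.
Proof.
move=> fu Fz t0 utz; rewrite -ltrN2.
apply: (flow_line_barrier (z := - z) (flow_line_opp fu) _ t0).
  by rewrite opprK Fz oppr0.
by rewrite ltrN2.
Qed.

Lemma flow_line_trap_gt F u (c t : R) : continuous F -> flow_line F u ->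
  0 < F c -> c <= u 0 -> 0 < t -> c < u t.
Proof.
move=> cF fu Fc cu t0; rewrite -ltrN2.
apply: (flow_line_trap (reflect_cts cF) (flow_line_opp fu)) => //.
  by rewrite opprK oppr_lt0.
by rewrite lerN2.
Qed.

Lemma flow_line_backward_gt F (x c : R) : continuous F -> c < x ->
  (forall y, c <= y -> y <= x -> 0 < F y) ->
  exists2 T : R, 0 < T & forall u t, flow_line F u -> T <= t -> u t = x -> u 0 < c.
Proof.
move=> cF cx Fpos.
have [||T T0 h] := @flow_line_backward R (fun x => - F (- x)) (- x) (- c) (reflect_cts cF).
- by rewrite ltrN2.
- by move=> y xy yc; rewrite oppr_lt0; apply: Fpos; rewrite 1?lerNr 1?lerNl.
exists T => // u t fu Tt ut; rewrite -ltrN2.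
by apply: (h _ t (flow_line_opp fu)) => //=; rewrite ut.
Qed.

End FlowLineMore.

Lemma pair_cts (X Y : topologicalType) (a : X) : continuous (fun y : Y => (a, y)).
Proof.
move=> y P [[/= Q1 Q2] [Q1a Q2y] Q]; rewrite /nbhs /=.
by apply: filterS Q2y => z Q2z; apply: (Q (a, z)); split=> //=; exact: nbhs_singleton.
Qed.

Lemma EFin_cts (R : realType) : continuous (@EFin R).
Proof. by move=> x P /nbhs_EFin. Qed.

Section DynsysTopology.
Variables (R : realType) (X : topologicalType) (phi : dynsys R X).

Lemma time_cts x : {within `[0, +oo[, continuous (fun t => phi t x)}.
Proof.
apply/subspace_continuousP => t; rewrite /= in_itv /= andbT => t0.
have /subspace_continuousP/(_ (t, x) t0) h := @flow_continuous _ _ phi.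
apply: (@cvg_comp _ _ _ (fun s => (s, x)) (fun p => phi p.1 p.2)) h.
move=> P [[/= Q1 Q2] [Q1t Q2x] Q].
rewrite /nbhs /= /within /=; apply: filterS Q1t => s Q1s.
rewrite in_itv /= andbT => s0; apply: (Q (s, x)) => //=; split => //=.
exact: nbhs_singleton.
Qed.

End DynsysTopology.

(** * Equilibria and orbits of the pitchfork *)

Section Pitchfork.
Variables (R : realType) (psi : param_dynsys R R (\bar R)).
Hypothesis pf : pitchfork psi.

Definition cubic (l x : R) : R := l * x - x ^+ 3.

Lemma cubic_cts (l : R) : continuous (cubic l).
Proof.
move=> x; apply: cvgB; last exact: exprn_continuous.
by apply: cvgM; [exact: cvg_cst|exact: cvg_id].
Qed.

(** The true vector field is a positive multiple of [cubic l], so it has the same signs and zeros.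
    Its factorisation at each zero is what [rest_short] requires. *)
Lemma pitchfork_line (l : R) : exists F : R -> R,
  [/\ continuous F, forall x, exists2 w : R, 0 < w & F x = w * cubic l x,
      forall z, F z = 0 -> exists2 G : R -> R, continuous G & forall x, F x = (x - z) * G x &
      forall x0, exists2 u : R -> R, solution F u &
        forall t, 0 <= t -> psi l t x0%:E = (u t)%:E].
Proof.
have [_ [g [cg g0 hg]]] := pf.
have cgl : continuous (g l).
  move=> x; apply: (@continuous_comp _ _ _ (fun x => (l, x)) (fun p => g p.1 p.2));
    last exact: cg.
  by apply: pair_cts.
exists (fun x => g l x * cubic l x); split.
- by move=> x; apply: cvgM; [exact: cgl|exact: cubic_cts].
- by move=> x; exists (g l x).
- move=> z /eqP; rewrite mulf_eq0 gt_eqF//= => /eqP z0.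
  (* The factor other than [x - z] in [cubic l x - cubic l z], multiplied by the speed. *)
  exists (fun x => g l x * (l - (x ^+ 2 + x * z + z ^+ 2))).
    move=> x; apply: cvgM; first exact: cgl.
    apply: cvgB; first exact: cvg_cst.
    apply: cvgD; last exact: cvg_cst.
    apply: cvgD; first exact: exprn_continuous.
    by apply: cvgM; [exact: cvg_id|exact: cvg_cst].
  move=> x; rewrite mulrCA; congr (_ * _).
  by rewrite -[LHS]subr0 -z0 /cubic; ring.
- move=> x0; have [u [ux du]] := hg l x0; exists u => //; split => //.
  apply/subspace_continuousP => t; rewrite /= in_itv /= andbT => t0.
  have /subspace_continuousP/(_ t) tc := @time_cts _ _ (psi l) x0%:E.
  have h : (fun s => psi l s x0%:E) @ within `[0, +oo[ (nbhs t) --> (u t)%:E.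
    by rewrite -ux//; apply: tc; rewrite /= in_itv /= t0.
  apply: (@cvg_trans _ ((fine \o (fun s => psi l s x0%:E)) @ within `[0, +oo[ (nbhs t))).
    apply: near_eq_cvg; rewrite near_withinE; apply: filterE => s.
    by rewrite /= in_itv /= andbT => s0; rewrite /= ux.
  exact: fine_cvg h.
Qed.

Lemma pitchfork_oo (l t : R) : 0 <= t -> psi l t +oo%E = +oo%E /\ psi l t -oo%E = -oo%E.
Proof. by move: pf => [h _]; exact: h. Qed.

(** [rest_short] keeps a zero fixed for a short time [e]; the semigroup law then covers [t] by [n]
    equal steps of length at most [e]. *)
Lemma pitchfork_rest (l z t : R) : cubic l z = 0 -> 0 <= t -> psi l t z%:E = z%:E.
Proof.
move=> z0 t0; have [F [cF Fw FG sol]] := pitchfork_line l.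
have Fz : F z = 0 by have [w _ ->] := Fw z; rewrite z0 mulr0.
have [G cG FGz] := FG _ Fz; have [u su ux] := sol z.
have u0 : u 0 = z by apply: EFin_inj; rewrite -ux// flow0.
have [e e0 ue] := rest_short (cG z) FGz su u0.
have short s : 0 <= s -> s <= e -> psi l s z%:E = z%:E.
  by move=> s0 se; rewrite ux// ue.
pose n := (Num.bound (t / e)).+1.
have n0 : 0 < n%:R :> R by rewrite ltr0n.
have tn : 0 <= t / n%:R by apply: divr_ge0 => //; exact: ltW.
have tne : t / n%:R <= e.
  rewrite ler_pdivrMr// mulrC -ler_pdivrMr//.
  apply: ltW; apply: lt_le_trans (archi_boundP _) _.
    by apply: divr_ge0 => //; exact: ltW.
  by rewrite ler_nat.
have steps k : psi l (k%:R * (t / n%:R)) z%:E = z%:E.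
  elim: k => [|k IH]; first by rewrite mul0r flow0.
  by rewrite -natr1 mulrDl mul1r addrC -flowD ?IH ?short// mulr_ge0.
by have := steps n; rewrite mulrCA divff ?gt_eqF// mulr1.
Qed.

Lemma pitchfork_flow_line (l : R) : exists F : R -> R,
  [/\ continuous F, forall x, exists2 w : R, 0 < w & F x = w * cubic l x &
      forall x0, exists u : R -> R, [/\ flow_line F u, u 0 = x0 &
        forall t, 0 <= t -> psi l t x0%:E = (u t)%:E]].
Proof.
have [F [cF Fw FG sol]] := pitchfork_line l.
exists F; split=> // x0; have [u su ux] := sol x0; exists u; split=> //.
  split=> // s t s0 st Fus; apply: EFin_inj.
  have t0 := le_trans s0 st.
  have [w w0] := Fw (u s); rewrite Fus => /esym/eqP.
  rewrite mulf_eq0 gt_eqF//= => /eqP c0.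
  rewrite -ux// -(subrK s t) -flowD ?subr_ge0// ux//.
  by apply: pitchfork_rest; rewrite ?subr_ge0.
by apply: EFin_inj; rewrite -ux// flow0.
Qed.

Lemma pitchfork_trap (l c t : R) x : cubic l c < 0 -> (x <= c%:E)%E -> 0 < t ->
  (psi l t x < c%:E)%E.
Proof.
move=> c0 xc t0; have [F [cF Fw fl]] := pitchfork_flow_line l.
have Fc : F c < 0 by have [w w0 ->] := Fw c; rewrite pmulr_rlt0.
case: x xc => [x|//|] xc; last by rewrite (pitchfork_oo l (ltW t0)).2 ltNyr.
have [u [fu u0 ux]] := fl x; rewrite (ux _ (ltW t0)) lte_fin.
by apply: (flow_line_trap cF fu Fc) => //; rewrite u0.
Qed.

Lemma pitchfork_trap_gt (l c t : R) x : 0 < cubic l c -> (c%:E <= x)%E -> 0 < t ->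
  (c%:E < psi l t x)%E.
Proof.
move=> c0 xc t0; have [F [cF Fw fl]] := pitchfork_flow_line l.
have Fc : 0 < F c by have [w w0 ->] := Fw c; rewrite pmulr_rgt0.
case: x xc => [x| |//] xc; last by rewrite (pitchfork_oo l (ltW t0)).1 ltry.
have [u [fu u0 ux]] := fl x; rewrite (ux _ (ltW t0)) lte_fin.
by apply: (flow_line_trap_gt cF fu Fc) => //; rewrite u0.
Qed.

(** Finite points stay finite and the infinite ones are fixed. Continuity at the infinite points
    yields arbitrarily low and high finite values, and the intermediate value theorem gives the
    rest. *)
Lemma pitchfork_surj (l t : R) x : 0 <= t -> exists y, psi l t y = x.
Proof.
move=> t0; have [F [cF Fw fl]] := pitchfork_flow_line l.
case: x => [x| |]; last 2 first.
- by exists +oo%E; exact: (pitchfork_oo l t0).1.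
- by exists -oo%E; exact: (pitchfork_oo l t0).2.
have fin y : psi l t y%:E = (fine (psi l t y%:E))%:E.
  by have [u [_ _ ->]] := fl y.
pose w (y : R) : R := fine (psi l t y%:E).
have cts := @flow_cts _ _ (psi l) t t0.
have cw : continuous w.
  move=> y; apply: fine_cvg; rewrite -fin.
  by apply: (@continuous_comp _ _ _ EFin (psi l t)); [exact: EFin_cts|exact: cts].
have [a wa] : exists a, w a <= x.
  have /(_ [set z | (z < x%:E)%E]) h := cts -oo%E.
  have /= [] : nbhs -oo%E ((psi l t) @^-1` [set z | (z < x%:E)%E]).
    apply: h; rewrite (pitchfork_oo l t0).2; exists x; split; first exact: num_real.
    by [].
  move=> M [_ hM]; exists (M - 1); rewrite -lee_fin -fin ltW//; apply: hM.
  by rewrite lte_fin; lra.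
have [b wb] : exists b, x <= w b.
  have /(_ [set z | (x%:E < z)%E]) h := cts +oo%E.
  have /= [] : nbhs +oo%E ((psi l t) @^-1` [set z | (x%:E < z)%E]).
    apply: h; rewrite (pitchfork_oo l t0).1; exists x; split; first exact: num_real.
    by [].
  move=> M [_ hM]; exists (M + 1); rewrite -lee_fin -fin ltW//; apply: hM.
  by rewrite lte_fin; lra.
suff [c wc] : exists c, w c = x by exists c%:E; rewrite fin -/(w c) wc.
have [ab|ba] := leP a b.
  have [|c _ wc] := @IVT R w a b x ab (continuous_subspaceT cw); last by exists c.
  by rewrite ge_min le_max wa wb orbT.
have [|c _ wc] := @IVT R w b a x (ltW ba) (continuous_subspaceT cw); last by exists c.
by rewrite ge_min le_max wa wb orbT.
Qed.

(** Listed in increasing order. As [Num.sqrt] vanishes on negative numbers, entries 1, 2 and 3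
    coincide for [l <= 0]. *)
Definition equilibrium (i : nat) (l : R) : \bar R :=
  match i with
  | 0 => -oo | 1 => (- Num.sqrt l)%:E | 2 => 0%:E | 3 => (Num.sqrt l)%:E | _ => +oo
  end%E.

Lemma cubic_sqrt (l : R) : cubic l (Num.sqrt l) = 0.
Proof.
rewrite /cubic; have [l0|l0] := leP 0 l.
  by rewrite exprS sqr_sqrtr// mulrC subrr.
by rewrite ltr0_sqrtr// mulr0 expr0n subrr.
Qed.

Lemma cubicN (l x : R) : cubic l (- x) = - cubic l x.
Proof. by rewrite /cubic; ring. Qed.

Lemma equilibrium_rest i (l t : R) : 0 <= t -> psi l t (equilibrium i l) = equilibrium i l.
Proof.
move=> t0; case: i => [|[|[|[|i]]]] /=.
- exact: (pitchfork_oo l t0).2.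
- by apply: pitchfork_rest => //; rewrite cubicN cubic_sqrt oppr0.
- by apply: pitchfork_rest => //; rewrite /cubic mulr0 expr0n subrr.
- by apply: pitchfork_rest => //; rewrite cubic_sqrt.
- exact: (pitchfork_oo l t0).1.
Qed.

Lemma cubic_eq0 (l x : R) : cubic l x = 0 -> exists2 i, (i < 5)%N & x%:E = equilibrium i l.
Proof.
rewrite /cubic => /eqP; rewrite (_ : _ - _ = x * (l - x ^+ 2)); last by ring.
rewrite mulf_eq0 => /orP[/eqP->|]; first by exists 2%N.
rewrite subr_eq0 => /eqP->.
have [x0|x0] := leP 0 x; first by exists 3%N; rewrite //= sqrtr_sqr ger0_norm.
by exists 1%N; rewrite //= sqrtr_sqr ltr0_norm// opprK.
Qed.

Lemma pitchfork_backward_neg (l x c : R) : x < c ->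
  (forall y, x <= y -> y <= c -> cubic l y < 0) ->
  exists2 T : R, 0 < T & forall t y, T <= t -> psi l t y = x%:E -> (c%:E < y)%E.
Proof.
move=> xc neg; have [F [cF Fw fl]] := pitchfork_flow_line l.
have [|T T0 h] := flow_line_backward cF xc.
  by move=> y xy yc; have [w w0 ->] := Fw y; rewrite pmulr_rlt0// neg.
exists T => // t y Tt; have t0 : 0 <= t by apply: le_trans Tt; exact: ltW.
case: y => [y| |]; last 2 first.
- by rewrite ltry.
- by rewrite (pitchfork_oo l t0).2.
have [u [fu u0 ux]] := fl y; rewrite ux// => -[ut].
by rewrite lte_fin -u0; exact: h ut.
Qed.

Lemma pitchfork_backward_pos (l x c : R) : c < x ->
  (forall y, c <= y -> y <= x -> 0 < cubic l y) ->
  exists2 T : R, 0 < T & forall t y, T <= t -> psi l t y = x%:E -> (y < c%:E)%E.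
Proof.
move=> xc neg; have [F [cF Fw fl]] := pitchfork_flow_line l.
have [|T T0 h] := flow_line_backward_gt cF xc.
  by move=> y xy yc; have [w w0 ->] := Fw y; rewrite pmulr_rgt0// neg.
exists T => // t y Tt; have t0 : 0 <= t by apply: le_trans Tt; exact: ltW.
case: y => [y| |]; last 2 first.
- by rewrite (pitchfork_oo l t0).1.
- by rewrite ltNyr.
have [u [fu u0 ux]] := fl y; rewrite ux// => -[ut].
by rewrite lte_fin -u0; exact: h ut.
Qed.

Lemma pitchfork_barrier (l x t : R) y : 0 <= t -> psi l t y = x%:E ->
  (x < 0 -> (y < 0%:E)%E) /\ (0 < x -> (0%:E < y)%E).
Proof.
move=> t0; have [F [cF Fw fl]] := pitchfork_flow_line l.
have F0 : F 0 = 0 by have [w _ ->] := Fw 0; rewrite /cubic mulr0 expr0n subrr mulr0.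
case: y => [y| |]; last 2 first.
- by rewrite (pitchfork_oo l t0).1.
- by rewrite (pitchfork_oo l t0).2.
have [u [fu u0 ux]] := fl y; rewrite ux// => -[<-]; rewrite !lte_fin -u0; split=> h.
  exact: flow_line_barrier fu F0 t0 h.
exact: flow_line_barrier_gt fu F0 t0 h.
Qed.

Lemma nbhs_zero_ereal (N : set (\bar R)) : nbhs (0%:E : \bar R) N ->
  exists2 d : R, 0 < d & forall y : \bar R, ((- d)%:E < y)%E -> (y < d%:E)%E -> N y.
Proof.
move=> /nbhs_EFin/nbhs_ballP[d /= d0 dN]; exists d => // -[y| |]//.
rewrite !lte_fin => y1 y2; apply: dN.
by rewrite /ball /= sub0r normrN ltr_norml y1.
Qed.

(** Backwards in time a moving point tends to 0 if it moves away from 0, and to the infinite point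
    on its side if it moves towards 0. The four cases are the signs of [cubic l x] and of [x]. *)
Lemma pitchfork_source (l x : R) : cubic l x != 0 ->
  exists2 i, (i < 5)%N & forall N, nbhs (equilibrium i l) N ->
    exists2 T : R, 0 < T & forall t y, T <= t -> psi l t y = x%:E -> N y.
Proof.
have cE y : cubic l y = y * (l - y ^+ 2) by rewrite /cubic; ring.
have sqle (y z : R) : 0 <= y -> y <= z -> y ^+ 2 <= z ^+ 2.
  by move=> y0 yz; rewrite ler_sqr// nnegrE// (le_trans y0).
move=> cx; have x0 : x != 0 by move: cx; rewrite cE mulf_eq0 negb_or => /andP[].
move: cx x0; rewrite !neq_lt !cE => /orP[cx|cx] /orP[x0|x0].
- exists 2%N => // N /nbhs_zero_ereal[d d0 dN].
  (* A level strictly between [x] and 0 and inside the given neighbourhood; [cubic l] keeps its sign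
     on [[x, c]] because squares decrease there. *)
  pose c : R := Num.max (x / 2) (- d / 2).
  have xc : x < c by rewrite lt_max; apply/orP; left; lra.
  have c0 : c < 0 by rewrite gt_max; lra.
  have cd : - d < c by rewrite lt_max; apply/orP; right; lra.
  have lx : 0 < l - x ^+ 2 by move: cx; rewrite nmulr_rlt0.
  have [|T T0 h] := @pitchfork_backward_neg l x c xc.
    move=> y xy yc; have y0 : y < 0 by apply: le_lt_trans c0.
    rewrite cE nmulr_rlt0//; apply: lt_le_trans lx _; rewrite lerB//.
    by rewrite -[y ^+ 2]sqrrN -[x ^+ 2]sqrrN sqle// ?lerN2// oppr_ge0 ltW.
  exists T => // t y Tt yx; apply: dN.
    by apply: lt_trans (h _ _ Tt yx); rewrite lte_fin.
  have t0 := le_trans (ltW T0) Tt.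
  by apply: lt_trans ((pitchfork_barrier t0 yx).1 x0) _; rewrite lte_fin.
- exists 4%N => // N [M [_ MN]]; pose c : R := Num.max (x + 1) M.
  have xc : x < c by rewrite lt_max; apply/orP; left; lra.
  have lx : l - x ^+ 2 < 0 by move: cx; rewrite pmulr_rlt0.
  have [|T T0 h] := @pitchfork_backward_neg l x c xc.
    move=> y xy yc; rewrite cE pmulr_rlt0 ?(lt_le_trans x0)//.
    by apply: le_lt_trans lx; rewrite lerB// sqle// ltW.
  exists T => // t y Tt yx; apply: MN; apply: le_lt_trans (h _ _ Tt yx).
  by rewrite lee_fin le_max lexx orbT.
- exists 0%N => // N [M [_ MN]]; pose c : R := Num.min (x - 1) M.
  have xc : c < x by rewrite gt_min; apply/orP; left; lra.
  have lx : l - x ^+ 2 < 0 by move: cx; rewrite nmulr_rgt0.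
  have [|T T0 h] := @pitchfork_backward_pos l x c xc.
    move=> y cy yx; have y0 : y < 0 by apply: le_lt_trans x0.
    rewrite cE nmulr_rgt0//; apply: le_lt_trans lx; rewrite lerB//.
    by rewrite -[y ^+ 2]sqrrN -[x ^+ 2]sqrrN sqle// ?lerN2// oppr_ge0 ltW.
  exists T => // t y Tt yx; apply: MN; apply: lt_le_trans (h _ _ Tt yx) _.
  by rewrite lee_fin ge_min lexx orbT.
- exists 2%N => // N /nbhs_zero_ereal[d d0 dN].
  pose c : R := Num.min (x / 2) (d / 2).
  have xc : c < x by rewrite gt_min; apply/orP; left; lra.
  have c0 : 0 < c by rewrite lt_min; lra.
  have cd : c < d by rewrite gt_min; apply/orP; right; lra.
  have lx : 0 < l - x ^+ 2 by move: cx; rewrite pmulr_rgt0.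
  have [|T T0 h] := @pitchfork_backward_pos l x c xc.
    move=> y cy yx; have y0 : 0 < y by apply: lt_le_trans cy.
    rewrite cE pmulr_rgt0//; apply: lt_le_trans lx _; rewrite lerB//.
    by rewrite sqle// ltW.
  have t0 t : T <= t -> 0 <= t by move=> Tt; exact: le_trans (ltW T0) Tt.
  exists T => // t y Tt yx; apply: dN.
    by apply: lt_trans ((pitchfork_barrier (t0 _ Tt) yx).2 x0); rewrite lte_fin; lra.
  by apply: lt_trans (h _ _ Tt yx) _; rewrite lte_fin.
Qed.

End Pitchfork.

(** * Rest points and the spectrum of the attractor lattice *)

Section RestPoints.
Variables (R : realType) (X : topologicalType) (phi : dynsys R X).

Definition rest x := forall t, 0 <= t -> phi t x = x.

Lemma rest_omega x U : rest x -> U x -> omega phi U x.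
Proof.
move=> rx Ux t t0; apply: subset_closure; exists t => /=; first exact: lexx.
by exists x => //; exact: rx.
Qed.

(** By continuity, [phi s] maps the closure of [U] into the closure of the image of [U]. *)
Lemma omega_closure U : omega phi (closure U) `<=` omega phi U.
Proof.
move=> x xU t t0; have /= := xU t t0; rewrite -[X in _ -> X]/(closure (tail phi U t) x).
rewrite (closure_id (closure (tail phi U t))).1; last exact: closed_closure.
apply: closureS => _ [s /= ts [y yU <-]].
move=> N Nx; have s0 := le_trans t0 ts.
have [z [Uz Nz]] := yU _ (flow_cts s0 Nx).
by exists (phi s z); split=> //; exists s => //; exists z.
Qed.

(** No rest point lies on the boundary of an attracting neighbourhood: passing to the closure leaves
    the omega-limit set unchanged. *)
Lemma rest_attracting x U : rest x -> attracting phi U -> closure U x ->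
  omega phi U x /\ (U°)%classic x.
Proof.
move=> rx aU Ux; have h : omega phi U x by apply/omega_closure/rest_omega.
by split=> //; exact: aU.
Qed.

End RestPoints.

Lemma open_opens (T : topologicalType) (U : opens T) (P : set U) :
  (forall l, P l -> exists V : opens T, oset V (val l) /\ forall k, oset V (val k) -> P k) ->
  open P.
Proof.
move=> h; rewrite openE => l /h[V [Vl VP]].
apply: (@filterS _ _ _ (set_val @^-1` (oset V))) => //.
apply: open_nbhs_nbhs; split=> //.
exact: (proj1 (continuousP _) (@continuous_set_val T U) _ (oset_open V)).
Qed.

Lemma opens_open (T : topologicalType) (U : opens T) (P : set U) : open P -> forall l, P l ->
  exists V : opens T, oset V (val l) /\ forall k, oset V (val k) -> P k.
Proof.
move=> [B oB BP] l Pl; exists (Opens oB); split; first by move: Pl; rewrite -BP.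
by move=> k Bk; rewrite -BP.
Qed.

(** * Prime ideals of rest points *)

Section RestIdeals.
Variables (R : realType) (Lam X : topologicalType) (phi : param_dynsys R Lam X).
Variable m : Lam -> X.
Hypothesis m_rest : forall l, rest (phi l) (m l).

Section Ideal.
Variable Om : opens Lam.
Notation L := (att_section phi Om).
Variable l : Om.

Let ideal : set L := [set A | ~ val A l (m (val l))].

Let ideal0 : ideal \bot%O. Proof. by []. Qed.
Let ideal1 : ~ ideal \top%O.
Proof. by apply; exact: rest_omega. Qed.
Let ideal_le A B : (A <= B)%O -> ideal B -> ideal A.
Proof. by move=> /asboolP AB nB /AB. Qed.
Let idealU A B : ideal A -> ideal B -> ideal (A `|` B)%O.
Proof. by move=> nA nB []. Qed.
(** Primality: a rest point common to [A] and [B] is its own limit, so it survives in the meet, the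
    omega-limit set of the intersection. *)
Let idealI A B : ideal (A `&` B)%O -> ideal A \/ ideal B.
Proof.
move=> nAB; apply: contrapT => /not_orP[/contrapT Am /contrapT Bm].
by apply: nAB; exact: rest_omega.
Qed.

Definition rest_ideal : prime_ideal L :=
  PrimeIdeal ideal0 ideal1 ideal_le idealU idealI.

End Ideal.

Lemma rest_ideal_res (U V : opens Lam) (h : V `<=` U) (l : V) :
  spec_map (att_res phi h) (rest_ideal l) = rest_ideal (Defs.incl h l).
Proof. exact/prime_ideal_inj. Qed.

Hypothesis m_cts : continuous m.

(** By [rest_attracting] the rest point is either interior to [U] or outside its closure; both
    persist for nearby parameters as [m] is continuous and [U] is fixed. *)
Lemma att_section_const (Om : opens Lam) (A : att_section phi Om) (l : Om) :
  exists V : opens Lam, oset V (val l) /\ forall k : Om, oset V (val k) ->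
    val A k (m (val k)) <-> val A l (m (val l)).
Proof.
have /asboolP[_ /(_ l)[Om0 [U [_ lOm0 UA]]]] := valP A.
have oint : open (m @^-1` U°) by apply: (proj1 (continuousP _) m_cts); exact: open_interior.
have oext : open (m @^-1` ~` closure U).
  by apply: (proj1 (continuousP _) m_cts); rewrite openC; exact: closed_closure.
have [Al|nAl] := pselect (val A l (m (val l))).
  exists (opensI Om0 (Opens oint)); split.
    by split=> //; have [aU Ae] := UA l lOm0; apply: aU; rewrite -Ae.
  move=> k [/UA[aU Ae] /interior_subset Uk]; split=> // _; rewrite Ae.
  exact: rest_omega.
exists (opensI Om0 (Opens oext)); split.
  split=> // /= cU; apply: nAl; have [aU Ae] := UA l lOm0.
  by rewrite Ae; have [] := rest_attracting (m_rest (val l)) aU cU.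
move=> k [/UA[aU Ae] nUk]; split=> // Ak; exfalso; apply: nUk.
by move: Ak; rewrite Ae => /aU/interior_subset; exact: subset_closure.
Qed.

Lemma rest_ideal_cts (Om : opens Lam) : continuous (@rest_ideal Om).
Proof.
apply/continuousP => _ [D sD <-]; rewrite preimage_bigcup; apply: bigcup_open.
move=> B /sD [E sE <-]; rewrite preimage_bigcap.
rewrite bigcap_fset big_seq; apply: big_ind; [exact: openT|exact: openI|].
move=> S /sE; rewrite inE => -[A SA]; apply: open_opens => l.
have [V [Vl VA]] := att_section_const A l.
case: SA => -> /= h; exists V; split=> // k /VA e.
  by rewrite /= e.
by move=> nA; apply: h => /e.
Qed.

Lemma rest_ideal_clopen (Om : opens Lam) (S : booleanization (att_section phi Om)) :
  clopen [set l | val S (rest_ideal l)].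
Proof. by apply: preimage_clopen (@rest_ideal_cts Om); exact/asboolP/(valP S). Qed.

End RestIdeals.

(* If [q] differed from every [p i], a finite join in [q] would dominate a finite
   meet outside [q]. *)
Lemma prime_ideal_finite d (L : tbDistrLatticeType d) n (p : 'I_n -> prime_ideal L) :
  (forall a b, (forall i, pideal (p i) a -> pideal (p i) b) -> (b <= a)%O) ->
  forall q : prime_ideal L, exists i, q = p i.
Proof.
move=> ple q; apply: contrapT => /forallNP qp.
have sep i : exists ab : L * L, [/\ pideal q ab.1, ~ pideal q ab.2 &
    pideal (p i) ab.1 -> pideal (p i) ab.2].
  apply: contrapT => h; apply: (qp i); apply: prime_ideal_inj; apply/seteqP; split=> a qa.
    apply: contrapT => pa; apply: h; exists (a, \top%O); split=> //; exact: pideal1.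
  apply: contrapT => pa; apply: h; exists (\bot%O, a); split=> //; exact: pideal0.
have [f fP] := choice sep.
have qa : pideal q (\join_i (f i).1)%O.
  apply: (big_ind (fun x => pideal q x)); [exact: pideal0|exact: pidealU|].
  by move=> i _; case: (fP i).
have qb : ~ pideal q (\meet_i (f i).2)%O.
  apply: (big_ind (fun x => ~ pideal q x)); first exact: pideal1.
    by move=> x y qx qy /pidealI[].
  by move=> i _; case: (fP i).
apply: qb; apply: pideal_le qa; apply: ple => i pa.
have [_ _ fi] := fP i.
have : pideal (p i) (f i).2.
  by apply/fi/(pideal_le _ pa); exact: Order.BJoinTheory.joins_sup.
apply: pideal_le; exact: Order.TMeetTheory.meets_inf.
Qed.

Lemma opens_const (R : realType) (U : opens R) (P : U -> Prop) : connected (oset U) ->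
  (forall l, exists V : opens R, oset V (val l) /\
     forall k, oset V (val k) -> (P k <-> P l)) ->
  forall k l, P k -> P l.
Proof.
move=> conn h k l Pk.
pose E (Q : U -> Prop) := [set x | exists2 k : U, val k = x & Q k].
have oE (Q : U -> Prop) : (forall l, Q l -> exists V : opens R, oset V (val l) /\
     forall k, oset V (val k) -> Q k) -> open (E Q).
  move=> hQ; rewrite openE => _ [j <- /hQ[V [Vj VQ]]].
  apply: (@filterS _ _ _ (oset V `&` oset U)).
    by move=> y [Vy Uy]; exists (SigSub (mem_set Uy)) => //; exact: VQ.
  apply: open_nbhs_nbhs; split; first by apply: openI; exact: oset_open.
  by split=> //; exact: set_valP.
have EU (Q : U -> Prop) : E Q `<=` oset U by move=> _ [j <- _]; exact: set_valP.
have : E P = oset U.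
  apply: conn; first by exists (val k), k.
  - exists (E P); last by rewrite setIidr.
    by apply: oE => j Pj; have [V [Vj VP]] := h j; exists V; split=> // i /VP ->.
  - exists (~` E (fun j => ~ P j)).
      rewrite closedC; apply: oE => j Pj; have [V [Vj VP]] := h j.
      by exists V; split=> // i /VP ->.
    apply/seteqP; split=> [_ [j <- Pj]|x [Ux nx]].
      split; first exact: set_valP.
      by move=> [i /val_inj -> ]; apply.
    exists (SigSub (mem_set Ux)) => //; apply: contrapT => nP; apply: nx.
    by exists (SigSub (mem_set Ux)).
move=> /seteqP[_ /(_ (val l) (set_valP l))[j /val_inj <-]//].
Qed.

Lemma F2_boolB (b c : bool) : (b (+) c)%:R = b%:R - c%:R :> 'F_2.
Proof. by case: b; case: c; apply/val_inj. Qed.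

Lemma F2_bool_inj : injective (fun b : bool => b%:R : 'F_2).
Proof. by case; case. Qed.

Lemma F2_boolK (x : 'F_2) : (x != 0)%:R = x.
Proof. by case: x => -[|[|n]] lt_n //; apply/val_inj. Qed.

(** * The Boolean presheaf determined by five rest points *)

Section BooleanModel.
Variables (R : realType) (X : topologicalType) (phi : param_dynsys R R X).
Variable m : nat -> R -> X.
Hypothesis m_cts : forall i, continuous (m i).
Hypothesis m_rest : forall i l, rest (phi l) (m i l).
Hypothesis m_merge : forall l, l <= 0 -> m 1 l = m 2 l /\ m 3 l = m 2 l.
Hypothesis m_det : forall l A B, attractor (phi l) A -> attractor (phi l) B ->
  (forall i, (i < 5)%N -> A (m i l) -> B (m i l)) -> A `<=` B.

(** One set attracting for all nearby parameters yields a section of the lattice sheaf around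
    [l]. *)
Definition robust (l : R) (U : set X) :=
  exists Om : opens R, oset Om l /\ forall k, oset Om k -> attracting (phi k) U.

(** Together with [m_high]: attracting sets cut the ordered list of rest points after the last or
    the first middle one, or before them, and cuts between middle ones exist only once these have
    separated. *)
Hypothesis m_low : forall l j, j = 4%N \/ 0 < l /\ j = 2%N ->
  exists U, robust l U /\ forall i, (i < 5)%N -> U (m i l) <-> (i < j)%N.
Hypothesis m_high : forall l j, j = 1%N \/ 0 < l /\ j = 3%N ->
  exists U, robust l U /\ forall i, (i < 5)%N -> U (m i l) <-> (j <= i)%N.

Notation sec Om := (booleanization (att_section phi Om)).

Definition bit i (Om : opens R) (l : Om) (S : sec Om) : bool :=
  `[< val S (rest_ideal (m_rest i) l) >].

Lemma bitB i (Om : opens R) (l : Om) (S S' : sec Om) :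
  bit i l (S - S') = bit i l S (+) bit i l S'.
Proof.
rewrite /bit; set p := rest_ideal _ _.
have -> : val (S - S') p = ((val S `+` val S') p) by [].
by case: (asboolP (val S p)) => Sp; case: (asboolP (val S' p)) => S'p;
  apply/asboolP; rewrite /setY /setD /setU /=; tauto.
Qed.

Lemma bit_res i (U V : opens R) (h : V `<=` U) (l : V) (S : sec U) :
  bit i l (bool_map (att_res phi h) S) = bit i (Defs.incl h l) S.
Proof. by rewrite /bit /= rest_ideal_res. Qed.

Lemma bit_irr i (U : opens R) (x : R) (Ux U'x : x \in oset U) (S : sec U) :
  bit i (SigSub Ux : U) S = bit i (SigSub U'x : U) S.
Proof. by congr bit; congr SigSub; exact: Prop_irrelevance. Qed.

Lemma bit_const n (Om : opens R) (l : Om) (S : sec Om) : exists V : opens R,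
  oset V (val l) /\
  forall i, (i < n)%N -> forall k : Om, oset V (val k) -> bit i k S = bit i l S.
Proof.
elim: n => [|n [V [Vl VS]]]; first by exists (opensT R).
have [op c] := rest_ideal_clopen (m_rest n) (@m_cts n) S.
have [W [Wl WS]] : exists W : opens R, oset W (val l) /\
    forall k : Om, oset W (val k) -> bit n k S = bit n l S.
  have [Sl|nSl] := pselect (val S (rest_ideal (m_rest n) l)).
    have [W [Wl WS]] := opens_open op Sl; exists W; split=> // k /WS Sk.
    by apply/asboolP/asboolP.
  move: c; rewrite -openC => c.
  have [W [Wl WS]] := opens_open c nSl; exists W; split=> // k /WS nSk.
  by apply/asboolP/asboolP => h; exfalso; [exact: nSk|exact: nSl].
exists (opensI V W); split=> // i; rewrite ltnS leq_eqVlt => /predU1P[->|lt] k [Vk Wk].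
  exact: WS.
exact: VS.
Qed.

(** Over a small interval the five rest ideals exhaust the spectrum, so a clopen set that misses
    them is empty. *)
Lemma bits_eq0 (Om : opens R) (l : Om) (S : sec Om) :
  (forall i, (i < 5)%N -> bit i l S = false) ->
  exists (V : opens R) (h : V `<=` Om), oset V (val l) /\ bool_map (att_res phi h) S = 0.
Proof.
move=> Sl; have [e e0 eOm] := opens_ball (set_valP l : oset Om (val l)).
pose V : opens R := Opens (@interval_open R (BRight (val l - e)) (BLeft (val l + e)) isT isT).
have VE x : oset V x = (val l - e < x < val l + e) by rewrite /= in_itv.
have h : V `<=` Om by move=> x; rewrite VE => xl; apply: eOm; rewrite ltr_distl.
have Vl : oset V (val l) by rewrite VE; apply/andP; split; lra.
exists V, h; split=> //.
have conn : connected (oset V) by apply/connected_intervalP; exact: interval_is_interval.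
pose l' : V := SigSub (mem_set Vl).
(* Attractors are compared on rest points, and over the connected [V] membership of each rest point
   can be tested at [l'] alone. *)
have det : forall A B : att_section phi V,
    (forall i : 'I_5, pideal (rest_ideal (m_rest i) l') A ->
       pideal (rest_ideal (m_rest i) l') B) ->
    (B <= A)%O.
  move=> A B AB; apply/asboolP => k.
  apply: (@m_det (val k)); [exact: att_section_attractor|exact: att_section_attractor|].
  move=> i i5 Bk.
  have cst C := @opens_const _ V (fun k => val C k (m i (val k))) conn
    (att_section_const (m_rest i) (@m_cts i) C).
  apply: (cst A l'); apply: contrapT => /(AB (Ordinal i5)); apply.
  exact: (cst B k).
apply/val_inj/seteqP; split=> // q Sq.
have [i qi] := prime_ideal_finite det q.
have := Sl i (ltn_ord i); rewrite /bit => /asboolPn; apply.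
move: Sq; rewrite qi /= rest_ideal_res.
by congr (val S (rest_ideal _ _)); exact/val_inj.
Qed.

(** Bit patterns realised by clopen sets near [l]. They form a Boolean algebra, so it suffices to
    realise generators. *)
Definition attained (l : R) (B : nat -> bool) := exists (Om : opens R) (Oml : oset Om l)
  (S : sec Om), forall i, (i < 5)%N -> bit i (SigSub (mem_set Oml) : Om) S = B i.

Lemma attained_ext l B B' :
  attained l B -> (forall i, (i < 5)%N -> B i = B' i) -> attained l B'.
Proof.
by move=> [Om [Oml [S SB]]] e; exists Om, Oml, S => i i5; rewrite SB// e.
Qed.

Lemma attained_const l b : attained l (fun=> b).
Proof.
exists (opensT R), I, (if b then bool1 _ else bool0 _) => i _.
by case: b; rewrite /bit /=; [apply/asboolT|apply/asboolF].
Qed.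

Lemma attainedN l B : attained l B -> attained l (fun i => ~~ B i).
Proof.
move=> [Om [Oml [S SB]]]; exists Om, Oml, (bool1 _ - S) => i i5.
by rewrite bitB SB// /bit asboolT.
Qed.

Lemma attainedI l B C : attained l B -> attained l C -> attained l (fun i => B i && C i).
Proof.
move=> [U [Ul [S SB]]] [V [Vl [S' SC]]].
have hU : opensI U V `<=` U by move=> x [].
have hV : opensI U V `<=` V by move=> x [].
have UVl : oset (opensI U V) l by split.
exists (opensI U V), UVl,
  (boolM (bool_map (att_res phi hU) S) (bool_map (att_res phi hV) S')) => i i5.
transitivity (bit i (SigSub (mem_set UVl) : opensI U V) (bool_map (att_res phi hU) S) &&
   bit i (SigSub (mem_set UVl) : opensI U V) (bool_map (att_res phi hV) S')).
  by rewrite /bit -asbool_and.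
by rewrite !bit_res -(SB i i5) -(SC i i5); congr andb; exact: bit_irr.
Qed.

Lemma attainedU l B C : attained l B -> attained l C -> attained l (fun i => B i || C i).
Proof.
move=> aB aC; apply: attained_ext (attainedN (attainedI (attainedN aB) (attainedN aC))) _.
by move=> i _; rewrite negb_and !negbK.
Qed.

(** The clopen set is that of the prime ideals not containing the attractor of [U]; rest points of
    [U] are exactly those of its attractor. *)
Lemma attained_robust l U (B : nat -> bool) :
  robust l U -> (forall i, (i < 5)%N -> U (m i l) <-> B i) ->
  attained l B.
Proof.
move=> [Om [Oml aU]] UB.
have sA : @is_att_section _ _ _ phi Om (fun k => omega (phi (val k)) U).
  apply/asboolP; split=> [k|k]; first by exists U => //; apply: aU; exact: set_valP.
  by exists Om, U; split=> //; [exact: set_valP|move=> j /aU].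
pose A : att_section phi Om := exist (@is_att_section _ _ _ phi Om) _ sA.
have cS : is_clopen [set p : prime_ideal (att_section phi Om) | ~ pideal p A].
  apply/asboolP; split; first by apply: subbase_open; exists A; right.
  by rewrite -openC; apply: subbase_open; exists A; left; apply/seteqP; split=> p /=;
    [exact: contrapT|move=> ? ?].
exists Om, Oml, (exist (fun S => is_clopen S) _ cS) => i i5.
have E : val A (SigSub (mem_set Oml) : Om) (m i l) <-> U (m i l).
  split; last exact: rest_omega.
  by move=> /(aU l Oml)/interior_subset.
apply/asboolP/idP => /=.
  by move=> /contrapT/E/UB => /(_ i5).
by move=> /(UB i i5)/E h; apply.
Qed.

Lemma attained_allowed l (B : nat -> bool) : 0 < l \/ B 1%N = B 2%N /\ B 3%N = B 2%N ->
  attained l B.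
Proof.
have low j (hj : j = 4%N \/ 0 < l /\ j = 2%N) : attained l (fun i => i < j)%N.
  by have [U [rU UB]] := m_low hj; exact: attained_robust UB.
have high j (hj : j = 1%N \/ 0 < l /\ j = 3%N) : attained l (fun i => j <= i)%N.
  by have [U [rU UB]] := m_high hj; exact: attained_robust UB.
have L4 := low 4%N (or_introl erefl); have G1 := high 1%N (or_introl erefl).
have cst i := attained_const l (B i).
(* Each [e] with an index carries [B] at that place and is false elsewhere; in the merged case [e2]
   covers places 1 to 3 together. *)
have e0 := attainedI (cst 0%N) (attainedN G1).
have e4 := attainedI (cst 4%N) (attainedN L4).
move=> [l0|[B1 B3]].
  have L2 := low 2%N (or_intror (conj l0 erefl)).
  have G3 := high 3%N (or_intror (conj l0 erefl)).
  have e1 := attainedI (cst 1%N) (attainedI L2 G1).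
  have e2 := attainedI (cst 2%N) (attainedI (attainedN L2) (attainedN G3)).
  have e3 := attainedI (cst 3%N) (attainedI L4 G3).
  apply: attained_ext (attainedU e0 (attainedU e1 (attainedU e2 (attainedU e3 e4)))) _.
  by move=> [|[|[|[|[|i]]]]] //= _; rewrite ?andbT ?andbF ?orbF ?orFb.
have e2 := attainedI (cst 2%N) (attainedI L4 G1).
apply: attained_ext (attainedU e0 (attainedU e2 e4)) _.
by move=> [|[|[|[|[|i]]]]] //= _; rewrite ?andbT ?andbF ?orbF ?orFb ?B1 ?B3.
Qed.

(* Bits 1, 2, 3 are carried by the rest points that merge at the bifurcation; the
   second component measures their differences. *)
Definition bitvec (b : nat -> bool) : 'rV['F_2]_3 * 'rV['F_2]_2 :=
  (\row_j (b (2 * j)%N)%:R, \row_j ((b (2 * j).+1)%:R - (b 2%N)%:R)).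

Lemma eq_bitvec b c : (forall i, (i < 5)%N -> b i = c i) -> bitvec b = bitvec c.
Proof.
move=> e; congr pair; apply/rowP => -[j jn]; rewrite !mxE.
  by rewrite e//; case: j jn => [|[|[|]]].
by rewrite !e//; case: j jn => [|[|]].
Qed.

Lemma bitvecB b c : bitvec (fun i => b i (+) c i) = bitvec b - bitvec c.
Proof.
congr pair; apply/rowP => j; rewrite !mxE !F2_boolB//.
by rewrite !opprD !opprK addrACA.
Qed.

Lemma bitvec_inj b c : bitvec b = bitvec c -> forall i, (i < 5)%N -> b i = c i.
Proof.
move=> [/rowP e1 /rowP e2].
have h1 j : (j < 3)%N -> b (2 * j)%N = c (2 * j)%N.
  by move=> j3; have := e1 (Ordinal j3); rewrite !mxE => /F2_bool_inj.
have h2 j : (j < 2)%N -> b (2 * j).+1 = c (2 * j).+1.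
  move=> j2; have := e2 (Ordinal j2); rewrite !mxE (h1 1%N)// => /addIr.
  exact: F2_bool_inj.
by move=> [|[|[|[|[|]]]]]// _;
  [exact: (h1 0%N)|exact: (h2 0%N)|exact: (h1 1%N)|exact: (h2 1%N)|exact: (h1 2%N)].
Qed.

Lemma bitvec_surj v : exists b, bitvec b = v /\ (v.2 = 0 -> b 1%N = b 2%N /\ b 3%N = b 2%N).
Proof.
case: v => u w /=.
(* The inverse of [bitvec]: bits 1 and 3 are recovered by adding bit 2 to the differences. *)
pose e i : 'F_2 := match i with 0 => u 0 0 | 1 => w 0 0 + u 0 1 | 2 => u 0 1
  | 3 => w 0 1 + u 0 1 | _ => u 0 (inord 2) end.
exists (fun i => e i != 0); split.
  congr pair; apply/rowP => j; rewrite !mxE !F2_boolK; move: j.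
    case=> -[|[|[|//]]] lt_j /=; congr (u _ _); apply/val_inj => //=.
    by rewrite inordK.
  by case=> -[|[|//]] lt_j /=; rewrite addrK; congr (w _ _); exact/val_inj.
by move=> w0; rewrite /e w0 !mxE !add0r.
Qed.

(** The value of a clopen set at [l] is its vector of five bits. Equal rest points have equal
    ideals, which makes the differences vanish for [l <= 0]. *)
Lemma boolean_model : model 'rV['F_2]_3 'rV['F_2]_2 idfun (boolean_presheaf phi).
Proof.
pose ev (Om : opens R) l (Oml : oset Om l) (S : boolean_presheaf phi Om) :=
  bitvec (fun i => bit i (SigSub (mem_set Oml) : Om) S).
apply: (@Model _ _ _ _ _ _ ev).
- move=> Om l Oml S S'; rewrite -bitvecB; apply: eq_bitvec => i _; exact: bitB.
- move=> U V h l Ul Vl S; apply: eq_bitvec => i _ /=; rewrite bit_res.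
  exact: bit_irr.
- move=> Om l Oml S e; have z : bitvec (fun=> false) = 0.
    by congr pair; apply/rowP => j; rewrite !mxE// subrr.
  have [|V [h [Vl SV]]] := @bits_eq0 Om (SigSub (mem_set Oml)) S.
    by apply: bitvec_inj; rewrite z.
  by exists V, h.
- move=> Om l Oml S; have [l0|] := leP l 0; [right|by left].
  have [e1 e3] := m_merge l0.
  have eq_rest i j : m i l = m j l ->
      bit i (SigSub (mem_set Oml) : Om) S = bit j (SigSub (mem_set Oml) : Om) S.
    move=> e; congr `[< val S _ >]; apply: prime_ideal_inj.
    by apply/seteqP; split=> A /=; rewrite e.
  apply/rowP => -[j jn]; rewrite !mxE; apply/eqP; rewrite subr_eq0; apply/eqP.
  congr ((nat_of_bool _)%:R) => /=; case: j jn => [|[|//]] _;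
    [exact: (eq_rest 1%N 2%N)|exact: (eq_rest 3%N 2%N)].
- move=> l v lv; have [b [bv bz]] := bitvec_surj v.
  have [|Om [Oml [S SB]]] := @attained_allowed l b; first by case: lv => [|/bz]; [left|right].
  by exists Om, Oml, S; rewrite -bv; apply: eq_bitvec => i i5; exact: SB.
- move=> Om S l Oml; have [V [Vl VS]] := @bit_const 5 Om (SigSub (mem_set Oml)) S.
  by exists V; split=> // k Omk Vk; apply: eq_bitvec => i i5; exact: VS.
Qed.

End BooleanModel.

(** * Conjugacy with the pitchfork *)

(** Times in [[1, 2]] compose to all times from 1 on, so the omega-limit set lies in the closure of
    [U]; being the image of itself under [phi 1], it lies in the open set [U]. *)
Lemma trap_attracting (R : realType) (X : topologicalType) (phi : dynsys R X) U :
  open U -> (forall t y, 1 <= t -> t <= 2 -> closure U y -> U (phi t y)) ->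
  attracting phi U.
Proof.
move=> oU trap.
have trapn (n : nat) t y : 1 <= t -> t <= n%:R + 2 -> closure U y -> U (phi t y).
  elim: n t y => [|n IH] t y t1 tn Uy; first by apply: trap => //; rewrite add0r in tn.
  have [t2|t2] := leP t 2; first exact: trap.
  rewrite -(subrK 1 t) -flowD//; last by rewrite subr_ge0.
  apply: IH; first by lra.
    by move: tn; rewrite -natr1; lra.
  by apply: subset_closure; apply: trap => //; lra.
have tail_sub : tail phi U 1 `<=` U.
  move=> _ [t /= t1 [y Uy <-]]; have [n tn] := nat_above t.
  by apply: (trapn n) => //; [lra|exact: subset_closure].
move=> x Ux; have [y yU <-] := omega_sub_flow ler01 Ux.
rewrite (interior_id U).1//; apply: trap => //; first lra.
exact: closureS tail_sub _ (yU 1 ler01).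
Qed.

Lemma compact_near_all (X : topologicalType) (I : Type) (F : set_system I) (K : set X)
    (P : I -> X -> Prop) : Filter F -> compact K ->
  (forall x, K x -> \forall x' \near x & i \near F, P i x') ->
  \forall i \near F, K `<=` P i.
Proof. by move=> FF /compact_near_coveringP cK h; exact: (cK I F P FF h). Qed.

(** The trapping condition is open and concerns only the compact set of times in [[1, 2]] and points
    in the closure of [U], so it persists for nearby parameters. *)
Lemma robust_trap (R : realType) (X : topologicalType) (phi : param_dynsys R R X) l U :
  open U -> (forall t y, 1 <= t -> t <= 2 -> closure U y -> U (phi l t y)) ->
  robust phi l U.
Proof.
move=> oU trap.
pose K : set (R * X) := `[1, 2]%classic `*` closure U.
have cK : compact K.
  apply: compact_setX; first exact: segment_compact.
  by apply: (subclosed_compact (@closed_closure _ _) (phase_compact (phi l))).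
pose P (k : R) (p : R * X) := U (phi k p.1 p.2).
have nP : \forall k \near l, K `<=` P k.
  apply: (@compact_near_all _ _ (nbhs l) K P) => // -[t y] [/=].
  rewrite in_itv /= => /andP[t1 t2] Uy.
  have /subspace_continuousP/(_ (t, y, l)) := @fiber_continuous _ _ _ phi.
  move=> /(_ (le_trans ler01 t1)) /(_ U) h.
  have {}h := h (open_nbhs_nbhs (conj oU (trap t y t1 t2 Uy))).
  (* Continuity of the flow is available only within nonnegative times, which surround [t] since
     [1 <= t]. *)
  have pos : nbhs (t, y, l) [set q : R * X * R | 0 <= q.1.1].
    exists ([set p : R * X | 0 <= p.1], setT) => /=; last by move=> [p k] [].
    split; last exact: filterT.
    exists ([set s : R | 0 <= s], setT) => /=; last by move=> [s z] [].
    split; last exact: filterT.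
    by apply: (@filterS _ _ _ `]0, +oo[%classic);
      [move=> s /=; rewrite in_itv /= andbT; exact: ltW|
       apply: open_nbhs_nbhs; split; [exact: interval_open|rewrite /= in_itv /= andbT; lra]].
  by apply: filterS2 pos h => -[p k] /= p0 /(_ p0).
exists (Opens (@open_interior _ [set k | K `<=` P k])); split; first exact: nP.
move=> k /interior_subset kP; apply: trap_attracting => // t y t1 t2 Uy.
by apply: (kP (t, y)); split=> //=; rewrite in_itv /= t1.
Qed.

(** Outside a neighbourhood of the preimage at [l0], [h l0] avoids [x l0]; by compactness of [Y],
    [h l] avoids [x l] there for all nearby [l]. *)
Lemma inverse_family_cts (R : realType) (L Y : topologicalType)
    (h : L -> Y -> \bar R) (g : L -> \bar R -> Y) (x : L -> \bar R) :
  compact [set: Y] -> continuous (fun p : L * Y => h p.1 p.2) ->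
  (forall l, cancel (h l) (g l)) -> (forall l, cancel (g l) (h l)) ->
  continuous x -> continuous (fun l => g l (x l)).
Proof.
move=> cY ch hK gK cx l0 N; rewrite nbhsE => -[B [oB Bm] BN].
have cK : compact (~` B).
  by apply: (subclosed_compact _ cY) => //; exact: open_closedC.
have nP : \forall l \near l0, ~` B `<=` (fun y => h l y <> x l).
  apply: (@compact_near_all _ _ (nbhs l0) (~` B) (fun l y => h l y <> x l)) => // y nBy.
  have hy : h l0 y != x l0 by apply/eqP => e; apply: nBy; rewrite -(hK l0 y) e.
  have := @ereal_hausdorff R; rewrite open_hausdorff => /(_ _ _ hy)[[U V] /=].
  rewrite !inE => -[Uy Vx] [oU oV UV].
  have nU : nbhs (l0, y) [set p : L * Y | U (h p.1 p.2)].
    by apply: ch; apply: open_nbhs_nbhs.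
  have nV : nbhs l0 [set l | V (x l)] by apply: cx; apply: open_nbhs_nbhs.
  case: nU => -[A1 A2] [/= A1l A2y] A12.
  exists (A2, A1 `&` [set l | V (x l)]) => /=.
    by split=> //; exact: filterI.
  move=> [y' l'] /= [A2y' [A1l' Vl']] e.
  have : (U `&` V) (x l') by split=> //; rewrite -e; exact: (A12 (l', y')).
  by rewrite UV.
rewrite /nbhs /=; apply: filterS nP => l nl; apply: BN; apply: contrapT => nB.
by have := nl _ nB; rewrite gK.
Qed.

Lemma equilibrium_cts (R : realType) i : continuous (@equilibrium R i).
Proof.
move=> l; case: i => [|[|[|[|i]]]]; rewrite /equilibrium; try exact: cvg_cst.
  apply: (@continuous_comp _ _ _ (fun l => - Num.sqrt l) EFin); last exact: EFin_cts.
  by apply: continuousN; exact: sqrt_continuous.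
apply: (@continuous_comp _ _ _ (fun l : R => Num.sqrt l) EFin); last exact: EFin_cts.
exact: sqrt_continuous.
Qed.

(** * Transport along the conjugacy *)

Section Conjugate.
Variables (R : realType) (Y : topologicalType).
Variables (phi : param_dynsys R R Y) (psi : param_dynsys R R (\bar R)).
Hypothesis pf : pitchfork psi.
Variables (h : R -> Y -> \bar R) (g : R -> \bar R -> Y) (tau : R -> R -> Y -> R).
Hypothesis h_cts : continuous (fun p : R * Y => h p.1 p.2).
Hypothesis g_cts : forall l, continuous (g l).
Hypothesis hK : forall l, cancel (h l) (g l).
Hypothesis gK : forall l, cancel (g l) (h l).
Hypothesis tau_cts : {within [set p : R * R * Y | 0 <= p.1.2],
  continuous (fun p => tau p.1.1 p.1.2 p.2)}.
Hypothesis tau0 : forall l y, tau l 0 y = 0.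
Hypothesis tau_mono : forall l y, strictly_monotone_on `[0, +oo[ (tau l ^~ y).
Hypothesis tau_bij : forall l y, set_bij `[0, +oo[ `[0, +oo[ (tau l ^~ y).
Hypothesis conj : forall l t y, 0 <= t -> h l (phi l t y) = psi l (tau l t y) (h l y).

Lemma tau_ge0 l t y : 0 <= t -> 0 <= tau l t y.
Proof.
move=> t0; have [tf _ _] := tau_bij l y.
by have := tf t; rewrite /= !in_itv /= !andbT; exact.
Qed.

(** A decreasing change of time would take negative values, since it starts at 0. *)
Lemma tau_lt l (s t : R) y : 0 <= s -> s < t -> tau l s y < tau l t y.
Proof.
move=> s0 st; have inI (r : R) : 0 <= r -> `[0, +oo[%classic r.
  by move=> r0; rewrite /= in_itv /= r0.
have [incr|decr] := tau_mono l y.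
  by apply: incr => //; apply: inI => //; apply: le_trans s0 (ltW st).
have := decr 0 1 (inI _ (lexx _)) (inI _ ler01) ltr01.
by rewrite tau0 ltNge tau_ge0.
Qed.

Lemma tau_surj l y s : 0 <= s -> exists2 t, 0 <= t & tau l t y = s.
Proof.
move=> s0; have [_ _ /(_ s)] := tau_bij l y.
rewrite /= in_itv /= s0 => /(_ isT)[t]; rewrite /= in_itv /= andbT => t0 e.
by exists t.
Qed.

Lemma tau_slice l t : 0 <= t -> continuous (tau l t).
Proof.
move=> t0 y N Ny.
have /subspace_continuousP/(_ (l, t, y) t0)/(_ N Ny) hN := tau_cts.
by have := @pair_cts _ _ (l, t) y _ hN; rewrite /nbhs /=; apply: filterS => z; apply.
Qed.

Lemma tau_upper l t : 0 <= t -> exists M, forall y, tau l t y <= M.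
Proof.
move=> t0.
have : \forall M \near +oo, [set: Y] `<=` (fun y => tau l t y <= M).
  apply: (@compact_near_all _ _ +oo setT (fun M y => tau l t y <= M) _
    (phase_compact (phi l))) => y _.
  exists ([set z | tau l t z < tau l t y + 1], [set M | tau l t y + 1 < M]) => /=.
    split; last by exists (tau l t y + 1); split=> //; exact: num_real.
    apply: (@tau_slice l t t0 y [set s : R | s < tau l t y + 1]); apply: open_nbhs_nbhs.
    by split; [exact: open_lt|rewrite /= ltrDl].
  by move=> [z M] /= [h1 h2]; apply/ltW/(lt_trans h1).
move=> [M0 [_ hM]]; exists (M0 + 1) => y; apply: hM => //; lra.
Qed.

(** Each orbit eventually exceeds [M] by surjectivity and monotonicity, and compactness makes the
    waiting time uniform. With [tau_upper], long times for one flow are long times for the other. *)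
Lemma tau_lower l M : exists2 T, 0 <= T & forall t y, T <= t -> M <= tau l t y.
Proof.
have : \forall T \near +oo, [set: Y] `<=` (fun y => forall t, T <= t -> M <= tau l t y).
  apply: (@compact_near_all _ _ +oo setT (fun T y => forall t, T <= t -> M <= tau l t y) _
    (phase_compact (phi l))) => y _.
  have [|s s0 es] := @tau_surj l y (Num.max 0 M + 1).
    by rewrite addr_ge0// le_max lexx.
  exists ([set z | M < tau l s z], [set T | s < T]) => /=.
    split; last by exists s; split=> //; exact: num_real.
    apply: (@tau_slice l s s0 y [set r : R | M < r]); apply: open_nbhs_nbhs.
    split; first exact: open_gt.
    by rewrite /= es ltr_pwDr// le_max lexx orbT.
  move=> [z T] /= [h1 h2] t Tt; apply: ltW; apply: lt_trans h1 _.
  by apply: tau_lt => //; exact: lt_le_trans Tt.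
move=> [T0 [_ hT]]; exists (Num.max 0 (T0 + 1)); first by rewrite le_max lexx.
move=> t y Tt; apply: (hT (Num.max 0 (T0 + 1))) => //.
by rewrite lt_max; apply/orP; right; lra.
Qed.

Definition rest_pt (i : nat) (l : R) : Y := g l (equilibrium i l).

Lemma h_inj l : injective (h l). Proof. exact: can_inj (hK l). Qed.

Lemma rest_pt_cts i : continuous (rest_pt i).
Proof.
apply: (inverse_family_cts (phase_compact (phi 0)) h_cts hK gK).
exact: equilibrium_cts.
Qed.

Lemma rest_pt_rest i l : rest (phi l) (rest_pt i l).
Proof.
move=> t t0; apply: (@h_inj l); rewrite conj// gK.
by apply: (equilibrium_rest pf); exact: tau_ge0.
Qed.

Lemma rest_pt_merge l : l <= 0 -> rest_pt 1 l = rest_pt 2 l /\ rest_pt 3 l = rest_pt 2 l.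
Proof.
move=> l0; have s0 : Num.sqrt l = 0 by apply/eqP; rewrite sqrtr_eq0.
by rewrite /rest_pt /= s0 oppr0.
Qed.

Lemma source_backward l x z i : h l x = z%:E ->
  (forall N, nbhs (equilibrium i l) N ->
    exists2 T : R, 0 < T & forall t y, T <= t -> psi l t y = z%:E -> N y) ->
  forall N, nbhs (rest_pt i l) N ->
    exists2 T, 0 <= T & forall t y, T <= t -> phi l t y = x -> N y.
Proof.
move=> hx src N Nm; have [T' T'0 hT'] := src _ (g_cts Nm).
have [T T0 hT] := tau_lower l T'; exists T => // t y Tt yx.
have := hT' _ (h l y) (hT t y Tt); rewrite /= hK; apply.
by rewrite -conj ?yx//; exact: le_trans Tt.
Qed.

(* A point which is not at rest belongs to an attractor if and only if the rest
   point it comes from does. *)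
Lemma rest_pt_det l A B : attractor (phi l) A -> attractor (phi l) B ->
  (forall i, (i < 5)%N -> A (rest_pt i l) -> B (rest_pt i l)) -> A `<=` B.
Proof.
move=> [U aU ->] [V aV ->] AB x Ux.
have eq_rest i : h l x = equilibrium i l -> x = rest_pt i l.
  by move=> e; rewrite /rest_pt -e hK.
have case_rest i : (i < 5)%N -> h l x = equilibrium i l -> omega (phi l) V x.
  by move=> i5 /eq_rest e; rewrite e; apply: AB => //; rewrite -e.
case hx : (h l x) => [z| |]; last 2 first.
- exact: (case_rest 4%N).
- exact: (case_rest 0%N).
have [z0|z0] := eqVneq (cubic l z) 0.
  by have [i i5 zi] := cubic_eq0 z0; apply: (case_rest i) => //; rewrite hx.
have [i i5 /(source_backward hx) src] := pitchfork_source pf z0.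
(* Past points of [x] can be chosen in the attractor, and they accumulate at the rest point; the
   attractor is closed. *)
have Am : omega (phi l) U (rest_pt i l).
  apply: (@closed_omega _ _ (phi l) U) => N /src[T T0 hT].
  have [y Uy yx] := omega_sub_flow T0 Ux.
  by exists y; split=> //; exact: hT yx.
have Vm : (V°)%classic (rest_pt i l) by apply/aV/AB.
have [T T0 hT] := src _ Vm.
(* Conversely, it is enough to reach [x] from [V] in some time at least [t]; past points of [x] at
   least [T] back do lie in [V]. *)
move=> t t0; apply: subset_closure; pose r := Num.max t T.
have r0 : 0 <= r by rewrite le_max t0.
(* Going back by a time [s] that dominates every change of time of length [r] forces the original
   time [t'] to be at least [r]. *)
have [M hM] := tau_upper l r0; pose s := Num.max 0 M.
have s0 : 0 <= s by rewrite le_max lexx.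
have [y0 y0z] := pitchfork_surj pf l z%:E s0.
have [t' t'0 et'] := tau_surj l (g l y0) s0.
have yx : phi l t' (g l y0) = x.
  by apply: (@h_inj l); rewrite conj// et' gK y0z hx.
have rt' : r <= t'.
  rewrite leNgt; apply/negP => t'r; have := tau_lt l (g l y0) t'0 t'r.
  rewrite et' ltNge => /negP; apply; apply: le_trans (hM _) _.
  by rewrite le_max lexx orbT.
exists t'; first by apply: le_trans rt'; rewrite le_max lexx.
exists (g l y0) => //; apply: hT yx.
by apply: le_trans rt'; rewrite le_max lexx orbT.
Qed.

Lemma h_slice l : continuous (h l).
Proof. by move=> y N Ny; exact: (@pair_cts _ _ l y _ (h_cts (x := (l, y)) Ny)). Qed.

(** Where [cubic l] is negative, the level [c] can only be crossed downwards. The region is drawn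
    with [h l] and kept fixed as the parameter varies. *)
Lemma robust_low l c : cubic l c < 0 -> robust phi l [set y | (h l y < c%:E)%E].
Proof.
move=> c0; have op : open [set y | (h l y < c%:E)%E].
  exact: (proj1 (continuousP _) (@h_slice l) [set z | (z < c%:E)%E]
    (@open_ereal_lt_ereal _ _)).
apply: robust_trap => // t y t1 t2 Uy; rewrite /= conj; last by lra.
have t0 : 0 < t by lra.
apply: (pitchfork_trap pf) => //; last by rewrite -(tau0 l y); exact: tau_lt.
have cl : closed [set y | (h l y <= c%:E)%E].
  exact: (proj1 (continuous_closedP _) (@h_slice l) [set z | (z <= c%:E)%E]
    (@closed_ereal_ge_ereal _ _)).
by apply: cl; apply: closureS Uy => w /= /ltW.
Qed.

Lemma robust_high l c : 0 < cubic l c -> robust phi l [set y | (c%:E < h l y)%E].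
Proof.
move=> c0; have op : open [set y | (c%:E < h l y)%E].
  exact: (proj1 (continuousP _) (@h_slice l) [set z | (c%:E < z)%E]
    (@open_ereal_gt_ereal _ _)).
apply: robust_trap => // t y t1 t2 Uy; rewrite /= conj; last by lra.
have t0 : 0 < t by lra.
apply: (pitchfork_trap_gt pf) => //; last by rewrite -(tau0 l y); exact: tau_lt.
have cl : closed [set y | (c%:E <= h l y)%E].
  exact: (proj1 (continuous_closedP _) (@h_slice l) [set z | (c%:E <= z)%E]
    (@closed_ereal_le_ereal _ _)).
by apply: cl; apply: closureS Uy => w /= /ltW.
Qed.

(** A level above all finite equilibria, where the flow descends from infinity. *)
Lemma sqrt_bound (l : R) : let c := `|l| + 1 in
  [/\ 0 < c, Num.sqrt l < c & cubic l c < 0].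
Proof.
have n0 := normr_ge0 l; have ln := ler_norm l; set c := `|l| + 1 => /=.
have c0 : 0 < c by rewrite /c; lra.
have lc : l < c ^+ 2 by apply: le_lt_trans ln _; rewrite /c; nra.
split=> //.
  by rewrite -[ltRHS]ger0_norm ?ltW// -sqrtr_sqr ltr_sqrt// exprn_gt0.
rewrite (_ : cubic l c = c * (l - c ^+ 2)); last by rewrite /cubic; ring.
by rewrite pmulr_rlt0// subr_lt0.
Qed.

(** The midpoint of the two lower finite equilibria; with [s = Num.sqrt l] the value there is
    [- (3 / 8 * s ^+ 3)]. *)
Lemma sqrt_half (l : R) : 0 < l -> cubic l (- (Num.sqrt l / 2)) < 0.
Proof.
move=> l0; have s0 : 0 < Num.sqrt l by rewrite sqrtr_gt0.
have e : l = Num.sqrt l ^+ 2 by rewrite sqr_sqrtr// ltW.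
rewrite {1}e /cubic; set s := Num.sqrt l in s0 *.
rewrite (_ : _ - _ = - (3 / 8 * s ^+ 3)); last by field.
by rewrite oppr_lt0 mulr_gt0// exprn_gt0.
Qed.

(** The cut below [+oo] is made at [|l| + 1], the cut after the first two rest points at
    [- (Num.sqrt l / 2)]; [rest_pt_high] uses the mirror images. *)
Lemma rest_pt_low l j : j = 4%N \/ 0 < l /\ j = 2%N ->
  exists U, robust phi l U /\ forall i, (i < 5)%N -> U (rest_pt i l) <-> (i < j)%N.
Proof.
have [c0 sc cc] := sqrt_bound l; have s0 := sqrtr_ge0 l.
case=> [->|[l0 ->]].
  eexists; split; first exact: robust_low cc.
  move=> [|[|[|[|[|i]]]]] // _; rewrite /= gK /= ?ltNyr ?lte_fin //=; split=> // _.
  lra.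
eexists; split; first exact: (robust_low (sqrt_half l0)).
have s1 : 0 < Num.sqrt l by rewrite sqrtr_gt0.
move=> [|[|[|[|[|i]]]]] // _; rewrite /= gK /= ?ltNyr ?lte_fin //=; split=> // ; lra.
Qed.

Lemma rest_pt_high l j : j = 1%N \/ 0 < l /\ j = 3%N ->
  exists U, robust phi l U /\ forall i, (i < 5)%N -> U (rest_pt i l) <-> (j <= i)%N.
Proof.
have [c0 sc cc] := sqrt_bound l; have s0 := sqrtr_ge0 l.
case=> [->|[l0 ->]].
  have cc' : 0 < cubic l (- (`|l| + 1)) by rewrite cubicN oppr_gt0.
  eexists; split; first exact: robust_high cc'.
  move=> [|[|[|[|[|i]]]]] // _; rewrite /= gK /= ?ltry ?lte_fin //=; split=> // _; lra.
have cc' : 0 < cubic l (Num.sqrt l / 2).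
  by rewrite -[X in cubic l X]opprK cubicN oppr_gt0 sqrt_half.
eexists; split; first exact: (robust_high cc').
have s1 : 0 < Num.sqrt l by rewrite sqrtr_gt0.
move=> [|[|[|[|[|i]]]]] // _; rewrite /= gK /= ?ltry ?lte_fin //=; split=> //; lra.
Qed.

Lemma conjugate_model : model 'rV['F_2]_3 'rV['F_2]_2 idfun (attractor_sheaf phi).
Proof.
apply: model_sheafify; apply: (@boolean_model _ _ _ rest_pt).
- exact: rest_pt_cts.
- exact: rest_pt_rest.
- exact: rest_pt_merge.
- exact: rest_pt_det.
- exact: rest_pt_low.
- exact: rest_pt_high.
Qed.

End Conjugate.

Theorem theorem10p7 (R : realType) (Y : metricType R)
    (phi : param_dynsys R R Y) (psi : param_dynsys R R (\bar R)) :
  pitchfork psi -> conjugate phi psi ->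
  [/\ forall k : nat, (1 <= k)%N ->
        zmod_zero (sheaf_cohomology (attractor_sheaf phi) k),
      zmod_iso (sheaf_cohomology (attractor_sheaf phi) 0) 'rV['F_2]_3,
      exists lam0 : R, forall (a : R) (k : nat),
        (k = 1%N /\ lam0 < a ->
          zmod_iso (relative_cohomology (attractor_sheaf phi) `[a, +oo[ k)
                   'rV['F_2]_2) /\
        (k <> 1%N \/ a <= lam0 ->
          zmod_zero (relative_cohomology (attractor_sheaf phi) `[a, +oo[ k)) &
      forall (a : R) (k : nat),
        zmod_zero (relative_cohomology (attractor_sheaf phi) `]-oo, a] k)].
Proof.
move=> pf [h [tau [h_cts tau_cts hP _]]]; apply: model_cohomology.
have inv l : exists g : \bar R -> Y, [/\ continuous g, cancel (h l) g & cancel g (h l)].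
  by have [[_ ?]] := hP l.
have [g gP] := choice inv.
apply: (@conjugate_model _ _ _ _ pf h g tau) => //.
- by move=> l; have [] := gP l.
- by move=> l; have [] := gP l.
- by move=> l; have [] := gP l.
- by move=> l; have [] := hP l.
- by move=> l; have [] := hP l.
- by move=> l; have [] := hP l.
- by move=> l; have [] := hP l.
Qed.
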